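(* Assume that $p/(n_1+n_2) \to y \in (0,1)$ and that $\Delta=\sqrt{(\mu_1-\mu_2)^{T}\Sigma^{-1}(\mu_1-\mu_2)}$ is a constant. Then the misclassification rate $$R_{\mathrm{LDA2}}=\Phi\left(\frac{-(\mu_1-\mu_2)^{T} S_n^{-1} (\mu_1-\mu_2) }{2\sqrt{(\mu_1-\mu_2)^{T} S_n^{-1}\Sigma S_n^{-1} (\mu_1-\mu_2)}}\right)$$ satisfies $$R_{\mathrm{LDA2}} \xrightarrow{\;p\;} \Phi\left(- \frac{\Delta}{2} \sqrt{1-y}\right).$$
   Context: Setting (asymptotic along a sequence of problems with $p$ and $n=n_1+n_2$ tending to infinity): $\mu_1\neq\mu_2$ are vectors in $\mathbb{R}^p$ and $\Sigma$ is a $p\times p$ (invertible) covariance matrix, all allowed to depend on $p$. $\{X_{1,j}\}_{j=1}^{n_1}$ and $\{X_{2,j}\}_{j=1}^{n_2}$ are independent i.i.d. samples from $N_p(\mu_1,\Sigma)$ and $N_p(\mu_2,\Sigma)$ respectively, $\bar X_k=\frac{1}{n_k}\sum_{j=1}^{n_k}X_{k,j}$, and $$S_n=\frac{1}{n-2}\sum_{k=1}^2\sum_{j=1}^{n_k}(X_{k,j}-\bar X_k)(X_{k,j}-\bar X_k)^{T}.$$ $\Phi$ is the standard normal distribution function and $\xrightarrow{p}$ denotes convergence in probability. The quantity $\Delta$ is assumed to be a constant (not depending on $p,n_1,n_2$). $R_{\mathrm{LDA2}}$ is the misclassification rate, conditional on the samples and with equal weights $1/2$ on the two types of error, of the classifier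 that assigns a new independent observation $X$ to class 1 if and only if $\left(X-\frac{\mu_1+\mu_2}{2}\right)^{T}S_n^{-1}(\mu_1-\mu_2)>0$, where $X$ belongs to class $k$ if $X\sim N(\mu_k,\Sigma)$. *)

(* Defs.v *)
From HB Require Import structures.
From mathcomp Require Import all_boot all_order all_algebra.
From mathcomp Require Import all_classical all_reals all_analysis.

Set Implicit Arguments.
Unset Strict Implicit.
Unset Printing Implicit Defensive.

Import Order.TTheory GRing.Theory Num.Theory.
Import numFieldNormedType.Exports.

Local Open Scope classical_set_scope.
Local Open Scope ring_scope.

Definition bilin (R : realType) (p : nat) (u : 'cV[R]_p) (M : 'M[R]_p)
    (v : 'cV[R]_p) : R :=
  (u^T *m M *m v) 0 0.

Definition covariance_mx (R : realType) (p : nat) (M : 'M[R]_p) : Prop :=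
  M^T = M /\ (forall v : 'cV[R]_p, 0 <= bilin v M v).

Definition std_normal_cdf (R : realType) (x : R) : R :=
  fine (normal_prob (0 : R) 1 `]-oo, x]).

(* The sigma-algebra generated by a random vector, resp. by a family of random
   vectors. *)
Definition sigma_vec (R : realType) (d : measure_display)
    (T : measurableType d) (p : nat) (X : T -> 'cV[R]_p) : set (set T) :=
  <<s \bigcup_(i in [set: 'I_p])
        g_sigma_algebra_preimage (fun w => X w i 0) >>.

Definition sigma_vecs (R : realType) (d : measure_display)
    (T : measurableType d) (I : Type) (p : nat) (X : I -> T -> 'cV[R]_p) :
    set (set T) :=
  <<s \bigcup_(i in [set: I]) sigma_vec (X i) >>.

Definition mutually_independent (R : realType) (d : measure_display)
    (T : measurableType d) (P : probability T R) (I : finType)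
    (G : I -> set (set T)) : Prop :=
  forall (J : {set I}) (E : I -> set T), (forall i, i \in J -> G i (E i)) ->
    P (\bigcap_(i in [set` J]) E i) = (\prod_(i in J) P (E i))%E.

Definition independent2 (R : realType) (d : measure_display)
    (T : measurableType d) (P : probability T R) (G H : set (set T)) : Prop :=
  forall A B : set T, G A -> H B -> P (A `&` B) = (P A * P B)%E.

(* X ~ N_p(mu, Sigma), by the affine-image definition: X = mu + A Z with
   A A^T = Sigma and Z a vector of i.i.d. standard normal variables on the same
   probability space. For invertible Sigma this depends only on the law of X,
   since Z = A^-1 (X - mu); it is used only for invertible Sigma. *)
Definition multivariate_normal (R : realType) (d : measure_display)
    (T : measurableType d) (P : probability T R) (p : nat)
    (mu : 'cV[R]_p) (Sigma : 'M[R]_p) (X : T -> 'cV[R]_p) : Prop :=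
  exists (A : 'M[R]_p) (Z : 'I_p -> {RV P >-> R}),
    [/\ A *m A^T = Sigma,
        forall (i : 'I_p) (B : set R), measurable B ->
          distribution P (Z i) B = normal_prob 0 1 B,
        mutually_independent P (fun i => g_sigma_algebra_preimage (Z i)) &
        forall w, X w = mu + A *m (\col_i Z i w)].

Definition sample_mean (R : realType) (p n : nat) (x : 'I_n -> 'cV[R]_p) :
    'cV[R]_p :=
  n%:R^-1 *: \sum_(j < n) x j.

Definition scatter (R : realType) (p n : nat) (x : 'I_n -> 'cV[R]_p) :
    'M[R]_p :=
  \sum_(j < n) ((x j - sample_mean x) *m (x j - sample_mean x)^T).

Definition pooled_cov (R : realType) (p n1 n2 : nat)
    (x1 : 'I_n1 -> 'cV[R]_p) (x2 : 'I_n2 -> 'cV[R]_p) : 'M[R]_p :=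
  ((n1 + n2)%:R - 2)^-1 *: (scatter x1 + scatter x2).

Definition pool (A : Type) (n1 n2 : nat) (x1 : 'I_n1 -> A) (x2 : 'I_n2 -> A)
    (i : 'I_n1 + 'I_n2) : A :=
  match i with inl j => x1 j | inr j => x2 j end.

(* [true] when the observation x is assigned to class 1. *)
Definition lda2_class1 (R : realType) (p : nat) (mu1 mu2 : 'cV[R]_p)
    (S : 'M[R]_p) (x : 'cV[R]_p) : bool :=
  0 < bilin (x - 2^-1 *: (mu1 + mu2)) (invmx S) (mu1 - mu2).

(* f is a version of the conditional probability of E given the
   sub-sigma-algebra G. *)
Definition cond_prob_version (R : realType) (d : measure_display)
    (T : measurableType d) (P : probability T R) (G : set (set T))
    (E : set T) (f : T -> R) : Prop :=
  [/\ forall B : set R, measurable B -> G (f @^-1` B),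
      P.-integrable setT (EFin \o f) &
      forall A, G A -> (\int[P]_(w in A) (f w)%:E)%E = P (A `&` E)].

(* r is (a version of) the misclassification rate, conditional on the samples
   and with weights 1/2, of the above classifier; Y1 and Y2 are the new
   observations from class 1 and from class 2. *)
Definition lda2_rate (R : realType) (d : measure_display)
    (T : measurableType d) (P : probability T R) (p n1 n2 : nat)
    (mu1 mu2 : 'cV[R]_p) (X1 : 'I_n1 -> T -> 'cV[R]_p)
    (X2 : 'I_n2 -> T -> 'cV[R]_p) (Y1 Y2 : T -> 'cV[R]_p) (r : T -> R) :
    Prop :=
  let S w := pooled_cov (X1 ^~ w) (X2 ^~ w) in
  let G := sigma_vecs (pool X1 X2) in
  exists e1 e2 : T -> R,
    [/\ cond_prob_version P G
          [set w | ~~ lda2_class1 mu1 mu2 (S w) (Y1 w)] e1,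
        cond_prob_version P G
          [set w | lda2_class1 mu1 mu2 (S w) (Y2 w)] e2 &
        forall w, r w = (e1 w + e2 w) / 2].

(* The probability space may change along the sequence, as is usual for
   convergence in probability to a constant. *)
Definition cvg_in_probability (R : realType) (d : nat -> measure_display)
    (T : forall m, measurableType (d m)) (P : forall m, probability (T m) R)
    (V : forall m, T m -> R) (c : R) : Prop :=
  forall eps : R, 0 < eps ->
    P m [set w | eps < `|V m w - c|] @[m --> \oo] --> (0 : \bar R)%E.

(* Main.v *)
(* Let B whiten Sigma and carry mu1 - mu2 to Delta e_0.  A reflection of the
   sample indices turns B (n-2) S_n B^T into the Gram matrix W of a p x (n-2)
   matrix of independent standard normals, so that for invertible W the
   argument of Phi is - Delta (W^-1)_00 / (2 sqrt ((W^-2)_00)).  Writing beta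
   for the coefficients of the regression of the first row on the others,
   (W^-2)_00 = (1 + |beta|^2) (W^-1)_00 ^ 2, and the argument is
   - Delta / (2 sqrt (1 + |beta|^2)).  Orthogonal invariance, applied first to
   the first row and then to the others, shows that |beta|^2 has the law of a
   quotient of independent chi-squares with p-1 and n-p degrees of freedom, and
   Chernoff's bound makes it concentrate at y / (1 - y).

   The formula for the conditional rate holds because, the sample being frozen,
   the linear classifier sees a one-dimensional normal variable; Fubini for the
   independent pair (sample, new observation) and the uniqueness of conditional
   probabilities do the rest. *)

(* The rotation that simplifies the first row depends on the other rows [G], and the one that
   simplifies [G] depends on the first row; each is applied with the other part frozen, by Fubini in
   one order and then in the other. Given [G], a polar decomposition [G = M V], with [M] symmetric
   and [V] the top rows of an orthogonal [U], turns |beta|^2 into z^T (G G^T)^-1 z, where z holds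
   the leading coordinates of the rotated first row. Given z, rotating the rows of [G] turns this
   into |z|^2 ((G G^T)^-1)_00, whose second factor is the inverse of a squared residual. Polar
   decomposition is obtained by maximising a trace over the compact orthogonal group, so neither
   spectral theory nor Wishart densities enter. Gaussian invariance is proved in coordinate planes,
   from shears and the radial density, and spreads to all orthogonal matrices through Householder
   reflections. Numerator and denominator are controlled by a union bound at fixed sample size, so a
   probability space that changes along the sequence does no harm. *)
Require Import Defs.
From HB Require Import structures.
From mathcomp Require Import all_boot all_order all_algebra.
From mathcomp Require Import all_classical all_reals all_analysis.
From mathcomp Require Import measurable_realfun.
From mathcomp Require Import ring lra zify.

Set Implicit Arguments.
Unset Strict Implicit.
Unset Printing Implicit Defensive.

Import Order.TTheory GRing.Theory Num.Theory.
Import numFieldNormedType.Exports.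

Local Open Scope classical_set_scope.
Local Open Scope ring_scope.

(** * Orthogonal matrices and Gram matrices *)

Section orthogonal.
Context {R : realType}.

Definition sqnorm n (v : 'cV[R]_n) : R := \sum_i v i 0 ^+ 2.

Lemma sqnormE n (v : 'cV[R]_n) : v^T *m v = (sqnorm v)%:M.
Proof.
apply/matrixP => i j; rewrite !ord1 !mxE eqxx mulr1n.
by apply: eq_bigr => k _; rewrite mxE expr2.
Qed.

Lemma sqnorm_dot n (v : 'cV[R]_n) : sqnorm v = (v^T *m v) 0 0.
Proof. by rewrite sqnormE mxE eqxx mulr1n. Qed.

Lemma sqnorm_ge0 n (v : 'cV[R]_n) : 0 <= sqnorm v.
Proof. by apply: sumr_ge0 => i _; exact: sqr_ge0. Qed.

Lemma sqnorm_eq0 n (v : 'cV[R]_n) : (sqnorm v == 0) = (v == 0).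
Proof.
apply/idP/eqP => [|->]; last by rewrite /sqnorm big1// => i _; rewrite mxE expr0n.
rewrite psumr_eq0 => [/allP v0|i _]; last exact: sqr_ge0.
apply/colP => i; rewrite mxE; apply/eqP; rewrite -sqrf_eq0.
by apply: v0; rewrite mem_index_enum.
Qed.

Lemma sqnormZ n (a : R) (v : 'cV[R]_n) : sqnorm (a *: v) = a ^+ 2 * sqnorm v.
Proof. by rewrite /sqnorm mulr_sumr; apply: eq_bigr => i _; rewrite mxE exprMn. Qed.

Lemma mulmx_tr_eq0 m n (A : 'M[R]_(m, n)) : A *m A^T = 0 -> A = 0.
Proof.
move=> A0; apply/matrixP => i j.
have : (row i A)^T = 0.
  apply/eqP; rewrite -sqnorm_eq0.
  have := congr1 (fun M : 'M[R]_m => M i i) A0; rewrite !mxE => {}A0; rewrite -[X in _ == X]A0.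
  by apply/eqP/eq_bigr => k _; rewrite !mxE expr2.
by move/colP/(_ j); rewrite !mxE.
Qed.

Definition orthomx n (U : 'M[R]_n) := U *m U^T = 1%:M.

Lemma orthomx_tr n (U : 'M[R]_n) : orthomx U -> U^T *m U = 1%:M.
Proof. exact: mulmx1C. Qed.

Lemma orthomx1 n : orthomx (1%:M : 'M[R]_n).
Proof. by rewrite /orthomx trmx1 mulmx1. Qed.

Lemma orthomxM n (O U : 'M[R]_n) : orthomx O -> orthomx U -> orthomx (O *m U).
Proof.
by move=> hO hU; rewrite /orthomx trmx_mul mulmxA -(mulmxA O) hU mulmx1.
Qed.

Lemma orthomx_sqnorm n (U : 'M[R]_n) v : orthomx U -> sqnorm (U *m v) = sqnorm v.
Proof.
move=> /orthomx_tr hO; have := sqnormE (U *m v).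
rewrite trmx_mul mulmxA -(mulmxA _ U^T) hO mulmx1 sqnormE.
by move/matrixP/(_ 0 0); rewrite !mxE eqxx !mulr1n.
Qed.

Lemma trmxZ m n (a : R) (A : 'M[R]_(m, n)) : (a *: A)^T = a *: A^T.
Proof. exact: linearZ. Qed.

Lemma col_mulmx m n p (A : 'M[R]_(m, n)) (B : 'M[R]_(n, p)) j :
  col j (A *m B) = A *m col j B.
Proof. by rewrite !colE mulmxA. Qed.

(** The Householder reflection in the hyperplane orthogonal to [v], when [v] is a unit vector. *)
Definition refl n (v : 'cV[R]_n) : 'M[R]_n := 1%:M - 2 *: (v *m v^T).

Lemma trmx_refl n (v : 'cV[R]_n) : (refl v)^T = refl v.
Proof. by rewrite /refl linearB linearZ/= trmx1 trmx_mul trmxK. Qed.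

Lemma refl_mul m n (v : 'cV[R]_n) (u : 'M[R]_(n, m)) :
  refl v *m u = u - 2 *: (v *m (v^T *m u)).
Proof. by rewrite mulmxBl mul1mx -scalemxAl mulmxA. Qed.

Lemma refl_orth n (v : 'cV[R]_n) : sqnorm v = 1 -> orthomx (refl v).
Proof.
move=> v1; rewrite /orthomx trmx_refl refl_mul.
have -> : v^T *m refl v = - v^T.
  rewrite mulmxBr mulmx1 -scalemxAr mulmxA sqnormE v1 mul1mx.
  by rewrite scaler_nat mulr2n opprD addrA subrr sub0r.
by rewrite mulmxN scalerN opprK subrK.
Qed.

Lemma sqnormB n (u v : 'cV[R]_n) :
  sqnorm (u - v) = sqnorm u + sqnorm v - 2 * (v^T *m u) 0 0.
Proof.
rewrite /sqnorm !mxE mulr_sumr -sumrN -!big_split/=.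
by apply: eq_bigr => i _; rewrite !mxE; ring.
Qed.

Lemma refl_exchange n (a b : 'cV[R]_n) : sqnorm a = sqnorm b -> a != b ->
  let v := (Num.sqrt (sqnorm (a - b)))^-1 *: (a - b) in
  sqnorm v = 1 /\ refl v *m a = b.
Proof.
move=> ab anb v; have d0 : 0 < sqnorm (a - b).
  by rewrite lt0r sqnorm_ge0 sqnorm_eq0 subr_eq0 anb.
have d2 : (Num.sqrt (sqnorm (a - b)))^-1 ^+ 2 = (sqnorm (a - b))^-1.
  by rewrite exprVn sqr_sqrtr// ltW.
split; first by rewrite sqnormZ d2 mulVf// gt_eqF.
rewrite refl_mul /v; set c := _^-1 in d2 *; set u := a - b in d2 *.
have -> : (c *: u) *m ((c *: u)^T *m a) = c ^+ 2 *: (u *m (u^T *m a)).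
  by rewrite [(c *: u)^T]linearZ/= -!scalemxAl -scalemxAr scalerA.
rewrite d2 scalerA /u {c d2 u}.
(* Equal norms enter here: <a - b, a> is half of |a - b|^2, so the reflection subtracts exactly
   [a - b] from [a]. *)
have -> : (a - b)^T *m a = (2^-1 * sqnorm (a - b))%:M.
  apply/matrixP => i j; rewrite !ord1 [RHS]mxE eqxx mulr1n sqnormB ab.
  rewrite linearB/= mulmxBl sqnormE -ab !mxE eqxx mulr1n.
  by field.
by rewrite mul_mx_scalar scalerA mulrA mulrAC mulfVK ?gt_eqF// divff// scale1r subKr.
Qed.

Lemma reflection_to n (a b : 'cV[R]_n) : sqnorm a = sqnorm b ->
  exists2 U : 'M[R]_n, orthomx U & U *m a = b.
Proof.
move=> ab; have [<-|anb] := eqVneq a b.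
  by exists 1%:M; [exact: orthomx1 | rewrite mul1mx].
have [v1 vab] := refl_exchange ab anb.
by exists (refl ((Num.sqrt (sqnorm (a - b)))^-1 *: (a - b))) => //; exact: refl_orth.
Qed.

(** The sign of [c] is free; [class_rate] later exploits both signs. *)
Lemma reflection_to_axis n (v : 'cV[R]_n.+1) (c : R) : sqnorm v = c ^+ 2 ->
  exists2 U : 'M[R]_n.+1, orthomx U & U *m v = c *: delta_mx 0 0.
Proof.
move=> vc; apply: reflection_to; rewrite sqnormZ vc.
rewrite [X in _ * X](_ : _ = 1) ?mulr1// /sqnorm (bigD1 0)//= mxE !eqxx expr1n.
by rewrite big1 ?addr0// => i /negPf i0; rewrite mxE i0 expr0n.
Qed.

(** Induction on the number of basis vectors moved by [U]. If e_j is moved, the reflection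
    exchanging U e_j and e_j puts column j in place, and it leaves alone every column e_i already in
    place, since e_i is orthogonal to both vectors. *)
Lemma orthomx_refl_ind n (Q : 'M[R]_n -> Prop) :
    Q 1%:M ->
    (forall v M, sqnorm v = 1 -> Q M -> Q (refl v *m M)) ->
  forall U, orthomx U -> Q U.
Proof.
move=> Q1 QM U hO.
pose moved (M : 'M[R]_n) := [pred j | col j M != col j 1%:M].
have [k] := ubnP #|moved U|; elim: k U hO => // k IH U hO Ok.
have [j Oj|fixO] := pickP (moved U); last first.
  suff -> : U = 1%:M by [].
  apply/matrixP => i j; have /negbT := fixO j.
  by rewrite /= negbK => /eqP/colP/(_ i); rewrite !mxE.
have colO i l : (col i U)^T *m col l U = (i == l)%:R%:M.
  apply/matrixP => x y; rewrite !ord1 !mxE eqxx mulr1n.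
  have /matrixP/(_ i l) := orthomx_tr hO; rewrite !mxE => <-.
  by apply: eq_bigr => m _; rewrite !mxE.
have col1 i : sqnorm (col i U) = sqnorm (col i 1%:M).
  have := colO i i; rewrite sqnormE eqxx => /matrixP/(_ 0 0); rewrite !mxE !eqxx !mulr1n => ->.
  rewrite /sqnorm (bigD1 i)//= big1 ?addr0; first by rewrite !mxE eqxx expr1n.
  by move=> l /negPf li; rewrite !mxE li expr0n.
have [v1 vab] := refl_exchange (col1 j) Oj.
set v := _ *: _ in v1 vab.
have vO := refl_orth v1.
have -> : U = refl v *m (refl v *m U).
  by rewrite mulmxA -{2}(trmx_refl v) vO mul1mx.
apply: (QM) => //; apply: IH; first exact: orthomxM.
apply: leq_trans (_ : #|moved U| <= k)%N; last by rewrite -ltnS.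
apply: proper_card; apply/properP; split; last first.
  by exists j; rewrite !inE ?Oj// negbK col_mulmx vab.
apply/fintype.subsetP => i; rewrite !inE; apply: contraNN => /eqP Oi.
have ij : i != j by apply: contraNneq Oj => <-; apply/eqP.
rewrite col_mulmx Oi refl_mul.
suff -> : v^T *m col i 1%:M = 0 by rewrite mulmx0 scaler0 subr0.
rewrite /v [_^T]linearZ/= -scalemxAl [(_ - _)^T]linearB/= mulmxBl -{1}Oi colO eq_sym (negPf ij).
have -> : (col j 1%:M)^T *m col i 1%:M = 0 :> 'M[R]_1.
  apply/matrixP => x y; rewrite !mxE big1// => l _; rewrite !mxE.
  by have [->|] := eqVneq l j; rewrite ?mul0r// eq_sym (negPf ij) mulr0.
have -> : (false%:R : R)%:M = 0 :> 'M[R]_1 by rewrite raddf0.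
by rewrite subr0 scaler0.
Qed.

Lemma mxtrace_mul_col n (u v : 'cV[R]_n) (M : 'M[R]_n) :
  \tr (u *m v^T *m M) = (v^T *m M *m u) 0 0.
Proof. by rewrite -mulmxA mxtrace_mulC /mxtrace big_ord1. Qed.

(* Compares [M] with its products by two reflections, one along [e_i] and
   one along [e_i + t e_j] with [t] small. *)
Lemma max_trace_sym n (M : 'M[R]_n) :
  (forall U, orthomx U -> \tr (U *m M) <= \tr M) -> M^T = M.
Proof.
move=> maxM.
(* The expansion of the trace of [refl u *m refl v *m M], compared with the maximal value
   [\tr M]. *)
have refl2 (u v : 'cV[R]_n) : sqnorm u = 1 -> sqnorm v = 1 ->
    2 * (u^T *m v) 0 0 * (v^T *m M *m u) 0 0 <=
    (u^T *m M *m u) 0 0 + (v^T *m M *m v) 0 0.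
  move=> u1 v1; have := maxM _ (orthomxM (refl_orth u1) (refl_orth v1)).
  rewrite refl_mul /refl mulmxBr mulmx1 -scalemxAr mulmxA.
  set c := (u^T *m v) 0 0.
  have -> : u^T *m v = c%:M by rewrite [LHS]mx11_scalar.
  rewrite mul_scalar_mx mulmxBr !mulmxBl mul1mx -!scalemxAl.
  rewrite -!scalemxAr mulmxBl -!scalemxAl.
  rewrite !(raddfB, mxtraceZ)/= !mxtraceZ !mxtrace_mul_col.
  lra.
apply/matrixP => j i; rewrite mxE.
pose e k : 'cV[R]_n := delta_mx k 0.
have sqe k : sqnorm (e k) = 1.
  rewrite /sqnorm (bigD1 k)//= big1 ?addr0 ?mxE ?eqxx ?expr1n// => l /negPf lk.
  by rewrite mxE lk expr0n.
have eM k l : ((e k)^T *m M *m e l) 0 0 = M k l.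
  by rewrite /e trmx_delta -rowE -colE !mxE.
have [->//|ij] := eqVneq i j.
have addE (x y : 'M[R]_1) k l : (x + y) k l = x k l + y k l by rewrite mxE.
have sclE (c : R) (x : 'M[R]_1) k l : (c *: x) k l = c * x k l by rewrite mxE.
have ee k l : ((e k)^T *m e l) 0 0 = (k == l)%:R.
  by rewrite /e trmx_delta -rowE !mxE eqxx andbT.
(* [refl2] for e_i and the normalised e_i + t e_j: the antisymmetric part of [M] is linear in [t],
   everything else quadratic, so a small [t] forces it to vanish. *)
have key t : t * (M j i - M i j) <= t ^+ 2 * (M i i + M j j).
  pose w := e i + t *: e j.
  have wt : w^T = (e i)^T + t *: (e j)^T by rewrite [w^T]linearD; congr (_ + _); exact: trmxZ.
  have sqw : sqnorm w = 1 + t ^+ 2.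
    rewrite /w -[t *: e j]opprK sqnormB -scaleNr sqnormZ !sqe.
    rewrite trmxZ -scalemxAl [X in 2 * X]mxE ee eq_sym (negPf ij).
    by rewrite mulr0 mulr0 subr0 mulr1 sqrrN.
  have w0 : 0 < sqnorm w by rewrite sqw ltr_wpDr// sqr_ge0.
  set a := (Num.sqrt (sqnorm w))^-1.
  have a2 : a ^+ 2 * sqnorm w = 1.
    by rewrite exprVn sqr_sqrtr ?mulVf ?gt_eqF// ltW.
  have := refl2 (e i) (a *: w) (sqe i); rewrite sqnormZ => /(_ a2).
  rewrite trmxZ -!scalemxAl -!scalemxAr !scalerA.
  rewrite wt !mulmxDl !mulmxDr -!scalemxAl -!scalemxAr.
  rewrite !(addE, sclE) !eM !ee !eqxx (negPf ij).
  rewrite mulr0 addr0 mulr1 mulrA -(mulrA 2) -expr2.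
  move: a2; rewrite sqw => a2 H.
  have a2p : 0 < a ^+ 2 by rewrite exprn_even_gt0//= gt_eqF// invr_gt0 sqrtr_gt0.
  rewrite -(ler_pM2l a2p).
  have {H} := H; rewrite -subr_ge0 => H; rewrite -subr_ge0.
  suff : M i i * (a ^+ 2 * (1 + t ^+ 2)) = M i i by move: H; nra.
  by rewrite a2 mulr1.
(* With t = d / s the inequality becomes d^2 s <= d^2 (M_ii + M_jj), and the second factor is at
   most s - 1; hence d = 0. *)
pose d := M j i - M i j; pose s := `|M i i + M j j| + 1.
have s0 : 0 < s by rewrite ltr_wpDl.
have := key (d / s).
have ds : M i i + M j j <= s - 1 by rewrite addrK ler_norm.
rewrite -/d => kd.
suff : d = 0 by move/eqP; rewrite subr_eq0 => /eqP.
have h1 : d ^+ 2 * s <= d ^+ 2 * (s - 1).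
  apply: le_trans (ler_wpM2l (sqr_ge0 d) ds).
  have := ler_wpM2r (sqr_ge0 s) kd.
  rewrite (_ : d / s * d * s ^+ 2 = d ^+ 2 * s); last by field; rewrite gt_eqF.
  rewrite (_ : (d / s) ^+ 2 * _ * s ^+ 2 = d ^+ 2 * (M i i + M j j))//.
  by field; rewrite gt_eqF.
apply/eqP; rewrite -sqrf_eq0 eq_le sqr_ge0 andbT.
by move: h1; rewrite mulrBr mulr1; lra.
Qed.

(** Phrased on row vectors of length n * n to match the extreme value theorem [EVT_max_rV]. Rows of
    norm 1 bound the entries, and finitely many polynomial equations give closedness. *)
Lemma compact_orthomx n : compact [set v : 'rV[R]_(n * n) | orthomx (vec_mx v)].
Proof.
apply: bounded_closed_compact.
  exists 1; split; first exact: num_real.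
  move=> x x1 v /= hv; apply: le_trans (ltW x1).
  rewrite /Num.norm/= mx_normrE; apply/bigmax_leP; split=> // -[i j] _ /=.
  rewrite ord1; case/mxvec_indexP: j => k l.
  have -> : v 0 (mxvec_index k l) = vec_mx v k l by rewrite mxE.
  rewrite -[leRHS]sqrtr1 -sqrtr_sqr ler_sqrt//.
  have /matrixP/(_ k k) := hv; rewrite !mxE eqxx mulr1n => <-.
  rewrite (bigD1 l)//= !mxE expr2 lerDl sumr_ge0// => m _.
  by rewrite !mxE -expr2 sqr_ge0.
have -> : [set v : 'rV[R]_(n * n) | orthomx (vec_mx v)] =
    \bigcap_(ij in [set: 'I_n * 'I_n])
      (fun v : 'rV[R]_(n * n) => \sum_k v 0 (mxvec_index ij.1 k) * v 0 (mxvec_index ij.2 k))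
      @^-1` [set (ij.1 == ij.2)%:R].
  apply/seteqP; split => v /=.
    move=> hv [i j] _ /=; have /matrixP/(_ i j) := hv; rewrite !mxE => <-.
    by apply: eq_bigr => k _; rewrite !mxE.
  move=> hv; apply/matrixP => i j; rewrite [RHS]mxE -(hv (i, j) I)/= mxE.
  by apply: eq_bigr => k _; rewrite !mxE.
apply: closed_bigI => -[i j] _; apply: closed_comp => [v _|]; last exact: closed_eq.
apply: (@continuous_big _ _ +%R) => [|k _ w]; first exact: add_continuous.
by apply: continuousM; exact: coord_continuous.
Qed.

(** Take [U] maximising the trace of U G^T over the compact orthogonal group. Left multiplication by
    an orthogonal matrix cannot increase that trace, so [max_trace_sym] makes U G^T symmetric.
    Symmetry is all that the sequel asks of the factor. *)
Lemma polar n (G : 'M[R]_n) : exists2 U, orthomx U & (G *m U^T)^T = G *m U^T.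
Proof.
have [|||v /= ov maxv] := @EVT_max_rV R (n * n)
    (fun v => \tr (vec_mx v *m G^T)) [set v | orthomx (vec_mx v)].
- by exists (mxvec 1%:M); rewrite /= mxvecK; exact: orthomx1.
- exact: compact_orthomx.
- apply: continuous_subspaceT; rewrite /mxtrace.
  apply: (@continuous_big _ _ +%R) => [|i _]; first exact: add_continuous.
  rewrite (_ : (fun v : 'rV[R]_(n * n) => (vec_mx v *m G^T) i i) = fun v : 'rV[R]_(n * n) => \sum_j v 0 (mxvec_index i j) * G^T j i).
    apply: (@continuous_big _ _ +%R) => [|j _ w]; first exact: add_continuous.
    by apply: continuousM; [exact: coord_continuous | exact: cst_continuous].
  by apply/funext => v; rewrite mxE; apply: eq_bigr => j _; rewrite mxE.
have /= hv : [set v | orthomx (vec_mx v)] v by move: ov; rewrite inE.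
exists (vec_mx v) => //; rewrite -[G]trmxK -trmx_mul; congr trmx.
apply: max_trace_sym => U hO.
have := maxv (mxvec (U *m vec_mx v)); rewrite mxvecK mulmxA; apply.
by rewrite inE/= mxvecK; exact: orthomxM.
Qed.

(** Pad [G] with zero rows to a square matrix. The symmetric factor then has zero lower rows, hence
    by symmetry a zero upper right block, and only the top rows of [U] contribute to [G]. *)
Lemma polar_rect k r (G : 'M[R]_(k, k + r)) :
  exists2 U, orthomx U & exists2 M : 'M[R]_k, M^T = M & G = M *m usubmx U.
Proof.
have [U hO symP] := polar (col_mx G 0 : 'M[R]_(k + r)).
exists U => //; set P := _ *m U^T in symP.
have PO : col_mx G 0 = P *m U by rewrite -mulmxA orthomx_tr// mulmx1.
have Pd : dsubmx P = 0 by rewrite /P mul_col_mx col_mxKd mul0mx.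
have Pdl : dlsubmx P = 0 by rewrite /dlsubmx Pd linear0.
have Pdr : drsubmx P = 0 by rewrite /drsubmx Pd linear0.
have Pur : ursubmx P = 0 by rewrite -symP -trmx_dlsub Pdl trmx0.
exists (ulsubmx P); first by rewrite trmx_ulsub symP.
have := congr1 usubmx PO; rewrite col_mxKu => ->.
rewrite -{1}[P]submxK Pur Pdl Pdr -{1}[U]vsubmxK mul_block_col !mul0mx !addr0.
by rewrite col_mxKu.
Qed.

Lemma orthomx_usubmx k r (U : 'M[R]_(k + r)) : orthomx U ->
  usubmx U *m (usubmx U)^T = 1%:M.
Proof.
move=> /(congr1 ulsubmx); rewrite -{1 2}[U]vsubmxK tr_col_mx mul_col_row.
by rewrite block_mxKul scalar_mx_block block_mxKul.
Qed.

(** * Least squares and bordered Gram matrices *)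

Definition gram m n (G : 'M[R]_(m, n)) : 'M[R]_m := G *m G^T.

(** The least-squares coefficients of [g] on the rows of [G], given by the normal equations when the
    Gram matrix is invertible. *)
Definition regr k n (G : 'M[R]_(k, n)) (g : 'cV[R]_n) : 'cV[R]_k :=
  invmx (gram G) *m G *m g.

Definition resid k n (G : 'M[R]_(k, n)) (g : 'cV[R]_n) : 'cV[R]_n :=
  g - G^T *m regr G g.

Lemma trmx_gram m n (G : 'M[R]_(m, n)) : (gram G)^T = gram G.
Proof. by rewrite /gram trmx_mul trmxK. Qed.

Lemma mul_resid k n (G : 'M[R]_(k, n)) g : gram G \in unitmx ->
  G *m resid G g = 0.
Proof.
by move=> W; rewrite mulmxBr mulmxA -/(gram G) /regr !mulmxA mulmxV// mul1mx subrr.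
Qed.

Lemma sqnorm_resid k n (G : 'M[R]_(k, n)) g : gram G \in unitmx ->
  g^T *m resid G g = (sqnorm (resid G g))%:M.
Proof.
move=> W; rewrite -sqnormE; set q := resid G g.
have {1}-> : g = q + G^T *m regr G g by rewrite subrK.
by rewrite [(_ + _)^T]linearD/= mulmxDl trmx_mul trmxK -mulmxA mul_resid// mulmx0 addr0.
Qed.

(** The normal equations in block form. They identify (1, - beta), divided by |resid|^2, as the
    first column of the inverse of the bordered Gram matrix. *)
Lemma gram_regr k n (G : 'M[R]_(k, n)) g : gram G \in unitmx ->
  gram (col_mx g^T G) *m col_mx 1%:M (- regr G g) =
  col_mx (sqnorm (resid G g))%:M 0.
Proof.
move=> W; rewrite /gram tr_col_mx trmxK -mulmxA mul_row_col mulmx1 mulmxN.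
by rewrite -/(resid G g) mul_col_mx sqnorm_resid// mul_resid.
Qed.

Lemma gram_unitP m n (G : 'M[R]_(m, n)) :
  reflect (forall v : 'cV_m, G^T *m v = 0 -> v = 0) (gram G \in unitmx).
Proof.
apply: (iffP idP) => [W v Gv|inj].
  by rewrite -[v](mulKmx W) /gram -mulmxA Gv !mulmx0.
rewrite -row_free_unit -kermx_eq0; apply/eqP/row_matrixP => i.
rewrite row0 -[LHS]trmxK; apply/(canLR trmxK); rewrite trmx0; apply: inj.
rewrite -[LHS]trmxK; apply/(canLR trmxK); rewrite trmx0 trmx_mul !trmxK.
apply: mulmx_tr_eq0; rewrite trmx_mul -!mulmxA (mulmxA G) -/(gram G).
by rewrite mulmxA -row_mul mulmx_ker row0 mul0mx.
Qed.

(** The squared residual is the Schur complement of [gram G]; the proof works with kernels instead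
    of determinants. *)
Lemma gram_col_mx_unit k n (G : 'M[R]_(k, n)) g :
  (gram (col_mx g^T G) \in unitmx) =
  (gram G \in unitmx) && (sqnorm (resid G g) != 0).
Proof.
apply/idP/andP => [W|[W s0]].
  have W2 : gram G \in unitmx.
    apply/gram_unitP => v Gv; move/gram_unitP: W => /(_ (col_mx 0 v)).
    rewrite tr_col_mx mul_row_col mulmx0 add0r => /(_ Gv).
    by rewrite -[RHS]col_mx0 => /eq_col_mx[].
  split => //; apply/eqP => s0; have := gram_regr g W2.
  rewrite s0 raddf0 col_mx0 => /(congr1 (mulmx (invmx (gram (col_mx g^T G))))).
  rewrite mulKmx// mulmx0 -[RHS]col_mx0 => /eq_col_mx[/matrixP/(_ 0 0)/eqP].
  by rewrite !mxE eqxx mulr1n oner_eq0.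
apply/gram_unitP => v; rewrite -[v]vsubmxK; set a := usubmx v; set b := dsubmx v.
rewrite tr_col_mx trmxK mul_row_col => ab.
have Ga : G *m (g *m a) + gram G *m b = 0 by rewrite /gram -mulmxA -mulmxDr ab mulmx0.
have bE : b = - (regr G g *m a).
  rewrite -[b](mulKmx W); move/eqP: Ga; rewrite addrC addr_eq0 => /eqP ->.
  by rewrite mulmxN /regr !mulmxA.
have qa : resid G g *m a = 0.
  by rewrite mulmxBl -mulmxA -[X in _ - X]opprK -mulmxN -bE opprK.
have a0 : a = 0.
  have : (resid G g)^T *m (resid G g *m a) = 0 by rewrite qa mulmx0.
  rewrite mulmxA sqnormE mul_scalar_mx => /eqP; rewrite scaler_eq0 (negPf s0)/=.
  by move/eqP.
by rewrite bE a0 mulmx0 oppr0 col_mx0.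
Qed.

(** Both entries are read off the first column of the inverse: its first coordinate and, the inverse
    being symmetric, its squared norm. *)
Lemma invmx_gram_col_mx k n (G : 'M[R]_(k, n)) g :
    gram (col_mx g^T G) \in unitmx ->
  let s := sqnorm (resid G g) in let W := gram (col_mx g^T G) in
  invmx W 0 0 = s^-1 /\
  (invmx W *m invmx W) 0 0 = (1 + sqnorm (regr G g)) / s ^+ 2.
Proof.
move=> W s Wm; have := W; rewrite gram_col_mx_unit => /andP[W2 s0].
have xE : col 0 (invmx Wm) = s^-1 *: col_mx 1%:M (- regr G g).
  rewrite -[RHS](mulKmx W) -scalemxAr gram_regr// -/s scale_col_mx scaler0.
  rewrite -mul_scalar_mx -scalar_mxM mulVf// colE; congr (_ *m _).
  apply/colP => i; rewrite !mxE; case: splitP => j /= ij; rewrite !mxE.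
    by rewrite !ord1 -val_eqE/= ij ord1 eqxx.
  by rewrite -val_eqE/= ij.
split.
  have /colP/(_ 0) := xE; rewrite mxE => ->; rewrite !mxE.
  by case: splitP => // j _; rewrite !ord1 mxE eqxx mulr1.
have -> : (invmx Wm *m invmx Wm) 0 0 = sqnorm (col 0 (invmx Wm)).
  have iT : (invmx Wm)^T = invmx Wm by rewrite trmx_inv trmx_gram.
  by rewrite -{1}iT mxE; apply: eq_bigr => j _; rewrite !mxE expr2.
rewrite xE sqnormZ exprVn mulrC; congr (_ / _).
rewrite sqnorm_dot tr_col_mx mul_row_col trmx1 mulmx1 [(- _)^T]linearN mulNmx mulmxN opprK.
by rewrite sqnormE !mxE eqxx !mulr1n.
Qed.

(** From G = M V with V V^T = 1: the Gram matrix is M^2, beta is M^-1 V g, and the residual is the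
    part of [g] orthogonal to the rows of V. The matrix [U] depends on [G] alone, so once [G] is
    frozen U g has the same law as [g]. *)
Lemma polar_regr k r (G : 'M[R]_(k, k + r)) : gram G \in unitmx ->
  exists2 U : 'M[R]_(k + r), orthomx U & forall g,
    sqnorm (resid G g) = sqnorm (dsubmx (U *m g)) /\
    let z := usubmx (U *m g) in
    sqnorm (regr G g) = (z^T *m invmx (gram G) *m z) 0 0.
Proof.
move=> W; have [U hO [M symM GE]] := polar_rect G.
exists U => // g; set V := usubmx U in GE; have VV : V *m V^T = 1%:M := orthomx_usubmx hO.
have WE : gram G = M *m M.
  by rewrite /gram GE trmx_mul symM mulmxA -(mulmxA M) VV mulmx1.
have Mu : M \in unitmx by move: W; rewrite WE unitmx_mul => /andP[].
have WV : invmx (gram G) = invmx M *m invmx M.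
  have WW : gram G *m (invmx M *m invmx M) = 1%:M.
    by rewrite WE -mulmxA mulKVmx// mulmxV.
  by rewrite -[RHS](mulKmx W) WW mulmx1.
have symMV : (invmx M)^T = invmx M by rewrite trmx_inv symM.
have zE : usubmx (U *m g) = V *m g by rewrite -{1}[U]vsubmxK mul_col_mx col_mxKu.
have rE : regr G g = invmx M *m (V *m g).
  by rewrite /regr WV GE -!mulmxA mulKmx.
split; last first.
  by rewrite /= zE rE sqnorm_dot trmx_mul symMV WV !mulmxA.
have qE : resid G g = g - V^T *m (V *m g).
  by rewrite /resid rE GE trmx_mul symM -!mulmxA mulKVmx.
have : sqnorm (U *m g) = sqnorm (V *m g) + sqnorm (dsubmx (U *m g)).
  rewrite -zE !sqnorm_dot -{1 2}[U *m g]vsubmxK tr_col_mx mul_row_col.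
  by rewrite mxE.
rewrite orthomx_sqnorm// => E; apply: (addrI (sqnorm (V *m g))); rewrite -E.
rewrite qE sqnormB.
have -> : sqnorm (V^T *m (V *m g)) = sqnorm (V *m g).
  by rewrite !sqnorm_dot (trmx_mul V^T) trmxK -mulmxA (mulmxA V V^T) VV mul1mx.
have -> : (V^T *m (V *m g))^T *m g = (V *m g)^T *m (V *m g).
  by rewrite !trmx_mul trmxK !mulmxA.
by rewrite -sqnorm_dot; lra.
Qed.

Lemma sqnorm_row k (W : 'M[R]_k.+1) (z : 'cV[R]_k.+1) (H : 'M[R]_k.+1) :
  orthomx H -> H *m z = Num.sqrt (sqnorm z) *: delta_mx 0 0 ->
  (z^T *m W *m z) 0 0 = sqnorm z * (H *m W *m H^T) 0 0.
Proof.
move=> hH Hz; have zE : z = H^T *m (Num.sqrt (sqnorm z) *: delta_mx 0 0).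
  by rewrite -Hz mulmxA orthomx_tr// mul1mx.
rewrite {1 2}zE trmx_mul trmxK trmxZ -!mulmxA -!scalemxAr -!scalemxAl scalerA.
rewrite -expr2 sqr_sqrtr ?sqnorm_ge0// [LHS]mxE; congr (_ * _).
by rewrite trmx_delta -rowE !mulmxA -colE !mxE.
Qed.

End orthogonal.

(** * Independence and standard normal families *)

Section independence.
Context {R : realType} d (T : measurableType d) (P : probability T R).
Context d1 (U : measurableType d1) d2 (V : measurableType d2).
Variables (X : T -> U) (Y : T -> V).
Hypotheses (mX : measurable_fun setT X) (mY : measurable_fun setT Y).
Variables (C1 : set (set U)) (C2 : set (set V)).
Hypotheses (C1E : measurable = <<s C1 >>) (C2E : measurable = <<s C2 >>).
Hypotheses (C1T : C1 setT) (C2T : C2 setT).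
Hypotheses (C1I : setI_closed C1) (C2I : setI_closed C2).
Hypothesis indep : forall A B, C1 A -> C2 B ->
  P [set w | A (X w) /\ B (Y w)] = (P (X @^-1` A) * P (Y @^-1` B))%E.

Let pX : {mfun T >-> U} := HB.pack X (isMeasurableFun.Build _ _ _ _ _ mX).
Let pY : {mfun T >-> V} := HB.pack Y (isMeasurableFun.Build _ _ _ _ _ mY).
Let mXY : measurable_fun setT (fun w => (X w, Y w)).
Proof. exact: measurable_fun_pair. Qed.
Let pXY : {mfun T >-> (U * V)%type} :=
  HB.pack (fun w => (X w, Y w)) (isMeasurableFun.Build _ _ _ _ _ mXY).

Let rect := [set A `*` B | A in C1 & B in C2].

Let rectE : @measurable _ (U * V)%type = <<s rect >>.
Proof.
apply/seteqP; split; last first.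
  apply: smallest_sub; first exact: sigma_algebra_measurable.
  move=> _ [A hA [B hB <-]]; apply: measurableX.
    by rewrite C1E; exact: sub_sigma_algebra.
  by rewrite C2E; exact: sub_sigma_algebra.
have h1 : preimage_set_system setT fst (@measurable _ U) `<=` <<s rect >>.
  rewrite C1E -g_sigma_preimageE; apply: smallest_sub.
    exact: smallest_sigma_algebra.
  move=> _ [A hA <-]; apply: sub_sigma_algebra; exists A => //; exists setT => //.
  by rewrite setTI setXT.
have h2 : preimage_set_system setT snd (@measurable _ V) `<=` <<s rect >>.
  rewrite C2E -g_sigma_preimageE; apply: smallest_sub.
    exact: smallest_sigma_algebra.
  move=> _ [A hA <-]; apply: sub_sigma_algebra; exists setT => //; by exists A.
apply: smallest_sub; first exact: smallest_sigma_algebra.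
by rewrite subUset.
Qed.

(** Uniqueness of measures on the pi-system of rectangles over [C1] and [C2]: independence has to be
    checked on generators only. *)
Lemma indep_law (C : set (U * V)) : measurable C ->
  P [set w | C (X w, Y w)] = (distribution P pX \x distribution P pY)%E C.
Proof.
move=> mC; rewrite -[LHS]/(distribution P pXY C).
apply: (measure_unique rect (fun=> setT)) => //.
- move=> _ _ [A hA [B hB <-]] [A' hA' [B' hB' <-]]; rewrite -setXI.
  by exists (A `&` A'); [exact: C1I | exists (B `&` B') => //; exact: C2I].
- by move=> _; exists setT => //; exists setT => //; rewrite setXTT.
- by rewrite bigcup_const//; exists 0%N.
- move=> _ [A hA [B hB <-]]; rewrite [RHS]product_measure1E.
  + exact: indep.
  + by rewrite C1E; exact: sub_sigma_algebra.
  + by rewrite C2E; exact: sub_sigma_algebra.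
- by move=> _; rewrite -[X in (X < _)%E]/(distribution P pXY setT) probability_setT ltry.
Qed.

Lemma indep_fubini (C : set (U * V)) : measurable C ->
  P [set w | C (X w, Y w)] = (\int[P]_w P [set w' | C (X w, Y w')])%E.
Proof.
move=> mC; rewrite indep_law// /product_measure1.
rewrite ge0_integral_distribution//=; last exact: measurable_fun_xsection.
by apply: eq_integral => w _; congr (P _); apply/seteqP; split => w' /=;
  rewrite /xsection/= inE.
Qed.

(** The other order of integration, needed because [regr_law] freezes each of the two blocks in
    turn. *)
Lemma indep_fubini_sym (C : set (U * V)) : measurable C ->
  P [set w | C (X w, Y w)] = (\int[P]_w' P [set w | C (X w, Y w')])%E.
Proof.
move=> mC; rewrite indep_law//.
rewrite (@product_measure_unique _ _ _ _ _ _ _ (distribution P pX \x^ distribution P pY)%E)//; last first.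
  by move=> A B mA mB; rewrite [LHS]product_measure2E.
rewrite /= /product_measure2.
rewrite ge0_integral_distribution//=; last exact: measurable_fun_ysection.
by apply: eq_integral => w _; congr (P _); apply/seteqP; split => w' /=;
  rewrite /ysection/= inE.
Qed.

Lemma indep_prod A B : measurable A -> measurable B ->
  P [set w | A (X w) /\ B (Y w)] = (P (X @^-1` A) * P (Y @^-1` B))%E.
Proof.
move=> mA mB; rewrite -[LHS]/(P [set w | (A `*` B) (X w, Y w)]).
rewrite indep_law; last exact: measurableX.
by rewrite product_measure1E.
Qed.

Lemma measurable_indep_section (C : set (U * V)) : measurable C ->
  measurable_fun setT (fun w => P [set w' | C (X w, Y w')]).
Proof.
move=> mC; have := measurableT_comp (measurable_fun_xsection (distribution P pY) mC) mX.
apply: eq_measurable_fun => w _ /=; congr (P _); apply/seteqP; split => w' /=;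
  by rewrite /xsection/= inE.
Qed.

End independence.

Section vectors.
Context {R : realType}.

(** Boxes are stable under intersection and include the whole space, so they determine laws on
    [vecT I]. Any index type is allowed: entries of a matrix, a row, or a single coordinate. *)
Definition rects (I : Type) : set (set (I -> R)) :=
  [set A | exists2 B : I -> set R, (forall i, measurable (B i)) &
                                   A = [set x | forall i, B i (x i)]].

Definition vecT (I : Type) := g_sigma_algebraType (@rects I).

Lemma rectsT I : @rects I setT.
Proof. by exists (fun=> setT) => //; apply/seteqP; split. Qed.

Lemma rectsI I : setI_closed (@rects I).
Proof.
move=> _ _ [B mB ->] [B' mB' ->]; exists (fun i => B i `&` B' i).
  by move=> i; exact: measurableI.
by apply/seteqP; split => x /= => [[h h'] i|h]; [|split => i; case: (h i)].
Qed.

Lemma measurable_coord I (i : I) : measurable_fun setT (fun x : vecT I => x i).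
Proof.
move=> _ B mB; rewrite setTI; apply: sub_sigma_algebra.
pose B' j := [set x | j = i -> B x].
exists B' => [j|].
  have [->|ji] := pselect (j = i).
    by rewrite (_ : B' i = B)//; apply/seteqP; split => x /=; [exact | move=> ? _].
  by rewrite (_ : B' j = setT)//; apply/seteqP; split => x /= => // _ /ji.
by apply/seteqP; split => x /= => [Bx j ->|]; [|exact].
Qed.

Lemma measurable_vec d (T : measurableType d) (I : finType) (F : T -> vecT I) :
  (forall i, measurable_fun setT (fun w => F w i)) -> measurable_fun setT F.
Proof.
move=> mF; apply: (@measurability _ _ T (vecT I) setT F (@rects I) erefl).
move=> _ [_ [B mB ->] <-]; rewrite setTI.
rewrite (_ : _ @^-1` _ = \big[setI/setT]_i ((fun w => F w i) @^-1` B i)).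
  by apply: bigsetI_measurable => i _; rewrite -[X in measurable X]setTI; exact: mF.
apply/seteqP; split=> w /=; last by move=> + i; rewrite -bigcap_seq/=; apply; exact: mem_index_enum.
by move=> h; rewrite -bigcap_seq/= => i _ ; exact: h.
Qed.

Section gauss.
Context d (T : measurableType d) (P : probability T R).

(** Independence and marginals are merged into one formula on boxes, so that subfamilies and
    reindexings come from [std_gauss_inj]. *)
Definition std_gauss (I : finType) (Z : I -> T -> R) :=
  (forall i, measurable_fun setT (Z i)) /\
  forall B : I -> set R, (forall i, measurable (B i)) ->
    P [set w | forall i, B i (Z i w)] = (\prod_i normal_prob 0 1 (B i))%E.

Lemma std_gauss_vec (I : finType) (Z : I -> T -> R) : std_gauss Z ->
  measurable_fun setT (fun w => (Z ^~ w : vecT I)).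
Proof. by move=> [mZ _]; exact: measurable_vec. Qed.

Lemma std_gauss_inj (I J : finType) (Z : I -> T -> R) (h : J -> I) :
  injective h -> std_gauss Z -> std_gauss (fun j => Z (h j)).
Proof.
move=> hinj [mZ gZ]; split => // B mB.
(* By injectivity this is [B j] at [h j], and it is the whole line off the image of [h], where it
   contributes a factor 1. *)
pose B' i := [set x | forall j, h j = i -> B j x].
have B'h j : B' (h j) = B j.
  by apply/seteqP; split => x /=; [apply | move=> Bx k /hinj ->].
have B'n i : i \notin codom h -> B' i = setT.
  by move=> ih; apply/seteqP; split => x // _ j hj; rewrite -hj codom_f in ih.
have mB' i : measurable (B' i).
  by have [/codomP[j ->]|/B'n ->//] := boolP (i \in codom h); rewrite B'h.
have := gZ _ mB'; rewrite (_ : [set _ | _] = [set w | forall j, B j (Z (h j) w)]).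
  move=> ->; rewrite (bigID (fun i => i \in codom h))/= [X in (_ * X)%E]big1 ?mule1.
    rewrite -big_uniq/=; last by rewrite map_inj_uniq// enum_uniq.
    by rewrite big_image/=; apply: eq_bigr => j _; rewrite B'h.
  by move=> i /B'n ->; exact: probability_setT.
apply/seteqP; split => w /= hw.
  by move=> j; have := hw (h j); rewrite B'h.
by move=> i j <-; exact: hw.
Qed.


Lemma std_gauss_indep (I J K : finType) (Z : K -> T -> R) (f : I -> K) (g : J -> K) :
    injective f -> injective g -> (forall i j, f i != g j) -> std_gauss Z ->
  forall (A : set (I -> R)) (B : set (J -> R)), rects A -> rects B ->
  P [set w | A (fun i => Z (f i) w) /\ B (fun j => Z (g j) w)] =
  (P ((fun w i => Z (f i) w) @^-1` A) * P ((fun w j => Z (g j) w) @^-1` B))%E.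
Proof.
move=> finj ginj fg gZ _ _ [A mA ->] [B mB ->].
pose h (x : I + J) := match x with inl i => f i | inr j => g j end.
have hinj : injective h.
  move=> [i|j] [i'|j'] //=; first by move=> /finj ->.
  - by move/eqP; rewrite (negPf (fg _ _)).
  - by move/esym/eqP; rewrite (negPf (fg _ _)).
  - by move=> /ginj ->.
have [_ gh] := std_gauss_inj hinj gZ.
have [_ gf] := std_gauss_inj finj gZ.
have [_ gg] := std_gauss_inj ginj gZ.
pose AB x := match x with inl i => A i | inr j => B j end.
rewrite [X in (X * _)%E](gf A mA) [X in (_ * X)%E](gg B mB).
transitivity (P [set w | forall x, AB x (Z (h x) w)]).
  congr (P _); apply/seteqP; split => w /= => [[hA hB] [i|j]//|hAB].
  by split => [i|j]; [exact: (hAB (inl i)) | exact: (hAB (inr j))].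
rewrite gh; last by case.
by rewrite big_sumType.
Qed.

Lemma std_gauss_mul_one (I : finType) (Z : I -> T -> R) i : std_gauss Z ->
  forall B, measurable B -> P (Z i @^-1` B) = normal_prob 0 1 B.
Proof.
move=> gZ B mB; have inj : injective (fun _ : unit => i) by case; case.
have [_ /(_ (fun=> B) (fun=> mB))] := std_gauss_inj inj gZ.
rewrite (_ : [set _ | _] = Z i @^-1` B) => [->|].
  by rewrite big_const card_unit/= mule1.
by apply/seteqP; split => w /= // /(_ tt).
Qed.

End gauss.

(** This turns invariance into equalities of probabilities: a rotated family is again standard
    normal, so it may replace the original one in any measurable event. *)
Lemma std_gauss_law d (T : measurableType d) (P : probability T R)
    d' (T' : measurableType d') (P' : probability T' R)
    (I : finType) (Z : I -> T -> R) (Z' : I -> T' -> R) :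
    std_gauss P Z -> std_gauss P' Z' ->
  forall C : set (vecT I), measurable C ->
    P [set w | C (Z ^~ w)] = P' [set w | C (Z' ^~ w)].
Proof.
move=> gZ gZ' C mC.
have mZ := std_gauss_vec gZ; have mZ' := std_gauss_vec gZ'.
pose X : {mfun T >-> vecT I} := HB.pack (fun w => Z ^~ w) (isMeasurableFun.Build _ _ _ _ _ mZ).
pose X' : {mfun T' >-> vecT I} := HB.pack (fun w => Z' ^~ w) (isMeasurableFun.Build _ _ _ _ _ mZ').
rewrite -[LHS]/(distribution P X C) -[RHS]/(distribution P' X' C).
apply: (@measure_unique _ R (vecT I) (@rects I) (fun=> setT)) => //.
- exact: rectsI.
- by move=> _; exact: rectsT.
- by rewrite bigcup_const//; exists 0%N.
- move=> _ [B mB ->]; rewrite [LHS](proj2 gZ)//; apply/esym; exact: (proj2 gZ').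
- by move=> _; rewrite -[X in (X < _)%E]/(distribution P X setT) probability_setT ltry.
Qed.

End vectors.

(** * Rotation invariance of the planar Gaussian measure *)

Section rotation.
Context {R : realType}.
Local Notation mu := (@lebesgue_measure R).
(* [lebesgue_measure] lives on this alias of [R]. *)
Local Notation Rm := (measurableTypeR R).
Local Notation mu2 := (mu \x mu)%E.

Lemma measurable_addl (a : R) : measurable_fun setT (fun x : Rm => (a + x : Rm)).
Proof. exact: measurable_funD. Qed.

Lemma lebesgue_measure_shift (a : R) (A : set R) : measurable A ->
  mu ((fun x => a + x) @^-1` A) = mu A.
Proof.
move=> mA; have mf : measurable_fun setT (fun x : measurableTypeR R => (a + x : measurableTypeR R)).
  exact: measurable_addl.
rewrite -[LHS]/(pushforward mu ((fun x => a + x) : Rm -> Rm) A).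
apply/esym/lebesgue_measure_unique => //= _ [[b c]] _ <-.
rewrite /= /pushforward.
have -> : [eta +%R a] @^-1` `]b, c]%classic = `]b - a, c - a]%classic.
  by apply/seteqP; split => x /=; rewrite !in_itv/= ltrBlDl lerBrDl.
rewrite !lebesgue_measure_itv/= !lte_fin ltrD2r.
by case: ifP => // _; rewrite -!EFinD; congr (_%:E); ring.
Qed.

Lemma product_lebesgueE (C : set (Rm * Rm)) : measurable C ->
  mu2 C = (mu \x^ mu)%E C.
Proof.
by move=> mC; apply: product_measure_unique => // A B mA mB; exact: product_measure2E.
Qed.

Let shear1 (a : R) (z : Rm * Rm) : Rm * Rm := (z.1 + a * z.2, z.2).
Let shear2 (a : R) (z : Rm * Rm) : Rm * Rm := (z.1, a * z.1 + z.2).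

Lemma measurable_shear1 a : measurable_fun setT (shear1 a).
Proof.
apply: measurable_fun_pair; last exact: measurable_snd.
apply: measurable_funD; first exact: measurable_fst.
by apply: measurable_funM => //; exact: measurable_snd.
Qed.

Lemma measurable_shear2 a : measurable_fun setT (shear2 a).
Proof.
apply: measurable_fun_pair; first exact: measurable_fst.
apply: measurable_funD; last exact: measurable_snd.
by apply: measurable_funM => //; exact: measurable_fst.
Qed.

(** On each section the shear is a translation, so Fubini reduces the claim to
    [lebesgue_measure_shift]. *)
Lemma lebesgue_shear2 a (C : set (Rm * Rm)) : measurable C ->
  mu2 (shear2 a @^-1` C) = mu2 C.
Proof.
move=> mC; rewrite /product_measure1; apply: eq_integral => x _ /=.
rewrite -[RHS](@lebesgue_measure_shift (a * x)); last exact: measurable_xsection.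
by congr (mu _); apply/seteqP; split => y; rewrite /xsection/= !inE.
Qed.

Lemma lebesgue_shear1 a (C : set (Rm * Rm)) : measurable C ->
  mu2 (shear1 a @^-1` C) = mu2 C.
Proof.
move=> mC; have mC' : measurable (shear1 a @^-1` C).
  by rewrite -[X in measurable X]setTI; exact: measurable_shear1.
rewrite !product_lebesgueE// /product_measure2; apply: eq_integral => x _ /=.
rewrite -[RHS](@lebesgue_measure_shift (a * x)); last exact: measurable_ysection.
by congr (mu _); apply/seteqP; split => y; rewrite /ysection/= !inE/= addrC.
Qed.

Definition rot (c s : R) (z : Rm * Rm) : Rm * Rm := (c * z.1 - s * z.2, s * z.1 + c * z.2).

Lemma measurable_rot c s : measurable_fun setT (rot c s).
Proof.
apply: measurable_fun_pair.
  by apply: measurable_funB; exact: measurable_funM.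
by apply: measurable_funD; exact: measurable_funM.
Qed.

(* A rotation by an angle that is not a multiple of pi is a product of three
   shears. *)
Lemma lebesgue_rot c s (C : set (Rm * Rm)) : c ^+ 2 + s ^+ 2 = 1 -> s != 0 ->
  measurable C -> mu2 (rot c s @^-1` C) = mu2 C.
Proof.
(* For c = cos a and s = sin a this is - tan (a / 2). *)
move=> cs s0 mC; pose t := (c - 1) / s.
have -> : rot c s = shear1 t \o shear2 s \o shear1 t.
  apply/funext => -[x y]; rewrite /rot /shear1 /shear2/=; congr pair.
    have -> : c * x - s * y = c * x - s ^+ 2 / s * y by field.
    have -> : s ^+ 2 = 1 - c ^+ 2 by rewrite -cs addrAC subrr add0r.
    by rewrite /t; field.
  by rewrite /t; field.
have m1 D : measurable D -> measurable (shear1 t @^-1` D).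
  by move=> mD; rewrite -[X in measurable X]setTI; exact: measurable_shear1.
have m2 D : measurable D -> measurable (shear2 s @^-1` D).
  by move=> mD; rewrite -[X in measurable X]setTI; exact: measurable_shear2.
rewrite -[X in X @^-1` _]/(_ \o (shear2 s \o shear1 t)) !comp_preimage.
rewrite lebesgue_shear1; last by apply: m2; exact: m1.
by rewrite lebesgue_shear2 ?lebesgue_shear1//; exact: m1.
Qed.

Let phi (x : R) := normal_pdf 0 1 x.
Let phi2 (z : Rm * Rm) : \bar R := (phi z.1 * phi z.2)%:E.

Let mphi2 : measurable_fun setT phi2.
Proof.
apply/measurable_EFinP; apply: measurable_funM => /=.
  by apply: measurableT_comp; [exact: measurable_normal_pdf|exact: measurable_fst].
by apply: measurableT_comp; [exact: measurable_normal_pdf|exact: measurable_snd].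
Qed.

Let phi2_ge0 z : (0 <= phi2 z)%E.
Proof. by rewrite lee_fin mulr_ge0// normal_pdf_ge0. Qed.

(** The Radon-Nikodym derivative and [normal_pdf] have the same integral over every measurable set,
    hence agree almost everywhere and may be exchanged in the change of variables. *)
Lemma ge0_integral_normal_prob (f : R -> \bar R) m sg : (forall x, 0 <= f x)%E ->
  measurable_fun setT f ->
  (\int[normal_prob m sg]_x f x = \int[mu]_x (f x * (normal_pdf m sg x)%:E))%E.
Proof.
move=> f0 mf.
have dom := @normal_prob_dominates R m sg.
rewrite -(Radon_Nikodym_SigmaFinite.change_of_variables dom)//.
have mpdf : measurable_fun setT (EFin \o normal_pdf m sg).
  by apply/measurable_EFinP; exact: measurable_normal_pdf.
have mRN : measurable_fun setT (Radon_Nikodym_SigmaFinite.f (normal_prob m sg) mu).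
  exact: (measurable_int _ (Radon_Nikodym_SigmaFinite.f_integrable dom)).
apply: ae_eq_integral => //.
- exact: emeasurable_funM.
- exact: emeasurable_funM.
apply: ae_eqe_mul2l; apply: integral_ae_eq => //.
- exact: Radon_Nikodym_SigmaFinite.f_integrable.
- by move=> E _ mE; rewrite -Radon_Nikodym_SigmaFinite.f_integral.
Qed.

Lemma normal_prob_product (C : set (Rm * Rm)) : measurable C ->
  (normal_prob 0 1 \x normal_prob 0 1)%E C = (\int[mu2]_(z in C) phi2 z)%E.
Proof.
move=> mC; rewrite [LHS]/product_measure1 ge0_integral_normal_prob//; last first.
  exact: measurable_fun_xsection.
rewrite [RHS]integral_mkcond [RHS]fubini_tonelli1; last 2 first.
- by apply/(measurable_restrictT _ _).1 => //; exact: measurable_funS mphi2.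
- by move=> z; rewrite erestrict_ge0// => ? _; exact: phi2_ge0.
apply: eq_integral => x _; rewrite /fubini_F /normal_prob -ge0_integralZr//=.
- rewrite integral_mkcond; apply: eq_integral => y _.
  rewrite /patch mem_xsection; case: ifP => // _.
  by rewrite /phi2/= muleC -EFinM.
- exact: measurable_xsection.
- by apply/measurable_EFinP; apply: measurable_funTS; exact: measurable_normal_pdf.
- by move=> y _; rewrite lee_fin normal_pdf_ge0.
- by rewrite lee_fin normal_pdf_ge0.
Qed.

(** The joint density depends on x^2 + y^2 only, and the rotation preserves Lebesgue measure. *)
Lemma normal_rot c s (C : set (Rm * Rm)) : c ^+ 2 + s ^+ 2 = 1 -> s != 0 ->
  measurable C ->
  (normal_prob 0 1 \x normal_prob 0 1)%E (rot c s @^-1` C) =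
  (normal_prob 0 1 \x normal_prob 0 1)%E C.
Proof.
move=> cs s0 mC.
have mC' : measurable (rot c s @^-1` C).
  by rewrite -[X in measurable X]setTI; exact: measurable_rot.
rewrite !normal_prob_product//.
have phiE z : phi2 (rot c s z) = phi2 z.
  rewrite /phi2 /phi !normal_pdfE ?oner_neq0//; congr (_%:E).
  rewrite /normal_fun mulrACA [RHS]mulrACA -!expRD; congr (_ * expR _).
  rewrite /rot/= !subr0 !mulNr -!opprD -!mulrDl; congr (- (_ / _)).
  by rewrite -[RHS]mul1r -cs; ring.
transitivity (\int[pushforward mu2 (rot c s)]_(z in C) phi2 z)%E.
  rewrite (ge0_integral_pushforward (measurable_rot c s)).
  - by apply: eq_integral => z _ /=; rewrite phiE.
  - exact: mC.
  - exact: measurable_funS mphi2.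
  - by move=> z _; exact: phi2_ge0.
apply: (@eq_measure_integral _ _ _ C mu2
  (measure_function_pushforward__canonical__measure_function_Measure mu2
     (measurable_rot c s))) => D mD _.
exact: lebesgue_rot.
Qed.

End rotation.

(** * Orthogonal invariance of standard normal families *)

Section invariance.
Context {R : realType} d (T : measurableType d) (P : probability T R).
Local Notation Rm := (measurableTypeR R).

Lemma normal_probN (B : set Rm) : measurable B ->
  normal_prob (0 : R) 1 (-%R @^-1` B) = normal_prob (0 : R) 1 B.
Proof.
move=> mB; rewrite /normal_prob.
have mN : measurable_fun setT (-%R : Rm -> Rm) by exact: oppr_measurable.
transitivity (\int[pushforward lebesgue_measure (-%R : Rm -> Rm)]_(x in B)
    (normal_pdf 0 1 x)%:E)%E.
  rewrite (ge0_integral_pushforward mN).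
  - apply: eq_integral => x _ /=; rewrite !normal_pdfE ?oner_neq0//.
    by rewrite /normal_fun !subr0 sqrrN.
  - exact: mB.
  - by apply/measurable_EFinP; apply: measurable_funTS; exact: measurable_normal_pdf.
  - by move=> x _; rewrite lee_fin normal_pdf_ge0.
apply: (@eq_measure_integral _ _ _ B lebesgue_measure
  (measure_function_pushforward__canonical__measure_function_Measure lebesgue_measure
     mN)) => D mD _.
exact: lebesgue_measureN.
Qed.

Lemma std_gauss_flip (I : finType) (Z : I -> T -> R) a : std_gauss P Z ->
  std_gauss P (fun i w => if i == a then - Z a w else Z i w).
Proof.
move=> [mZ gZ]; split => [i|B mB].
  by case: (i == a) => //; exact: measurableT_comp.
pose B' i := if i == a then -%R @^-1` B a else B i.
have mB' i : measurable (B' i).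
  rewrite /B'; case: ifP => // _; rewrite -[X in measurable X]setTI.
  exact: oppr_measurable.
transitivity (P [set w | forall i, B' i (Z i w)]).
  congr (P _); apply/seteqP; split => w /= h i; have := h i; rewrite /B';
  by have [->|] := eqVneq i a.
rewrite gZ//; apply: eq_bigr => i _; rewrite /B'.
by have [->|//] := eqVneq i a; apply: normal_probN; exact: (mB a).
Qed.

Lemma std_gauss_pair (I : finType) (Z : I -> T -> R) a b (C : set (Rm * Rm)) :
  a != b -> std_gauss P Z -> measurable C ->
  P [set w | C (Z a w, Z b w)] = (normal_prob (0 : R) 1 \x normal_prob (0 : R) 1)%E C.
Proof.
move=> ab gZ mC.
have mab : measurable_fun setT ((fun w => (Z a w, Z b w)) : T -> (Rm * Rm)%type).
  by apply: measurable_fun_pair; exact: gZ.1.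
pose X : {mfun T >-> (Rm * Rm)%type} :=
  HB.pack (fun w => (Z a w, Z b w)) (isMeasurableFun.Build _ _ _ _ _ mab).
rewrite -[LHS]/(distribution P X C); apply/esym.
apply: product_measure_unique => // A B mA mB.
pose h (x : bool) := if x then a else b.
have hinj : injective h by move=> [] [] //= /eqP; rewrite ?(negPf ab)// eq_sym (negPf ab).
have [_ /(_ (fun x => if x then A else B))] := std_gauss_inj hinj gZ.
rewrite big_bool/= => <-; last by case.
by congr (P _); apply/seteqP; split => w /= => [[hA hB] []|h']//; split;
  [exact: (h' true)|exact: (h' false)].
Qed.

(** The pair at [a], [b] is independent of the remaining coordinates, so only the law of the pair
    matters, and [normal_rot] preserves it. The condition [s != 0] is inherited from the
    factorisation into shears. *)
Lemma std_gauss_rot (I : finType) (Z : I -> T -> R) a b c s :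
    a != b -> c ^+ 2 + s ^+ 2 = 1 -> s != 0 -> std_gauss P Z ->
  std_gauss P (fun i w => if i == a then c * Z a w - s * Z b w else
                          if i == b then s * Z a w + c * Z b w else Z i w).
Proof.
move=> ab cs s0 gZ; have mZ := gZ.1; split => [i|B mB].
  case: (i == a); first by apply: measurable_funB; exact: measurable_funM.
  by case: (i == b) => //; apply: measurable_funD; exact: measurable_funM.
pose J := {i : I | (i != a) && (i != b)}.
pose h (x : bool) := if x then a else b.
have hinj : injective h by move=> [] [] //= /eqP; rewrite ?(negPf ab)// eq_sym (negPf ab).
have hJ x (j : J) : h x != val j.
  by case: j => i /= /andP[ia ib]; case: x; rewrite eq_sym.
have key := indep_prod (std_gauss_vec (std_gauss_inj hinj gZ))
  (std_gauss_vec (std_gauss_inj val_inj gZ)) erefl erefl (@rectsT R bool) (@rectsT R J)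
  (@rectsI R bool) (@rectsI R J) (std_gauss_indep hinj val_inj hJ gZ).
pose D : set (vecT J) := [set x | forall j, B (val j) (x j)].
have mD : measurable D by apply: sub_sigma_algebra; exists (fun j => B (val j)).
pose p (x : vecT bool) : Rm * Rm := (x true, x false).
have mp : measurable_fun setT p by apply: measurable_fun_pair; exact: measurable_coord.
have mC (C : set (Rm * Rm)) : measurable C -> measurable (p @^-1` C).
  by move=> mC; rewrite -[X in measurable X]setTI; exact: mp.
have mBB : measurable (B a `*` B b : set (Rm * Rm)).
  exact: (@measurableX _ _ Rm Rm _ _ (mB a) (mB b)).
have mrBB : measurable (rot c s @^-1` (B a `*` B b)).
  by rewrite -[X in measurable X]setTI; exact: measurable_rot.
transitivity (P [set w | (p @^-1` (rot c s @^-1` (B a `*` B b))) (fun x => Z (h x) w)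
                         /\ D (fun j => Z (val j) w)]).
  congr (P _); apply/seteqP; split => w /=.
    move=> hB; split; last first.
      move=> j; have := hB (val j); rewrite eq_sym (negPf (hJ true j)).
      by rewrite eq_sym (negPf (hJ false j)).
    have := hB a; have := hB b; rewrite !eqxx eq_sym (negPf ab) => h1 h2.
    by split.
  move=> [[/= h1 h2] hJB] i; have [->//|ia] := eqVneq i a.
  have [->//|ib] := eqVneq i b.
  have ij : (i != a) && (i != b) by rewrite ia.
  exact: (hJB (exist _ i ij)).
rewrite key//; last exact: mC.
rewrite -(proj2 gZ)//.
transitivity (P [set w | (p @^-1` (B a `*` B b)) (fun x => Z (h x) w)
                         /\ D (fun j => Z (val j) w)]).
  rewrite key//; last exact: mC.
  congr (_ * _)%E.
  have := std_gauss_pair ab gZ mrBB; rewrite (normal_rot cs s0 mBB).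
  by rewrite -(std_gauss_pair ab gZ mBB).
congr (P _); apply/seteqP; split => w /=.
  move=> [[/= h1 h2] hJB] i; have [->//|ia] := eqVneq i a.
  have [->//|ib] := eqVneq i b.
  have ij : (i != a) && (i != b) by rewrite ia.
  exact: (hJB (exist _ i ij)).
by move=> hB; split => // j; exact: hB.
Qed.

Definition mulfam (I J : finType) (M : J -> I -> R) (Z : I -> T -> R) : J -> T -> R :=
  fun j w => \sum_i M j i * Z i w.

Lemma mulfam_mulmx n (A B : 'M[R]_n) Z :
  mulfam (A *m B) Z = mulfam A (mulfam B Z).
Proof.
apply/funext => i; apply/funext => w; rewrite /mulfam.
under [RHS]eq_bigr do rewrite mulr_sumr; rewrite exchange_big/=.
apply: eq_bigr => j _; rewrite mxE mulr_suml; apply: eq_bigr => k _.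
by rewrite mulrA.
Qed.

Lemma mulfam_refl n (v : 'cV[R]_n) Z i w :
  mulfam (refl v) Z i w = Z i w - 2 * v i 0 * \sum_j v j 0 * Z j w.
Proof.
rewrite /mulfam /refl; under eq_bigr do rewrite !mxE big_ord1 !mxE mulrBl.
rewrite sumrB (bigD1 i)//= eqxx mul1r big1 ?addr0; last first.
  by move=> j /negPf ji; rewrite eq_sym ji mul0r.
congr (_ - _); rewrite mulr_sumr; apply: eq_bigr => j _.
by rewrite !mulrA.
Qed.

(** In the plane of e_a and e_b a reflection is a rotation followed by a change of sign of
    coordinate [b]. The rotation has sine 2 v_a v_b; when this vanishes the reflection is itself a
    sign change. *)
Lemma std_gauss_refl2 n (v : 'cV[R]_n) a b (Z : 'I_n -> T -> R) :
    a != b -> sqnorm v = 1 -> (forall i, i != a -> i != b -> v i 0 = 0) ->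
  std_gauss P Z -> std_gauss P (mulfam (refl v) Z).
Proof.
move=> ab; wlog vb : a b ab / v a 0 = 0 -> v b 0 != 0 => [wl v1 v0 gZ|].
  have [vb|vb] := eqVneq (v b 0) 0; last exact: (wl a b).
  have [va|va] := eqVneq (v a 0) 0; last first.
    by apply: (wl b a) => //; [rewrite eq_sym|move=> i ib ia; exact: v0].
  move: v1; rewrite /sqnorm big1 => [/eqP|i _]; first by rewrite eq_sym oner_eq0.
  have [->|ia] := eqVneq i a; first by rewrite va expr0n.
  by have [->|ib] := eqVneq i b; rewrite ?vb ?v0 ?expr0n.
move=> v1 v0 gZ.
have ba : b != a by rewrite eq_sym.
have sum2 F : (forall i, i != a -> i != b -> F i = 0) -> \sum_i F i = F a + F b :> R.
  move=> F0; rewrite (bigD1 a)//= (bigD1 b)//= big1 ?addr0// => i /andP[ia ib].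
  exact: F0.
have vab : v a 0 ^+ 2 + v b 0 ^+ 2 = 1.
  by rewrite -v1 /sqnorm sum2// => i ia ib; rewrite v0// expr0n.
have E w : \sum_j v j 0 * Z j w = v a 0 * Z a w + v b 0 * Z b w.
  by rewrite sum2// => i ia ib; rewrite v0// mul0r.
have [va|va] := eqVneq (v a 0) 0.
  have vb1 : v b 0 ^+ 2 = 1 by rewrite -vab va expr0n add0r.
  have := std_gauss_flip b gZ; congr (std_gauss P).
  apply/funext => i; apply/funext => w; rewrite mulfam_refl E va mul0r add0r.
  have [->|ib] := eqVneq i b; first by rewrite mulrA -(mulrA 2) -expr2 vb1; ring.
  have [->|ia] := eqVneq i a; first by rewrite va mulr0 mul0r subr0.
  by rewrite v0// mulr0 mul0r subr0.
have [vb0|vb0] := eqVneq (v b 0) 0.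
  have va1 : v a 0 ^+ 2 = 1 by rewrite -vab vb0 expr0n addr0.
  have := std_gauss_flip a gZ; congr (std_gauss P).
  apply/funext => i; apply/funext => w; rewrite mulfam_refl E vb0 mul0r addr0.
  have [->|ia] := eqVneq i a; first by rewrite mulrA -(mulrA 2) -expr2 va1; ring.
  have [->|ib] := eqVneq i b; first by rewrite vb0 mulr0 mul0r subr0.
  by rewrite v0// mulr0 mul0r subr0.
pose c := 1 - 2 * v a 0 ^+ 2; pose s := 2 * v a 0 * v b 0.
have vb2 : v b 0 ^+ 2 = 1 - v a 0 ^+ 2 by rewrite -vab addrAC subrr add0r.
have cs : c ^+ 2 + s ^+ 2 = 1.
  by rewrite /c /s 2!exprMn vb2; ring.
have s0 : s != 0 by rewrite !mulf_neq0// pnatr_eq0.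
have := std_gauss_flip b (std_gauss_rot ab cs s0 gZ); congr (std_gauss P).
apply/funext => i; apply/funext => w; rewrite mulfam_refl E eqxx (negPf ba).
have [->|ib] := eqVneq i b.
  rewrite /c /s mulrDr mulrA -!mulrA.
  have -> : v b 0 * (v b 0 * Z b w) = v b 0 ^+ 2 * Z b w by rewrite mulrA expr2.
  by rewrite vb2; ring.
have [->|ia] := eqVneq i a; first by rewrite /c /s; ring.
by rewrite v0// mulr0 mul0r subr0.
Qed.

Lemma refl_conj n (u v : 'cV[R]_n) : sqnorm u = 1 ->
  refl v = refl u *m refl (refl u *m v) *m refl u.
Proof.
move=> /refl_orth hU; have UU : refl u *m refl u = 1%:M by rewrite -{2}trmx_refl.
have -> : refl (refl u *m v) = 1%:M - 2 *: (refl u *m (v *m v^T) *m refl u).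
  by rewrite {1}/refl trmx_mul trmx_refl !mulmxA.
rewrite {1}/refl; move: (refl u) (v *m v^T) UU => r w rr.
rewrite mulmxBr mulmxBl mulmx1 rr -scalemxAr -scalemxAl !mulmxA rr mul1mx.
by rewrite -!mulmxA rr mulmx1.
Qed.

(** Induction on the size of the support of [v]. A reflection in one coordinate plane moves [v] to a
    vector with one more zero, and [refl_conj] writes [refl v] as a conjugate by it. *)
Lemma std_gauss_refl n (v : 'cV[R]_n) (Z : 'I_n -> T -> R) :
  sqnorm v = 1 -> std_gauss P Z -> std_gauss P (mulfam (refl v) Z).
Proof.
have [k] := ubnP #|[pred i | v i 0 != 0]|; elim: k v Z => // k IH v Z vk v1 gZ.
have [a va|v0] := pickP [pred i | v i 0 != 0]; last first.
  move: v1; rewrite /sqnorm big1 => [/eqP|i _]; first by rewrite eq_sym oner_eq0.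
  by have /negbFE/eqP -> := v0 i; rewrite expr0n.
have [b /andP[vb ba]|v0] := pickP [pred i | (v i 0 != 0) && (i != a)]; last first.
  have vi i : i != a -> v i 0 = 0.
    by move=> ia; have := v0 i; rewrite /= ia andbT => /negbFE/eqP.
  have va1 : v a 0 ^+ 2 = 1.
    rewrite -v1 /sqnorm (bigD1 a)//= big1 ?addr0// => i ia.
    by rewrite vi// expr0n.
  have := std_gauss_flip a gZ; congr (std_gauss P).
  apply/funext => i; apply/funext => w; rewrite mulfam_refl.
  rewrite (bigD1 a)//= big1 ?addr0; last by move=> j ja; rewrite vi// mul0r.
  have [->|ia] := eqVneq i a; first by rewrite mulrA -(mulrA 2) -expr2 va1; ring.
  by rewrite vi// mulr0 mul0r subr0.
have ab : a != b by rewrite eq_sym.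
(* [w] gathers the mass of coordinates [a] and [b] in [a]; hence the direction of v - w lies in that
   plane. *)
pose r := Num.sqrt (v a 0 ^+ 2 + v b 0 ^+ 2).
pose w : 'cV[R]_n := \col_i (if i == a then r else if i == b then 0 else v i 0).
have sqw : sqnorm v = sqnorm w.
  rewrite /sqnorm (bigD1 a)//= (bigD1 b)//= [RHS](bigD1 a)//= [in RHS](bigD1 b)//=.
  rewrite !mxE eqxx (negPf ba) eqxx /r sqr_sqrtr ?addr_ge0 ?sqr_ge0// expr0n/= add0r addrA.
  congr (_ + _); apply: eq_bigr => i /andP[/negPf ia /negPf ib].
  by rewrite mxE ia ib.
have vw : v != w.
  by apply: contraNneq vb => /colP/(_ b); rewrite mxE eqxx (negPf ba) => ->.
have [u1 uv] := refl_exchange sqw vw; set u := _ *: _ in u1 uv.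
have u0 i : i != a -> i != b -> u i 0 = 0.
  by move=> /negPf ia /negPf ib; rewrite !mxE ia ib subrr mulr0.
rewrite (refl_conj v u1) uv !mulfam_mulmx.
apply: (std_gauss_refl2 ab u1 u0); apply: IH; last first.
- exact: (std_gauss_refl2 ab u1 u0).
- by rewrite -sqw.
rewrite ltnS in vk; apply: leq_trans vk.
apply: proper_card; apply/properP; split; last first.
  by exists b; rewrite !inE// mxE eqxx (negPf ba) eqxx.
apply/fintype.subsetP => i; rewrite !inE mxE.
by have [->//|ia] := eqVneq i a; have [->|//] := eqVneq i b; rewrite eqxx.
Qed.

Lemma std_gauss_orthomx n (A : 'M[R]_n) (Z : 'I_n -> T -> R) :
  orthomx A -> std_gauss P Z -> std_gauss P (mulfam A Z).
Proof.
move=> hA gZ; move: A hA; apply: orthomx_refl_ind => [|v M v1 gM].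
  move: gZ; congr (std_gauss P); apply/funext => i; apply/funext => w.
  rewrite /mulfam (bigD1 i)//= big1 ?addr0 ?mxE ?eqxx ?mul1r// => j ji.
  by rewrite mxE eq_sym (negPf ji) mul0r.
by rewrite mulfam_mulmx; exact: std_gauss_refl.
Qed.

(** Enumerating the index type reduces this to square matrices. It is applied to index pairs, such
    as (coordinate, observation). *)
Lemma std_gauss_orth (I : finType) (M : I -> I -> R) (Z : I -> T -> R) :
    (forall i j, \sum_k M i k * M j k = (i == j)%:R) ->
  std_gauss P Z -> std_gauss P (mulfam M Z).
Proof.
move=> hM gZ; pose A : 'M[R]_#|I| := \matrix_(i, j) M (enum_val i) (enum_val j).
have hA : orthomx A.
  apply/matrixP => i j; rewrite [RHS]mxE -(inj_eq enum_val_inj) -hM mxE.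
  rewrite [RHS](reindex_onto enum_val enum_rank)/=; last by move=> k _; rewrite enum_rankK.
  by under [RHS]eq_bigl do rewrite enum_valK eqxx; apply: eq_bigr => k _; rewrite !mxE.
have := std_gauss_orthomx hA (std_gauss_inj enum_val_inj gZ).
move=> /(std_gauss_inj enum_rank_inj); congr (std_gauss P).
apply/funext => i; apply/funext => w; rewrite /mulfam.
rewrite [RHS](reindex_onto enum_val enum_rank)/=; last by move=> k _; rewrite enum_rankK.
under [RHS]eq_bigl do rewrite enum_valK eqxx.
by apply: eq_bigr => k _; rewrite mxE enum_rankK.
Qed.

End invariance.

(** * Concentration of chi-square variables *)

Section independence_integral.
Context {R : realType} d (T : measurableType d) (P : probability T R).
Context d1 (U : measurableType d1) d2 (V : measurableType d2).
Variables (X : T -> U) (Y : T -> V).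
Hypotheses (mX : measurable_fun setT X) (mY : measurable_fun setT Y).
Variables (C1 : set (set U)) (C2 : set (set V)).
Hypotheses (C1E : measurable = <<s C1 >>) (C2E : measurable = <<s C2 >>).
Hypotheses (C1T : C1 setT) (C2T : C2 setT).
Hypotheses (C1I : setI_closed C1) (C2I : setI_closed C2).
Hypothesis indep : forall A B, C1 A -> C2 B ->
  P [set w | A (X w) /\ B (Y w)] = (P (X @^-1` A) * P (Y @^-1` B))%E.

Lemma indep_ge0_integralM (f : U -> \bar R) (g : V -> \bar R) :
    (forall x, 0 <= f x)%E -> (forall y, 0 <= g y)%E ->
    measurable_fun setT f -> measurable_fun setT g ->
  (\int[P]_w (f (X w) * g (Y w)) = (\int[P]_w f (X w)) * (\int[P]_w g (Y w)))%E.
Proof.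
move=> f0 g0 mf mg.
pose pX : {mfun T >-> U} := HB.pack X (isMeasurableFun.Build _ _ _ _ _ mX).
pose pY : {mfun T >-> V} := HB.pack Y (isMeasurableFun.Build _ _ _ _ _ mY).
have mXY : measurable_fun setT (fun w => (X w, Y w)) by exact: measurable_fun_pair.
pose pXY : {mfun T >-> (U * V)%type} :=
  HB.pack (fun w => (X w, Y w)) (isMeasurableFun.Build _ _ _ _ _ mXY).
have mfg : measurable_fun setT (fun z : U * V => f z.1 * g z.2)%E.
  by apply: emeasurable_funM; exact: measurableT_comp.
have fg0 (z : U * V) : (0 <= f z.1 * g z.2)%E by exact: mule_ge0.
transitivity (\int[distribution P pXY]_z (f z.1 * g z.2))%E.
  by rewrite ge0_integral_distribution.
transitivity (\int[distribution P pX \x distribution P pY]_z (f z.1 * g z.2))%E.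
  apply: eq_measure_integral => D mD _.
  exact: (indep_law mX mY C1E C2E C1T C2T C1I C2I indep mD).
rewrite fubini_tonelli1// /fubini_F/=.
under eq_integral do rewrite ge0_integralZl//.
rewrite ge0_integralZr//; last exact: integral_ge0.
by rewrite !ge0_integral_distribution.
Qed.

End independence_integral.

Section chi_square.
Context {R : realType} d (T : measurableType d) (P : probability T R).

Lemma std_gauss_integral (I : finType) (Z : I -> T -> R) i (f : R -> \bar R) :
    std_gauss P Z -> (forall x, 0 <= f x)%E -> measurable_fun setT f ->
  (\int[P]_w f (Z i w) = \int[normal_prob 0 1]_x f x)%E.
Proof.
move=> gZ f0 mf.
have mZi : measurable_fun setT (Z i : T -> measurableTypeR R) := gZ.1 i.
pose X : {mfun T >-> measurableTypeR R} := HB.pack (Z i) (isMeasurableFun.Build _ _ _ _ _ mZi).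
rewrite -(@ge0_integral_distribution _ _ _ _ _ P X f)//.
apply: (@eq_measure_integral _ _ _ setT (normal_prob 0 1)) => D mD _.
exact: (@std_gauss_mul_one _ _ _ _ _ Z i gZ D mD).
Qed.

Lemma std_gauss_integral_prod k (Z : 'I_k -> T -> R) (f : R -> R) :
    std_gauss P Z -> (forall x, 0 <= f x) -> measurable_fun setT f ->
  (\int[P]_w (\prod_i f (Z i w))%:E = (\int[normal_prob 0%R 1%R]_x (f x)%:E) ^+ k)%E.
Proof.
move=> gZ f0 mf; elim: k Z gZ => [|k IH] Z gZ.
  under eq_integral do rewrite big_ord0.
  by rewrite integral_cst// mul1e expe0; exact: probability_setT.
have inj0 : injective (fun _ : unit => @ord0 k) by case; case.
have injl := @lift_inj k.+1 ord0.
have d0 (u : unit) (i : 'I_k) : ord0 != lift ord0 i by [].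
pose F (x : vecT unit) : \bar R := (f (x tt))%:E.
pose G (x : vecT 'I_k) : \bar R := (\prod_i f (x i))%:E.
have mF : measurable_fun setT F.
  by apply/measurable_EFinP; apply: measurableT_comp => //; exact: measurable_coord.
have mG : measurable_fun setT G.
  apply/measurable_EFinP; apply: measurable_prod => i _.
  by apply: measurableT_comp => //; exact: measurable_coord.
transitivity (\int[P]_w (F (fun _ => Z ord0 w) * G (fun i => Z (lift ord0 i) w)))%E.
  by apply: eq_integral => w _; rewrite big_ord_recl EFinM.
rewrite (indep_ge0_integralM (std_gauss_vec (std_gauss_inj inj0 gZ))
  (std_gauss_vec (std_gauss_inj injl gZ)) erefl erefl (@rectsT R unit) (@rectsT R 'I_k)
  (@rectsI R unit) (@rectsI R 'I_k) (std_gauss_indep inj0 injl d0 gZ))//; last 2 first.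
- by move=> x; rewrite lee_fin.
- by move=> x; rewrite lee_fin prodr_ge0.
rewrite (IH _ (std_gauss_inj injl gZ)) expeS; congr (_ * _)%E.
apply: (@std_gauss_integral _ Z ord0 (EFin \o f)) => //.
exact/measurable_EFinP.
Qed.

(** The integrand times the N(0, 1) density is sqrt v times the N(0, v) density. Parametrising the
    exponent by the variance [v] keeps the moment generating function of a squared normal variable
    finite for every v > 0. *)
Lemma normal_exp_sqr (v : R) : 0 < v ->
  (\int[normal_prob 0 1]_x (expR ((1 - v^-1) / 2 * x ^+ 2))%:E =
   (Num.sqrt v)%:E :> \bar R)%E.
Proof.
move=> v0; have s0 : Num.sqrt v != 0 by rewrite gt_eqF// sqrtr_gt0.
have mexp : measurable_fun setT (fun x : R => expR ((1 - v^-1) / 2 * x ^+ 2)).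
  by apply: measurableT_comp => //; apply: measurable_funM => //; exact: exprn_measurable.
rewrite ge0_integral_normal_prob; last 2 first.
- by move=> x; rewrite lee_fin expR_ge0.
- exact/measurable_EFinP.
transitivity (\int[lebesgue_measure]_x ((Num.sqrt v)%:E * (normal_pdf 0 (Num.sqrt v) x)%:E))%E.
  apply: eq_integral => x _; rewrite -!EFinM !normal_pdfE ?oner_neq0//; congr (_%:E).
  rewrite /normal_fun /normal_peak subr0 expr1n mul1r sqr_sqrtr ?ltW//.
  rewrite -[v * pi *+ 2]mulrnAr sqrtrM ?ltW// invfM.
  rewrite -[X in _ = _ * X]mulrA mulVKf// [LHS]mulrCA -expRD; congr (_ * expR _).
  by field; rewrite gt_eqF.
rewrite ge0_integralZl//.
- by rewrite integral_normal_pdf mule1.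
- by apply/measurable_EFinP; exact: measurable_normal_pdf.
- by move=> x _; rewrite lee_fin normal_pdf_ge0.
Qed.

Lemma measurable_bool_set (b : T -> bool) : measurable_fun setT b ->
  measurable [set w | b w].
Proof.
move=> mb; rewrite (_ : [set w | b w] = setT `&` b @^-1` [set true]).
  exact: mb.
by rewrite setTI; apply/seteqP; split => w /=.
Qed.

(* Chernoff's bound; the exponent is chosen so that the moment generating
   function of Z^2 is sqrt (1 + delta / 2). *)
Lemma chi_square_tail k (Z : 'I_k -> T -> R) (dl : R) : -1 < dl ->
    std_gauss P Z ->
  (P [set w | dl * ((1 + dl) * k%:R) <= dl * \sum_i Z i w ^+ 2]%R <=
   (expR (- dl ^+ 2 / (8 * (1 + dl / 2))) ^+ k)%:E)%E.
Proof.
move=> dl1 gZ; pose v := 1 + dl / 2.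
have v0 : 0 < v by rewrite /v; lra.
pose l := (1 - v^-1) / 2.
have lE : l = dl / (4 * v) by rewrite /l /v; field; rewrite gt_eqF//; move: v0; rewrite /v; lra.
pose S w := \sum_i Z i w ^+ 2.
have mS : measurable_fun setT S.
  by apply: measurable_sum => i; apply: measurable_funX; exact: gZ.1.
pose g w := expR (l * S w - l * ((1 + dl) * k%:R)).
have mg : measurable_fun setT g.
  by apply: measurableT_comp => //; apply: measurable_funB => //; exact: measurable_funM.
set A := [set w | _].
have mA : measurable A.
  by apply: measurable_bool_set; apply: measurable_fun_ler => //; exact: measurable_funM.
(* [l] has the sign of [dl], so the event multiplied by [dl] covers the upper tail ([dl > 0]) and
   the lower tail ([dl < 0]) at once. *)
have Ag w : A w -> 1 <= g w.
  rewrite /A/= => Aw; rewrite -expR0 ler_expR subr_ge0 lE.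
  rewrite -(mulrA dl) -(mulrA dl) [dl * (_ * S w)]mulrCA [dl * (_ * _)]mulrCA.
  by rewrite ler_wpM2l// invr_ge0 mulr_ge0// ltW.
apply: (@le_trans _ _ (\int[P]_w (g w)%:E)%E).
  rewrite -[X in P X]setIT -integral_indic//; apply: ge0_le_integral => //.
  - by apply/measurable_EFinP; exact: measurable_indic.
  - exact/measurable_EFinP.
  - move=> w _; rewrite lee_fin indicE.
    by have [/set_mem/Ag//|_] := boolP (w \in A); rewrite expR_ge0.
have -> : (\int[P]_w (g w)%:E = \int[P]_w ((\prod_i expR (l * Z i w ^+ 2))%:E *
    (expR (- (l * ((1 + dl) * k%:R))))%:E))%E.
  apply: eq_integral => w _; rewrite /g expRD EFinM -expR_sum; congr (_%:E * _)%E.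
  by rewrite /S mulr_sumr.
have mf : measurable_fun setT (fun x : R => expR (l * x ^+ 2)).
  by apply: measurableT_comp => //; apply: measurable_funM => //; exact: exprn_measurable.
rewrite ge0_integralZr//; last 2 first.
- apply/measurable_EFinP; apply: measurable_prod => i _.
  by apply: (measurableT_comp mf); exact: gZ.1.
- by move=> w _; rewrite lee_fin prodr_ge0// => i _; exact: expR_ge0.
rewrite (std_gauss_integral_prod gZ (f := fun x => expR (l * x ^+ 2)))//.
rewrite normal_exp_sqr// -EFin_expe -EFinM lee_fin.
have -> : - (l * ((1 + dl) * k%:R)) = - (l * (1 + dl)) *+ k by rewrite mulrA -mulNr mulr_natr.
rewrite -[- (l * _) *+ k]mulr_natr expRM_natr -exprMn lerXn2r ?nnegrE ?mulr_ge0 ?sqrtr_ge0 ?expR_ge0//.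
(* From 1 + x <= exp x at x = dl / 2. The exponent dl / 4 - l (1 + dl) then equals - dl^2 / (8 (1 +
   dl / 2)). *)
have sv : Num.sqrt v <= expR (dl / 4).
  rewrite -(ger0_norm (expR_ge0 (dl / 4))) -sqrtr_sqr ler_sqrt ?exprn_ge0 ?expR_ge0//.
  rewrite expr2 -expRD /v (le_trans (expR_ge1Dx (dl / 2)))// ler_expR; lra.
apply: le_trans (ler_wpM2r (expR_ge0 _) sv) _; rewrite -expRD ler_expR lE -/v.
rewrite le_eqVlt; apply/orP; left; apply/eqP; rewrite /v; field.
by rewrite gt_eqF//; move: v0; rewrite /v; lra.
Qed.

Lemma chi_square_concentration k (Z : 'I_k -> T -> R) (eps : R) :
    0 < eps -> eps < 1 -> std_gauss P Z ->
  (P [set w | eps * k%:R <= `|\sum_i Z i w ^+ 2 - k%:R| ]%R <=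
   (expR (- eps ^+ 2 / 12) ^+ k *+ 2)%:E)%E.
Proof.
move=> e0 e1 gZ; pose S w := \sum_i Z i w ^+ 2.
have mS : measurable_fun setT S.
  by apply: measurable_sum => i; apply: measurable_funX; exact: gZ.1.
pose A dl := [set w | dl * ((1 + dl) * k%:R) <= dl * S w].
have mA dl : measurable (A dl).
  by apply: measurable_bool_set; apply: measurable_fun_ler => //; exact: measurable_funM.
(* The constant 12 bounds 8 (1 + dl / 2) for dl <= 1; it serves dl = eps and dl = - eps. *)
have bnd dl : -1 < dl -> dl ^+ 2 = eps ^+ 2 -> dl <= 1 ->
    (P (A dl) <= (expR (- eps ^+ 2 / 12) ^+ k)%:E)%E.
  move=> dl1 dle dl1'; apply: le_trans (chi_square_tail dl1 gZ) _.
  rewrite lee_fin lerXn2r ?nnegrE ?expR_ge0// ler_expR dle.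
  rewrite !mulNr lerN2 ler_wpM2l ?sqr_ge0// lef_pV2 ?posrE; lra.
apply: (@le_trans _ _ (P (A eps `|` A (- eps)))).
  apply: le_measure; rewrite ?inE.
  - apply: measurable_bool_set; apply: measurable_fun_ler => //.
    by apply: measurableT_comp => //; exact: measurable_funB.
  - exact: measurableU.
  - move=> w /=; rewrite -/(S w) ler_normr => /orP[h|h]; [left|right]; rewrite /A/=.
      by rewrite ler_pM2l//; lra.
    by rewrite ler_nM2l ?oppr_lt0//; lra.
apply: le_trans (measureU2 _ _ _) _ => //.
rewrite mulr2n EFinD leeD ?bnd ?sqrrN//; lra.
Qed.

Lemma normal_prob_point (x : R) : normal_prob (0 : R) 1 [set x] = 0%E.
Proof.
apply: (null_content_dominatesP (normal_prob (0:R) 1) lebesgue_measure).1 => //.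
- exact: normal_prob_dominates.
- exact: lebesgue_measure_set1.
Qed.

Lemma std_gauss_point (I : finType) (Z : I -> T -> R) i : std_gauss P Z ->
  P [set w | Z i w = 0] = 0%E.
Proof.
move=> gZ; rewrite (_ : [set w | _] = Z i @^-1` [set 0])//.
by rewrite (std_gauss_mul_one i gZ)// normal_prob_point.
Qed.

End chi_square.

(** * Gaussian matrices *)

Section matrix_measurability.
Context {R : realType} d (T : measurableType d).

Lemma measurable_invr : measurable_fun setT (fun x : R => x^-1).
Proof.
rewrite -(setvU [set 0 : R]); apply/measurable_funU => //.
- by apply: measurableC; exact: measurable_set1.
- split; last exact: measurable_fun_set1.
  apply: open_continuous_measurable_fun => [|x].
    by apply: closed_openC; exact: closed_eq.
  by rewrite inE/= => /eqP x0; exact: inv_continuous.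
Qed.

Lemma measurable_preim (f : T -> R) (A : set R) : measurable_fun setT f ->
  measurable A -> measurable [set w | A (f w)].
Proof. by move=> mf mA; rewrite -[X in measurable X]setTI; exact: mf. Qed.

Definition mxmeas m n (F : T -> 'M[R]_(m, n)) :=
  forall i j, measurable_fun setT (fun w => F w i j).

Lemma mxmeas_cst m n (A : 'M[R]_(m, n)) : mxmeas (fun=> A).
Proof. by move=> i j; exact: measurable_cst. Qed.

Lemma mxmeas_mul m n p (F : T -> 'M[R]_(m, n)) (G : T -> 'M[R]_(n, p)) :
  mxmeas F -> mxmeas G -> mxmeas (fun w => F w *m G w).
Proof.
move=> mF mG i j; under eq_fun do rewrite mxE.
by apply: measurable_sum => k; exact: measurable_funM.
Qed.

Lemma mxmeas_tr m n (F : T -> 'M[R]_(m, n)) : mxmeas F -> mxmeas (fun w => (F w)^T).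
Proof. by move=> mF i j; under eq_fun do rewrite mxE; exact: mF. Qed.

Lemma mxmeas_sub m n (F G : T -> 'M[R]_(m, n)) :
  mxmeas F -> mxmeas G -> mxmeas (fun w => F w - G w).
Proof.
move=> mF mG i j; under eq_fun do rewrite !mxE.
exact: measurable_funB.
Qed.

Lemma mxmeas_add m n (F G : T -> 'M[R]_(m, n)) :
  mxmeas F -> mxmeas G -> mxmeas (fun w => F w + G w).
Proof.
move=> mF mG i j; under eq_fun do rewrite !mxE.
exact: measurable_funD.
Qed.

Lemma mxmeas_scale m n (a : T -> R) (F : T -> 'M[R]_(m, n)) :
  measurable_fun setT a -> mxmeas F -> mxmeas (fun w => a w *: F w).
Proof.
move=> ma mF i j; under eq_fun do rewrite !mxE.
exact: measurable_funM.
Qed.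

Lemma mxmeas_sum (I : Type) (s : seq I) m n (F : I -> T -> 'M[R]_(m, n)) :
  (forall i, mxmeas (F i)) -> mxmeas (fun w => \sum_(i <- s) F i w).
Proof.
move=> mF i j; under eq_fun do rewrite summxE.
by apply: measurable_sum => k; exact: mF.
Qed.

Lemma measurable_sqnorm n (F : T -> 'cV[R]_n) : mxmeas F ->
  measurable_fun setT (fun w => sqnorm (F w)).
Proof.
by move=> mF; apply: measurable_sum => i; apply: measurable_funX; exact: mF.
Qed.

Lemma measurable_det n (F : T -> 'M[R]_n) : mxmeas F ->
  measurable_fun setT (fun w => \det (F w)).
Proof.
move=> mF; apply: measurable_sum => s; apply: measurable_funM => //.
by apply: measurable_prod => i _; exact: mF.
Qed.

Lemma measurable_unitmx n (F : T -> 'M[R]_n) : mxmeas F ->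
  measurable_fun setT (fun w => F w \in unitmx).
Proof.
move=> mF; under eq_fun do rewrite unitmxE unitfE.
apply: measurable_neg; apply: measurable_fun_eqr => //; exact: measurable_det.
Qed.

(** Cofactors on the invertible matrices; elsewhere [invmx] returns its argument, so measurability
    holds everywhere. *)
Lemma mxmeas_inv n (F : T -> 'M[R]_n) : mxmeas F -> mxmeas (fun w => invmx (F w)).
Proof.
move=> mF i j; rewrite /invmx.
rewrite (_ : (fun _ => _) = (fun w => if F w \in unitmx
    then (\det (F w))^-1 * \adj (F w) i j else F w i j)); last first.
  by apply/funext => w; case: ifP => _ //; rewrite mxE.
apply: measurable_fun_ifT => //; first exact: measurable_unitmx.
apply: measurable_funM.
  by apply: (measurableT_comp measurable_invr); exact: measurable_det.
under eq_fun do rewrite mxE; rewrite /cofactor; apply: measurable_funM => //.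
by apply: measurable_det => a b; under eq_fun do rewrite !mxE; exact: mF.
Qed.

Lemma mxmeas_gram m n (F : T -> 'M[R]_(m, n)) : mxmeas F -> mxmeas (fun w => gram (F w)).
Proof. by move=> mF; apply: mxmeas_mul => //; exact: mxmeas_tr. Qed.

Lemma mxmeas_regr k n (F : T -> 'M[R]_(k, n)) (g : T -> 'cV[R]_n) :
  mxmeas F -> mxmeas g -> mxmeas (fun w => regr (F w) (g w)).
Proof.
move=> mF mg; apply: mxmeas_mul => //; apply: mxmeas_mul => //.
by apply: mxmeas_inv; exact: mxmeas_gram.
Qed.

Lemma mxmeas_resid k n (F : T -> 'M[R]_(k, n)) (g : T -> 'cV[R]_n) :
  mxmeas F -> mxmeas g -> mxmeas (fun w => resid (F w) (g w)).
Proof.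
move=> mF mg; apply: mxmeas_sub => //; apply: mxmeas_mul; first exact: mxmeas_tr.
exact: mxmeas_regr.
Qed.

End matrix_measurability.

(** * Residuals and regression coefficients of a Gaussian matrix *)

Section gauss_matrix.
Context {R : realType}.

Definition mxfam m n (x : 'I_m * 'I_n -> R) : 'M[R]_(m, n) := \matrix_(i, j) x (i, j).
Definition cvfam n (x : 'I_n -> R) : 'cV[R]_n := \col_i x i.
Definition lows m n (ij : 'I_m * 'I_n) : 'I_m.+1 * 'I_n := (lift ord0 ij.1, ij.2).
Definition top m n (j : 'I_n) : 'I_m.+1 * 'I_n := (ord0, j).

Lemma lows_inj m n : injective (@lows m n).
Proof.
move=> [i j] [i' j'] ij; have := congr1 snd ij; have := congr1 fst ij.
by move=> /= /lift_inj -> ->.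
Qed.

Lemma top_inj m n : injective (@top m n).
Proof. by move=> j j' []. Qed.

Lemma lows_top m n i j : @lows m n i != top m j.
Proof. by apply/eqP => /(congr1 fst)/eqP; rewrite eq_sym (negPf (neq_lift _ _)). Qed.

Lemma mxfam_col_mx m n (x : 'I_m.+1 * 'I_n -> R) :
  mxfam x = col_mx (cvfam (x \o @top m n))^T (mxfam (x \o @lows m n)).
Proof.
apply/matrixP => i j; rewrite !mxE; case: splitP => k ik; rewrite !mxE/=.
  by congr x; congr pair; apply: val_inj; rewrite /= ik ord1.
by congr x; congr pair; apply: val_inj; rewrite /= ik.
Qed.

Lemma mxmeas_mxfam m n d (T : measurableType d) (F : T -> vecT ('I_m * 'I_n)) :
  measurable_fun setT F -> mxmeas (fun w => mxfam (F w)).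
Proof.
move=> mF i j; under eq_fun do rewrite mxE.
exact: (measurableT_comp (@measurable_coord R _ (i, j)) mF).
Qed.

Lemma mxmeas_cvfam n d (T : measurableType d) (F : T -> vecT 'I_n) :
  measurable_fun setT F -> mxmeas (fun w => cvfam (F w)).
Proof.
move=> mF i j; under eq_fun do rewrite mxE.
exact: (measurableT_comp (@measurable_coord R _ i) mF).
Qed.

Context d (T : measurableType d) (P : probability T R).

Section rows.
Variables (k N : nat) (Z : 'I_k.+1 * 'I_N -> T -> R).
Hypothesis gZ : std_gauss P Z.

Let X w : vecT ('I_k * 'I_N) := fun i => Z (lows i) w.
Let Y w : vecT 'I_N := fun j => Z (top k j) w.

Lemma rows_fubini (C : set (vecT ('I_k * 'I_N) * vecT 'I_N)) : measurable C ->
  P [set w | C (X w, Y w)] = (\int[P]_w P [set w' | C (X w, Y w')])%E /\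
  P [set w | C (X w, Y w)] = (\int[P]_w' P [set w | C (X w, Y w')])%E.
Proof.
have hX := std_gauss_vec (std_gauss_inj (@lows_inj k N) gZ).
have hY := std_gauss_vec (std_gauss_inj (@top_inj k N) gZ).
have hI := std_gauss_indep (@lows_inj k N) (@top_inj k N) (@lows_top k N) gZ.
move=> mC; split.
- exact: (indep_fubini hX hY erefl erefl (@rectsT R _) (@rectsT R _) (@rectsI R _)
    (@rectsI R _) hI mC).
- exact: (indep_fubini_sym hX hY erefl erefl (@rectsT R _) (@rectsT R _) (@rectsI R _)
    (@rectsI R _) hI mC).
Qed.

Lemma rows_section_measurable (C : set (vecT ('I_k * 'I_N) * vecT 'I_N)) : measurable C ->
  measurable_fun setT (fun w => P [set w' | C (X w, Y w')]).
Proof.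
have hX := std_gauss_vec (std_gauss_inj (@lows_inj k N) gZ).
have hY := std_gauss_vec (std_gauss_inj (@top_inj k N) gZ).
exact: measurable_indep_section.
Qed.

End rows.

Lemma measurable_fst_vec (I J : Type) : measurable_fun setT (fun z : @vecT R I * @vecT R J => z.1).
Proof. exact: measurable_fst. Qed.
Lemma measurable_snd_vec (I J : Type) : measurable_fun setT (fun z : @vecT R I * @vecT R J => z.2).
Proof. exact: measurable_snd. Qed.

Lemma cvfam_mulfam n (A : 'M[R]_n) (Z : 'I_n -> T -> R) w :
  cvfam (mulfam A Z ^~ w) = A *m cvfam (Z ^~ w).
Proof. by apply/colP => i; rewrite !mxE; apply: eq_bigr => j _; rewrite !mxE. Qed.

(** With an invertible [gram G] frozen, |resid|^2 is the sum of squares of the last [r] coordinates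
    of U g, which are standard normal again. A singular [gram G] contributes nothing on the left,
    whence an inequality; almost sure invertibility is itself deduced from it below. *)
Lemma resid_law k r (Z : 'I_k.+1 * 'I_(k + r) -> T -> R) (Z' : 'I_r -> T -> R) (A : set R) :
    measurable A -> std_gauss P Z -> std_gauss P Z' ->
  (P [set w | let G := mxfam (fun i => Z (lows i) w) in gram G \in unitmx /\
              A (sqnorm (resid G (cvfam (fun j => Z (top k j) w))))] <=
   P [set w | A (\sum_i Z' i w ^+ 2)%R])%E.
Proof.
move=> mA gZ gZ'.
pose C : set (vecT ('I_k * 'I_(k + r)) * vecT 'I_(k + r)) :=
  [set z | gram (mxfam z.1) \in unitmx /\ A (sqnorm (resid (mxfam z.1) (cvfam z.2)))].
have m1 := mxmeas_mxfam (@measurable_fst_vec ('I_k * 'I_(k + r)) 'I_(k + r)).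
have m2 := mxmeas_cvfam (@measurable_snd_vec ('I_k * 'I_(k + r)) 'I_(k + r)).
have mC : measurable C.
  apply: measurableI.
    by apply: measurable_bool_set; apply: measurable_unitmx; exact: mxmeas_gram.
  rewrite -[X in measurable X]setTI.
  by apply: measurable_sqnorm mA => //; exact: mxmeas_resid.
rewrite [leLHS](rows_fubini gZ mC).1.
apply: (@le_trans _ _ (\int[P]_w (P [set w | A (\sum_i Z' i w ^+ 2)%R]))%E); last first.
  by rewrite integral_cst//= -[leRHS]mule1 lee_wpmul2l// probability_le1.
apply: ge0_le_integral => //; first exact: rows_section_measurable.
move=> w _; rewrite /C/=; set G := mxfam _.
have [W|W] := boolP (gram G \in unitmx); last first.
  by rewrite (_ : [set _ | _] = set0) ?measure0//; apply/seteqP; split => // w' [].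
have [U hU resE] := polar_regr W.
have gU := std_gauss_orthomx hU (std_gauss_inj (@top_inj k _) gZ).
have gU' := std_gauss_inj (@rshift_inj k r) gU.
pose D : set (@vecT R 'I_r) := [set x | A (\sum_i x i ^+ 2)].
have mD : measurable D.
  rewrite -[X in measurable X]setTI.
  have mS : measurable_fun setT (fun x : @vecT R 'I_r => \sum_i x i ^+ 2).
    by apply: measurable_sum => i; apply: measurable_funX; exact: measurable_coord.
  exact: mS.
rewrite -[leRHS](std_gauss_law gU' gZ' mD) le_eqVlt; apply/orP; left; apply/eqP.
have sE w' : sqnorm (resid G (cvfam (fun j => Z (top k j) w'))) =
    \sum_(i < r) mulfam U (fun j => Z (top k j)) (rshift k i) w' ^+ 2.
  rewrite (resE _).1 -(cvfam_mulfam U (fun j => Z (top k j)) w').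
  by apply: eq_bigr => i _; rewrite !mxE.
congr (P _); apply/seteqP; split => w' /=; rewrite sE; last by split.
by move=> [].
Qed.

(** Rows are added one at a time: by [gram_col_mx_unit] singularity appears only when the residual
    of the new row vanishes. *)
Lemma gram_unit_ae k N (Z : 'I_k * 'I_N -> T -> R) : (k <= N)%N -> std_gauss P Z ->
  P [set w | gram (mxfam (Z ^~ w)) \notin unitmx] = 0%E.
Proof.
elim: k Z => [|k IH] Z kN gZ.
  rewrite (_ : [set _ | _] = set0) ?measure0//; apply/seteqP; split => // w /=.
  by rewrite unitmxE det_mx00 unitr1.
have gL := std_gauss_inj (@lows_inj k N) gZ.
have mL := mxmeas_mxfam (std_gauss_vec gL).
have mTop := mxmeas_cvfam (std_gauss_vec (std_gauss_inj (@top_inj k N) gZ)).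
pose G w := mxfam (fun i => Z (lows i) w).
pose g w := cvfam (fun j => Z (top k j) w).
have mZ := mxmeas_mxfam (std_gauss_vec gZ).
pose A := [set w | gram (G w) \notin unitmx].
pose B := [set w | gram (G w) \in unitmx /\ [set 0] (sqnorm (resid (G w) (g w)))].
have mA : measurable A.
  by apply: measurable_bool_set; apply: measurable_neg; apply: measurable_unitmx; exact: mxmeas_gram.
have mB : measurable B.
  apply: measurableI.
    by apply: measurable_bool_set; apply: measurable_unitmx; exact: mxmeas_gram.
  rewrite -[X in measurable X]setTI; apply: measurable_sqnorm => //; exact: mxmeas_resid.
apply/eqP; rewrite eq_le measure_ge0 andbT.
apply: (@le_trans _ _ (P (A `|` B))).
  apply: le_measure; rewrite ?inE.
  - apply: measurable_bool_set; apply: measurable_neg; apply: measurable_unitmx.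
    exact: mxmeas_gram.
  - exact: measurableU.
  - move=> w /=; rewrite mxfam_col_mx gram_col_mx_unit negb_and negbK /A /B/=.
    by case/orP => [|/eqP]; [left | have [|] := boolP (gram (G w) \in unitmx); [right|left]].
apply: le_trans (measureU2 _ _ _) _ => //.
rewrite [X in (X + _)%E]IH//; last exact: ltnW.
rewrite add0e.
(* At least one degree of freedom is left, so a zero residual forces one normal coordinate to be
   zero, a null event. *)
have [r NE] : exists r, N = (k + r.+1)%N by exists (N - k.+1)%N; rewrite addnS -addSn subnKC.
subst N.
have gTop := std_gauss_inj (@rshift_inj k r.+1) (std_gauss_inj (@top_inj k _) gZ).
apply: le_trans (resid_law (measurable_set1 0) gZ gTop) _.
rewrite -(std_gauss_point ord0 gTop); apply: le_measure; rewrite ?inE.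
- apply: (@measurable_preim _ _ _ (fun w => \sum_i Z (top k (rshift k i)) w ^+ 2)) => //.
  by apply: measurable_sum => i; apply: measurable_funX; exact: gTop.1.
- by apply: (measurable_preim (A := [set 0])) => //; exact: gZ.1.
- move=> w /= /eqP; rewrite psumr_eq0 => [/allP/(_ ord0)|i _]; last exact: sqr_ge0.
  by rewrite mem_index_enum sqrf_eq0 => /(_ isT)/eqP.
Qed.

Definition kron m n (A : 'M[R]_m) (B : 'M[R]_n) (x y : 'I_m * 'I_n) : R :=
  A x.1 y.1 * B x.2 y.2.

Lemma std_gauss_kron m n (A : 'M[R]_m) (B : 'M[R]_n) (Z : 'I_m * 'I_n -> T -> R) :
  orthomx A -> orthomx B -> std_gauss P Z -> std_gauss P (mulfam (kron A B) Z).
Proof.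
move=> hA hB; apply: std_gauss_orth => -[i a] [j b].
have hAij : \sum_k A i k * A j k = (i == j)%:R.
  by have /matrixP/(_ i j) := hA; rewrite !mxE => <-; apply: eq_bigr => k _; rewrite mxE.
have hBij : \sum_k B a k * B b k = (a == b)%:R.
  by have /matrixP/(_ a b) := hB; rewrite !mxE => <-; apply: eq_bigr => k _; rewrite mxE.
rewrite xpair_eqE -mulnb natrM -hAij -hBij big_distrlr/= pair_bigA/=.
by apply: eq_bigr => -[k l] _; rewrite /kron/= mulrACA.
Qed.

Lemma mxfam_kron m n (A : 'M[R]_m) (B : 'M[R]_n) (Z : 'I_m * 'I_n -> T -> R) w :
  mxfam (mulfam (kron A B) Z ^~ w) = A *m mxfam (Z ^~ w) *m B^T.
Proof.
apply/matrixP => i j; rewrite !mxE /mulfam.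
under [RHS]eq_bigr do rewrite !mxE mulr_suml.
rewrite exchange_big/= pair_bigA/=; apply: eq_bigr => -[k l] _.
by rewrite /kron/= !mxE mulrAC.
Qed.

Lemma invmx_orth_conj n (H M : 'M[R]_n) : orthomx H -> M \in unitmx ->
  invmx (H *m M *m H^T) = H *m invmx M *m H^T.
Proof.
move=> hH Mu; have Hu : H \in unitmx by case: (mulmx1_unit hH).
have Xu : H *m M *m H^T \in unitmx by rewrite !unitmx_mul Hu Mu unitmx_tr.
suff E : (H *m M *m H^T) *m (H *m invmx M *m H^T) = 1%:M.
  by rewrite -[RHS](mulKmx Xu) E mulmx1.
by rewrite -!mulmxA (mulmxA H^T) orthomx_tr// mul1mx mulKVmx.
Qed.

Lemma gram_mull m n (A : 'M[R]_m) (G : 'M[R]_(m, n)) : gram (A *m G) = A *m gram G *m A^T.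
Proof. by rewrite /gram trmx_mul !mulmxA. Qed.

(** The regression coefficients are traded for the leading coordinates z of the first row and a
    single entry of the inverse Gram matrix of the others, by one rotation on each side. *)
Lemma regr_law k N (kN : (k.+1 <= N)%N) (Z : 'I_k.+2 * 'I_N -> T -> R) (A : set R) :
    measurable A -> std_gauss P Z ->
  let G w := mxfam (fun i => Z (lows i) w) in
  P [set w | gram (G w) \in unitmx /\
             A (sqnorm (regr (G w) (cvfam (fun j => Z (top k.+1 j) w))))] =
  P [set w | gram (G w) \in unitmx /\
     A (sqnorm (cvfam (fun i : 'I_k.+1 => Z (top k.+1 (widen_ord kN i)) w))
        * invmx (gram (G w)) 0 0)].
Proof.
have [r NE] : exists r, N = (k.+1 + r)%N by exists (N - k.+1)%N; rewrite subnKC.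
subst N; move=> mA gZ G.
have -> : widen_ord kN = lshift r by apply/funext => i; exact: val_inj.
pose VG := @vecT R ('I_k.+1 * 'I_(k.+1 + r)); pose Vg := @vecT R 'I_(k.+1 + r).
have m1 := mxmeas_mxfam (@measurable_fst_vec ('I_k.+1 * 'I_(k.+1 + r)) 'I_(k.+1 + r)).
have m2 := mxmeas_cvfam (@measurable_snd_vec ('I_k.+1 * 'I_(k.+1 + r)) 'I_(k.+1 + r)).
have m3 : mxmeas (fun z : VG * Vg => cvfam (fun i => z.2 (lshift r i))).
  apply: (@mxmeas_cvfam _ _ _ (fun z : VG * Vg => ((fun i => z.2 (lshift r i)) : vecT 'I_k.+1))).
  apply: measurable_vec => i.
  exact: (measurableT_comp (@measurable_coord R _ (lshift r i)) (@measurable_snd_vec _ _)).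
have mU : measurable [set z : VG * Vg | gram (mxfam z.1) \in unitmx].
  by apply: measurable_bool_set; apply: measurable_unitmx; exact: mxmeas_gram.
pose q (M : 'M[R]_k.+1) (z : 'cV[R]_k.+1) := (z^T *m invmx M *m z) 0 0.
pose C1 : set (VG * Vg) :=
  [set z | gram (mxfam z.1) \in unitmx /\ A (sqnorm (regr (mxfam z.1) (cvfam z.2)))].
pose C2 : set (VG * Vg) :=
  [set z | gram (mxfam z.1) \in unitmx /\
           A (q (gram (mxfam z.1)) (cvfam (fun i => z.2 (lshift r i))))].
pose C3 : set (VG * Vg) :=
  [set z | gram (mxfam z.1) \in unitmx /\
           A (sqnorm (cvfam (fun i => z.2 (lshift r i))) * invmx (gram (mxfam z.1)) 0 0)].
have mC1 : measurable C1.
  by apply: measurableI => //; apply: measurable_preim mA; apply: measurable_sqnorm;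
    exact: mxmeas_regr.
have mC2 : measurable C2.
  apply: measurableI => //; apply: measurable_preim mA.
  have := mxmeas_mul (mxmeas_mul (mxmeas_tr m3) (mxmeas_inv (mxmeas_gram m1))) m3.
  exact.
have mC3 : measurable C3.
  apply: measurableI => //; apply: measurable_preim mA; apply: measurable_funM.
    exact: measurable_sqnorm.
  exact: (mxmeas_inv (mxmeas_gram m1)).
rewrite [LHS](rows_fubini gZ mC1).1.
(* The lower rows are frozen: [U] from [polar_regr] depends on them only, and rotating the top row
   by it does not change its law. *)
transitivity (\int[P]_w P [set w' | C2 (fun i => Z (lows i) w, fun j => Z (top k.+1 j) w')])%E.
  apply: eq_integral => w _; rewrite /C1 /C2/=; set M := mxfam _.
  have [W|W] := boolP (gram M \in unitmx); last first.
    by congr (P _); apply/seteqP; split => w' /= -[].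
  have [U hU regE] := polar_regr W.
  have gU := std_gauss_orthomx hU (std_gauss_inj (@top_inj k.+1 _) gZ).
  have gU' := std_gauss_inj (@lshift_inj k.+1 r) gU.
  have gT' := std_gauss_inj (@lshift_inj k.+1 r) (std_gauss_inj (@top_inj k.+1 _) gZ).
  pose D : set (@vecT R 'I_k.+1) := [set x | A (q (gram M) (cvfam x))].
  have mD : measurable D.
    apply: measurable_preim mA.
    have mid : mxmeas (fun x : @vecT R 'I_k.+1 => cvfam x).
      by apply: mxmeas_cvfam; exact: measurable_id.
    exact: (mxmeas_mul (mxmeas_mul (mxmeas_tr mid) (mxmeas_cst (invmx (gram M)))) mid).
  have := std_gauss_law gU' gT' mD.
  have sE w' : sqnorm (regr M (cvfam (fun j => Z (top k.+1 j) w'))) =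
      q (gram M) (cvfam (fun i => mulfam U (fun j => Z (top k.+1 j)) (lshift r i) w')).
    rewrite (regE _).2 -(cvfam_mulfam U (fun j => Z (top k.+1 j)) w') /q.
    suff -> : usubmx (cvfam (mulfam U (fun j => Z (top k.+1 j)) ^~ w')) =
      cvfam (fun i => mulfam U (fun j => Z (top k.+1 j)) (lshift r i) w') by [].
    by apply/colP => i; rewrite !mxE.
  move=> E; transitivity (P [set w' | D (fun i => mulfam U (fun j => Z (top k.+1 j)) (lshift r i) w')]).
    by congr (P _); apply/seteqP; split => w' /=; rewrite sE; [case|split].
  by rewrite E; congr (P _); apply/seteqP; split => w' /=; [split|case].
rewrite -(rows_fubini gZ mC2).1 (rows_fubini gZ mC2).2.
transitivity (\int[P]_w' P [set w | C3 (fun i => Z (lows i) w, fun j => Z (top k.+1 j) w')])%E; last first.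
  by rewrite -(rows_fubini gZ mC3).2.
apply: eq_integral => w' _; set z := fun j => Z (top k.+1 j) w'.
pose zc := cvfam (fun i => z (lshift r i)).
(* Now the top row is frozen. [H] carries z to the first axis, and acting by [H] on the rows of [G]
   preserves their law while conjugating the Gram matrix. *)
have [H hH Hz] : exists2 H : 'M[R]_k.+1, orthomx H & H *m zc = Num.sqrt (sqnorm zc) *: delta_mx 0 0.
  by apply: reflection_to_axis; rewrite sqr_sqrtr ?sqnorm_ge0.
have gL := std_gauss_inj (@lows_inj k.+1 (k.+1 + r)) gZ.
have gH := std_gauss_kron hH (orthomx1 _) gL.
pose D : set VG := [set x | C3 (x, z)].
have mD : measurable D.
  have mx1 : mxmeas (fun x : VG => mxfam x) by apply: mxmeas_mxfam; exact: measurable_id.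
  apply: measurableI.
    by apply: measurable_bool_set; apply: measurable_unitmx; exact: mxmeas_gram.
  apply: measurable_preim mA; apply: measurable_funM.
    exact: (measurable_cst (sqnorm zc)).
  exact: (mxmeas_inv (mxmeas_gram mx1)).
rewrite -[RHS](std_gauss_law gH gL mD); congr (P _); apply/seteqP.
have HE w : gram (mxfam (mulfam (kron H 1%:M) (fun i => Z (lows i)) ^~ w)) =
    H *m gram (mxfam (fun i => Z (lows i) w)) *m H^T.
  by rewrite mxfam_kron trmx1 mulmx1 gram_mull.
have Hu : H \in unitmx by case: (mulmx1_unit hH).
have qE M : M \in unitmx -> q M zc = sqnorm zc * invmx (H *m M *m H^T) 0 0.
  by move=> Mu; rewrite /q (sqnorm_row _ hH Hz) invmx_orth_conj.
split => w; rewrite /D /C2 /C3/= HE.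
  move=> [Mu]; rewrite qE// => ?; split => //.
  by rewrite !unitmx_mul Hu Mu unitmx_tr.
rewrite !unitmx_mul unitmx_tr Hu/= andbT => -[Mu].
by rewrite -qE.
Qed.

Lemma resid_concentration k r N (Z : 'I_k.+1 * 'I_N -> T -> R) (eps : R) :
    N = (k + r)%N -> 0 < eps -> eps < 1 -> std_gauss P Z ->
  (P [set w | let G := mxfam (fun i => Z (lows i) w) in gram G \in unitmx /\
       (eps * r%:R <= `|sqnorm (resid G (cvfam (fun j => Z (top k j) w))) - r%:R|)%R] <=
   (expR (- eps ^+ 2 / 12) ^+ r *+ 2)%:E)%E.
Proof.
move=> NE; subst N => eps0 eps1 gZ.
have mA : measurable [set t : R | eps * r%:R <= `|t - r%:R|].
  apply: measurable_bool_set; apply: measurable_fun_ler => //.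
  by apply: measurableT_comp => //; exact: measurable_funB.
have gr := std_gauss_inj (@rshift_inj k r) (std_gauss_inj (@top_inj _ _) gZ).
by apply: le_trans (resid_law mA gZ gr) _; exact: chi_square_concentration.
Qed.

(** As b > 1/2 and |a - b| <= 2 eta, the quotient a / b is within 4 eta of 1, and [q] is at most c +
    eps / 2. *)
Lemma ratio_dist (q a b c eps eta : R) : 0 < eta -> eta < 2^-1 -> 0 <= q -> 0 < eps ->
    `|q - c| <= eps / 2 -> 4 * eta * (c + eps / 2) <= eps / 2 ->
    `|a - 1| < eta -> `|b - 1| < eta ->
  `|q * (a / b) - c| <= eps.
Proof.
move=> eta0 eta1 q0 eps0; rewrite ler_norml => /andP[q1 q2] etac.
rewrite !ltr_norml => /andP[a1 a2] /andP[b1 b2].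
have b0 : 0 < b by lra.
have qab : q * (a / b) - q = q * (a - b) / b by field; rewrite gt_eqF.
have : `|q * (a / b) - q| <= eps / 2.
  apply: le_trans etac; rewrite qab !normrM normfV (ger0_norm q0) (gtr0_norm b0).
  have ab : `|a - b| <= 2 * eta by rewrite ler_norml; apply/andP; split; lra.
  have qce : q <= c + eps / 2 by lra.
  rewrite ler_pdivrMr//; apply: le_trans (ler_pM q0 (normr_ge0 _) qce ab) _.
  have ce0 : 0 <= eta * (c + eps / 2) by rewrite mulr_ge0//; lra.
  nra.
by rewrite !ler_norml => /andP[h1 h2]; apply/andP; split; lra.
Qed.

(** After [regr_law] the numerator is a chi-square with k + 1 degrees of freedom, and the inverse
    entry is 1 / |resid|^2 for the second row regressed on the remaining [k] rows, which leaves N -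
    k. A union bound over the two deviations concludes. *)
Lemma regr_concentration k N (Z : 'I_k.+2 * 'I_N -> T -> R) (c eps eta : R) :
    (k.+1 <= N)%N -> 0 < eta -> eta < 2^-1 -> 0 < eps ->
    `|k.+1%:R / (N - k)%:R - c| <= eps / 2 -> 4 * eta * (c + eps / 2) <= eps / 2 ->
    std_gauss P Z ->
  (P [set w | let G := mxfam (fun i => Z (lows i) w) in gram G \in unitmx /\
       (eps < `|sqnorm (regr G (cvfam (fun j => Z (top k.+1 j) w))) - c|)%R] <=
   (expR (- eta ^+ 2 / 12) ^+ k.+1 *+ 2 + expR (- eta ^+ 2 / 12) ^+ (N - k) *+ 2)%:E)%E.
Proof.
move=> kN eta0 eta1 eps0 qc etac gZ.
pose A := [set t : R | eps < `|t - c|].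
have mA : measurable A.
  apply: measurable_bool_set; apply: measurable_fun_ltr => //.
  by apply: measurableT_comp => //; exact: measurable_funB.
rewrite [leLHS](regr_law kN mA gZ).
pose z i w := Z (top k.+1 (widen_ord kN i)) w.
have gz : std_gauss P z.
  have inj : injective (fun i => top k.+1 (widen_ord kN i)).
    by move=> i j /top_inj /(congr1 val) /= ij; exact: val_inj.
  exact: (std_gauss_inj inj gZ).
pose W i w := Z (lows i) w.
have gW : std_gauss P W := std_gauss_inj (@lows_inj _ _) gZ.
pose G w := mxfam (W ^~ w).
pose G3 w := mxfam (fun i => W (lows i) w).
pose g3 w := cvfam (fun j => W (top k j) w).
pose s w := sqnorm (resid (G3 w) (g3 w)).
pose S w := \sum_i z i w ^+ 2.
pose B1 := [set w | eta * k.+1%:R <= `|S w - k.+1%:R|].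
pose A2 := [set t : R | eta * (N - k)%:R <= `|t - (N - k)%:R|].
pose B2 := [set w | gram (G3 w) \in unitmx /\ A2 (s w)].
have mG : mxmeas G by exact: (mxmeas_mxfam (std_gauss_vec gW)).
have mG3 : mxmeas G3 by exact: (mxmeas_mxfam (std_gauss_vec (std_gauss_inj (@lows_inj _ _) gW))).
have mg3 : mxmeas g3 by exact: (mxmeas_cvfam (std_gauss_vec (std_gauss_inj (@top_inj _ _) gW))).
have mS : measurable_fun setT S.
  by apply: measurable_sum => i; apply: measurable_funX; exact: gz.1.
have ms : measurable_fun setT s by apply: measurable_sqnorm; exact: mxmeas_resid.
have mB1 : measurable B1.
  apply: measurable_bool_set; apply: measurable_fun_ler => //.
  by apply: measurableT_comp => //; exact: measurable_funB.
have mA2 : measurable A2.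
  apply: measurable_bool_set; apply: measurable_fun_ler => //.
  by apply: measurableT_comp => //; exact: measurable_funB.
have mB2 : measurable B2.
  apply: measurableI; last exact: measurable_preim.
  by apply: measurable_bool_set; apply: measurable_unitmx; exact: mxmeas_gram.
have SE w : sqnorm (cvfam (fun i => z i w)) = S w.
  by apply: eq_bigr => i _; rewrite mxE.
apply: (@le_trans _ _ (P (B1 `|` B2))).
  apply: le_measure; rewrite ?inE.
  - apply: measurableI.
      by apply: measurable_bool_set; apply: measurable_unitmx; exact: mxmeas_gram.
    apply: measurable_preim mA; apply: measurable_funM.
      by apply: measurable_sqnorm; exact: (mxmeas_cvfam (std_gauss_vec gz)).
    exact: (mxmeas_inv (mxmeas_gram mG)).
  - exact: measurableU.
  - move=> w [Wu]; have := Wu; rewrite mxfam_col_mx => Wu'.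
    have [iW _] := invmx_gram_col_mx Wu'.
    have := Wu'; rewrite gram_col_mx_unit => /andP[W3 s0].
    rewrite iW /A [cvfam _](_ : _ = cvfam (fun i => z i w))// SE -/(s w) /= => far.
    have [h1|h1] := leP (eta * k.+1%:R) `|S w - k.+1%:R|; first by left.
    have [h2|h2] := leP (eta * (N - k)%:R) `|s w - (N - k)%:R|; first by right.
    exfalso; move: far; apply/negP; rewrite -leNgt.
    have N0 : (0 < (N - k)%:R :> R) by rewrite ltr0n subn_gt0.
    have k0 : (0 < k.+1%:R :> R) by [].
    have sN : (s w) != 0 by [].
    (* Normalising by the degrees of freedom leaves two factors within [eta] of 1. *)
    have -> : S w * (s w)^-1 = k.+1%:R / (N - k)%:R * (S w / k.+1%:R / (s w / (N - k)%:R)).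
      have gen (a b x y : R) : 0 < a -> 0 < b -> y != 0 ->
          x * y^-1 = a / b * (x / a / (y / b)).
        by move=> a0 b0 y0; field; rewrite y0 (gt_eqF a0) (gt_eqF b0).
      exact: gen.
    have dist1 (a x : R) : 0 < a -> `|x - a| < eta * a -> `|x / a - 1| < eta.
      move=> a0 xa; rewrite -(ltr_pM2r a0); apply: le_lt_trans xa.
      by rewrite -[X in _ * X](gtr0_norm a0) -normrM mulrBl mul1r divfK// gt_eqF.
    apply: (ratio_dist eta0 eta1 _ eps0 qc etac (dist1 _ _ k0 h1) (dist1 _ _ N0 h2)).
    by rewrite divr_ge0// ltW.
apply: le_trans (measureU2 _ _ _) _ => //.
rewrite EFinD; apply: leeD.
  by apply: chi_square_concentration => //; lra.
have NE : N = (k + (N - k))%N by rewrite subnKC// ltnW.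
by apply: (resid_concentration NE) => //; lra.
Qed.

End gauss_matrix.

(** * Whitening the samples *)

Section scatter.
Context {R : realType}.

Lemma sample_mean_affine p n (B : 'M[R]_p) (mu : 'cV[R]_p) (x : 'I_n.+1 -> 'cV[R]_p) :
  sample_mean (fun j => B *m (x j - mu)) = B *m (sample_mean x - mu).
Proof.
rewrite /sample_mean -mulmx_sumr scalemxAr sumrB scalerBr; congr (_ *m (_ - _)).
by rewrite sumr_const card_ord -[mu *+ _]scaler_nat scalerA mulVf ?scale1r// pnatr_eq0.
Qed.

Lemma scatter_affine p n (B : 'M[R]_p) (mu : 'cV[R]_p) (x : 'I_n.+1 -> 'cV[R]_p) :
  scatter (fun j => B *m (x j - mu)) = B *m scatter x *m B^T.
Proof.
rewrite /scatter mulmx_sumr mulmx_suml; apply: eq_bigr => j _.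
rewrite sample_mean_affine -mulmxBr opprB addrA subrK.
by rewrite trmx_mul !mulmxA.
Qed.

Lemma sum_centered n (u v : 'I_n.+1 -> R) :
  \sum_j (u j - n.+1%:R^-1 * \sum_i u i) * (v j - n.+1%:R^-1 * \sum_i v i) =
  \sum_j u j * v j - n.+1%:R^-1 * ((\sum_i u i) * (\sum_i v i)).
Proof.
set su := \sum_i u i; set sv := \sum_i v i; set c := n.+1%:R^-1.
have cn : n.+1%:R * c = 1 by rewrite divff// pnatr_eq0.
transitivity (\sum_j (u j * v j - u j * (c * sv) - c * su * v j + c * su * (c * sv))).
  by apply: eq_bigr => j _; ring.
rewrite !big_split/= !sumrN -mulr_suml -mulr_sumr sumr_const card_ord -/su -/sv.
rewrite -[_ *+ n.+1]mulr_natl (_ : n.+1%:R * (c * su * (c * sv)) = n.+1%:R * c * (c * (su * sv))); last by ring.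
by rewrite cn; ring.
Qed.

(* An orthogonal change of the observations that carries the sample mean to
   the first coordinate turns the scatter into a Gram matrix. *)
Lemma scatter_gram p n (H : 'M[R]_n.+1) (y : 'I_n.+1 -> 'cV[R]_p) :
    orthomx H -> H *m (const_mx 1 : 'cV[R]_n.+1) = Num.sqrt n.+1%:R *: delta_mx 0 0 ->
  scatter y = gram (col' ord0 ((\matrix_(i, j) y j i 0) *m H^T)).
Proof.
move=> hH H1; set Y := \matrix_(i, j) _; set Y' := Y *m H^T.
(* The coordinate sums sit in column 0 of [Y'], so subtracting the mean amounts to deleting that
   column. *)
have Y1 a : \sum_j y j a 0 = Num.sqrt n.+1%:R * Y' a ord0.
  have : Y *m (const_mx 1 : 'cV[R]_n.+1) = Num.sqrt n.+1%:R *: (Y' *m delta_mx 0 0 : 'cV[R]_p).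
    by rewrite scalemxAr -H1 /Y' -mulmxA (mulmxA H^T) orthomx_tr// mul1mx.
  move/colP/(_ a); rewrite -colE !mxE => <-.
  by apply: eq_bigr => j _; rewrite !mxE mulr1.
have YY : Y' *m Y'^T = Y *m Y^T.
  by rewrite trmx_mul trmxK mulmxA -(mulmxA Y) orthomx_tr// mulmx1.
apply/matrixP => a b; rewrite /scatter summxE.
under eq_bigr => j _ do rewrite mxE big_ord1 !mxE !summxE.
rewrite sum_centered !Y1.
rewrite (_ : _^-1 * _ = Y' a ord0 * Y' b ord0); last first.
  rewrite mulrACA -expr2 sqr_sqrtr ?ler0n// mulKf// pnatr_eq0//.
have -> : \sum_j y j a 0 * y j b 0 = (Y *m Y^T) a b.
  by rewrite mxE; apply: eq_bigr => j _; rewrite !mxE.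
rewrite -YY [in LHS]mxE big_ord_recl [Y'^T _ _]mxE addrAC subrr add0r.
by rewrite mxE; apply: eq_bigr => j _; rewrite !mxE.
Qed.

Lemma const_mx_reflection n : exists2 H : 'M[R]_n.+1,
  orthomx H & H *m (const_mx 1 : 'cV[R]_n.+1) = Num.sqrt n.+1%:R *: delta_mx 0 0.
Proof.
apply: reflection_to_axis; rewrite sqr_sqrtr// /sqnorm.
by under eq_bigr do rewrite mxE expr1n; rewrite sumr_const card_ord.
Qed.

End scatter.

Section normal_samples.
Context {R : realType} d (T : measurableType d) (P : probability T R).

Lemma measurable_coord_sigma_vec p (X : T -> 'cV[R]_p) i :
  measurable_fun setT (fun w : g_sigma_algebraType (\bigcup_(i in [set: 'I_p])
        g_sigma_algebra_preimage (fun w => X w i 0)) => X w i 0).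
Proof.
move=> _ B mB; rewrite setTI; apply: sub_sigma_algebra; exists i => //.
by exists B => //; rewrite setTI.
Qed.

Lemma std_gauss_of_independent n (Z : 'I_n -> {RV P >-> R}) :
    (forall i (B : set R), measurable B -> distribution P (Z i) B = normal_prob 0 1 B) ->
    mutually_independent P (fun i => g_sigma_algebra_preimage (Z i)) ->
  std_gauss P (fun i w => Z i w).
Proof.
move=> dZ iZ; split => [i|B mB]; first exact: measurable_funP.
have := iZ [set: 'I_n]%SET (fun i => Z i @^-1` B i).
move=> /(_ (fun i _ => ex_intro2 _ _ (B i) (mB i) (setTI _))) E.
transitivity (P (\bigcap_(i in [set` [set: 'I_n]%SET]) Z i @^-1` B i)).
  by congr (P _); apply/seteqP; split => w /= h i; [move=> _|]; apply: h; rewrite /= inE.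
rewrite E; apply: eq_big => [i|i _]; first by rewrite inE.
exact: dZ.
Qed.

(** If X = mu + A Z, then B (X - mu) = (B A) Z, and B A is orthogonal because B Sigma B^T = 1. *)
Lemma mvn_whiten p (mu : 'cV[R]_p) (Sigma B : 'M[R]_p) (X : T -> 'cV[R]_p) :
    multivariate_normal P mu Sigma X -> B *m Sigma *m B^T = 1%:M ->
  std_gauss P (fun i w => (B *m (X w - mu)) i 0).
Proof.
move=> [A [Z [AA dZ iZ XE]]] BS.
have hBA : orthomx (B *m A) by rewrite /orthomx trmx_mul mulmxA -(mulmxA B) AA.
have := std_gauss_orthomx hBA (std_gauss_of_independent dZ iZ); congr (std_gauss P).
apply/funext => i; apply/funext => w.
rewrite XE addrAC subrr add0r mulmxA mxE /mulfam.
by apply: eq_bigr => j _; rewrite !mxE.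
Qed.

Lemma samples_whiten p (K : finType) (mu : K -> 'cV[R]_p) (Sigma B : 'M[R]_p)
    (X : K -> T -> 'cV[R]_p) :
    (forall k, multivariate_normal P (mu k) Sigma (X k)) -> B *m Sigma *m B^T = 1%:M ->
    mutually_independent P (fun k => sigma_vec (X k)) ->
  std_gauss P (fun (ik : 'I_p * K) w => (B *m (X ik.2 w - mu ik.2)) ik.1 0).
Proof.
move=> nX BS iX.
have gX k := mvn_whiten (nX k) BS.
split => [[i k]|D mD]; first exact: (gX k).1.
pose E k := [set w | forall i, D (i, k) ((B *m (X k w - mu k)) i 0)].
(* The box event of observation [k] lies in its own sigma-algebra; independence then factors over
   observations and [gX] over coordinates. *)
have EX k : sigma_vec (X k) (E k).
  pose TX := g_sigma_algebraType (\bigcup_(i in [set: 'I_p])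
        g_sigma_algebra_preimage (fun w => X k w i 0)).
  have mX : @mxmeas R _ TX _ _ (X k).
    by move=> i j; rewrite ord1; exact: measurable_coord_sigma_vec.
  have mBX : @mxmeas R _ TX _ _ (fun w => B *m (X k w - mu k)).
    by apply: mxmeas_mul; [exact: mxmeas_cst | apply: mxmeas_sub => //; exact: mxmeas_cst].
  suff : measurable (E k : set TX) by [].
  have mV : measurable_fun setT (fun w : TX => ((fun i => (B *m (X k w - mu k)) i 0) : vecT 'I_p)).
    by apply: measurable_vec => i; exact: mBX.
  rewrite -[X in measurable X]setTI.
  have := mV measurableT [set x : vecT 'I_p | forall i, D (i, k) (x i)]; apply.
  by apply: sub_sigma_algebra; exists (fun i => D (i, k)).
transitivity (P (\bigcap_(k in [set` [set: K]%SET]) E k)).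
  congr (P _); apply/seteqP; split => w /= h; first by move=> k _ i; exact: (h (i, k)).
  by move=> [i k]; apply: (h k); rewrite /= inE.
rewrite (iX [set: K]%SET E (fun k _ => EX k)).
transitivity (\prod_k \prod_i normal_prob 0 1 (D (i, k)))%E.
  apply: eq_big => [k|k _]; first by rewrite inE.
  by rewrite -(proj2 (gX k)).
by rewrite exchange_big pair_bigA/=; apply: eq_bigr => -[].
Qed.

End normal_samples.

Section one_sample_size.
Context {R : realType} d (T : measurableType d) (P : probability T R).
Variables (k n1 n2 : nat).
Local Notation p := k.+2.
Variables (mu1 mu2 : 'cV[R]_p) (Sigma : 'M[R]_p).
Variables (X1 : 'I_n1.+1 -> T -> 'cV[R]_p) (X2 : 'I_n2.+1 -> T -> 'cV[R]_p).
Variable (Delta : R).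
Hypothesis hmu : mu1 <> mu2.
Hypothesis Su : Sigma \in unitmx.
Hypothesis hDelta : Num.sqrt (bilin (mu1 - mu2) (invmx Sigma) (mu1 - mu2)) = Delta.
Hypothesis hX1 : forall j, multivariate_normal P mu1 Sigma (X1 j).
Hypothesis hX2 : forall j, multivariate_normal P mu2 Sigma (X2 j).
Hypothesis hX : mutually_independent P (fun i => sigma_vec (pool X1 X2 i)).

(** B = H A^-1, where [A] is the factor of [Sigma] supplied by the normality of the first
    observation and [H] rotates A^-1 (mu1 - mu2) to the first axis. Positivity of [Delta] comes from
    [mu1 <> mu2]. *)
Lemma whitening : exists2 B : 'M[R]_p, B *m Sigma *m B^T = 1%:M &
  0 < Delta /\ B *m (mu1 - mu2) = Delta *: delta_mx 0 0.
Proof.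
have [A [_ [AA _ _ _]]] := hX1 ord0.
have Au : A \in unitmx by move: Su; rewrite -AA unitmx_mul unitmx_tr andbb.
have hD := hDelta; set dl := mu1 - mu2 in hD *.
have dl0 : dl != 0 by rewrite subr_eq0; apply/eqP.
pose v := invmx A *m dl.
have v2 : sqnorm v = bilin dl (invmx Sigma) dl.
  rewrite sqnorm_dot /bilin /v -AA trmx_mul; congr (fun_of_matrix _ _ _).
  have -> : invmx (A *m A^T) = (invmx A)^T *m invmx A.
    have AAu : A *m A^T \in unitmx by rewrite AA.
    rewrite -[RHS](mulKmx AAu) -!mulmxA (mulmxA A^T) trmx_inv mulmxV ?unitmx_tr//.
    by rewrite mul1mx mulmxV// mulmx1.
  by rewrite !mulmxA.
have v0 : 0 < sqnorm v.
  rewrite lt0r sqnorm_ge0 sqnorm_eq0 andbT; apply: contra dl0 => /eqP v0.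
  by rewrite -[dl](mulKVmx Au) -/v v0 mulmx0.
have D0 : 0 < Delta by rewrite -hD sqrtr_gt0 -v2.
have D2 : Delta ^+ 2 = sqnorm v by rewrite -hD -v2 sqr_sqrtr// ltW.
have [H hH Hv] : exists2 H : 'M[R]_p, orthomx H & H *m v = Delta *: delta_mx 0 0.
  by apply: reflection_to_axis; rewrite D2.
exists (H *m invmx A); last by split => //; rewrite -mulmxA.
rewrite -AA trmx_mul -!mulmxA mulKmx// (mulmxA A^T) trmx_inv mulmxV ?unitmx_tr//.
by rewrite mul1mx.
Qed.

Lemma scatter_std_gauss (B : 'M[R]_p) : B *m Sigma *m B^T = 1%:M ->
  exists2 Z : 'I_p * 'I_(n1 + n2) -> T -> R, std_gauss P Z &
    forall w, B *m (scatter (X1 ^~ w) + scatter (X2 ^~ w)) *m B^T =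
              gram (mxfam (Z ^~ w)).
Proof.
move=> BS.
pose mu (k : 'I_n1.+1 + 'I_n2.+1) := if k is inl _ then mu1 else mu2.
have nX j : multivariate_normal P (mu j) Sigma (pool X1 X2 j).
  by case: j => j; [exact: hX1 | exact: hX2].
have gU := samples_whiten nX BS hX; set U := fun ik w => _ in gU.
have [H1 hH1 H1E] := @const_mx_reflection R n1.
have [H2 hH2 H2E] := @const_mx_reflection R n2.
(* One reflection per sample, assembled into a block-diagonal matrix on the observation indices; [M]
   lets it act on every coordinate. *)
pose V (a b : 'I_n1.+1 + 'I_n2.+1) : R := match a, b with
  | inl a, inl b => H1 a b | inr a, inr b => H2 a b | _, _ => 0 end.
have rowsE n (H : 'M[R]_n) a b : orthomx H -> \sum_i H a i * H b i = (a == b)%:R.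
  by move=> /matrixP/(_ a b); rewrite !mxE => <-; apply: eq_bigr => i _; rewrite mxE.
have hV a b : \sum_c V a c * V b c = (a == b)%:R.
  rewrite big_sumType/=; case: a b => a [] b /=.
  - by rewrite rowsE// [X in _ + X]big1 ?addr0// => i _; rewrite mul0r.
  - by rewrite !big1 ?addr0// => i _; rewrite ?mul0r ?mulr0.
  - by rewrite !big1 ?addr0// => i _; rewrite ?mul0r ?mulr0.
  - by rewrite rowsE// big1 ?add0r// => i _; rewrite mul0r.
pose M (x y : 'I_p * ('I_n1.+1 + 'I_n2.+1)) : R := (x.1 == y.1)%:R * V x.2 y.2.
have hM x y : \sum_z M x z * M y z = (x == y)%:R.
  transitivity (\sum_i \sum_c (x.1 == i)%:R * (y.1 == i)%:R * (V x.2 c * V y.2 c)).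
    by rewrite pair_bigA/=; apply: eq_bigr => -[i c] _; rewrite /M/= mulrACA.
  under eq_bigr do rewrite -mulr_sumr hV.
  rewrite -mulr_suml (bigD1 x.1)//= eqxx mul1r big1 ?addr0; last first.
    by move=> i /negPf ix; rewrite eq_sym ix mul0r.
  by case: x y => x1 x2 [y1 y2]; rewrite xpair_eqE/= eq_sym -natrM mulnb.
have gMU := std_gauss_orth hM gU.
(* Skips index 0 of each sample, the direction of its mean; this is where two degrees of freedom are
   lost. *)
pose h (c : 'I_(n1 + n2)) : 'I_n1.+1 + 'I_n2.+1 :=
  match fintype.split c with inl a => inl (lift ord0 a) | inr b => inr (lift ord0 b) end.
have hinj : injective h.
  move=> c c'; rewrite /h => E; apply: (can_inj splitK).
  have inl_inj : injective (@inl 'I_n1.+1 'I_n2.+1) by move=> ? ? [].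
  have inr_inj : injective (@inr 'I_n1.+1 'I_n2.+1) by move=> ? ? [].
  case: (fintype.split c) (fintype.split c') E => a [] b //=.
    by move=> /inl_inj /lift_inj ->.
  by move=> /inr_inj /lift_inj ->.
have hpinj : injective (fun ic : 'I_p * 'I_(n1 + n2) => (ic.1, h ic.2)).
  by move=> [i c] [i' c'] /= [-> /hinj ->].
have gZ := std_gauss_inj hpinj gMU.
exists (fun ic => mulfam M U (ic.1, h ic.2)) => // w.
have MUE i c : mulfam M U (i, c) w = \sum_e V c e * U (i, e) w.
  rewrite /mulfam (eq_bigr (fun z => (i == z.1)%:R * (V c z.2 * U (z.1, z.2) w))); last first.
    by move=> [j e] _; rewrite /M/= mulrA.
  rewrite -(pair_bigA _ (fun j e => (i == j)%:R * (V c e * U (j, e) w)))/=.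
  rewrite (bigD1 i)//= [X in _ + X]big1 ?addr0; last first.
    by move=> j /negPf ji; rewrite big1// => e _; rewrite eq_sym ji mul0r.
  by apply: eq_bigr => e _; rewrite eqxx mul1r.
rewrite mulmxDr mulmxDl -(scatter_affine B mu1) -(scatter_affine B mu2).
rewrite (scatter_gram _ hH1 H1E) (scatter_gram _ hH2 H2E).
have -> : mxfam (fun ic => mulfam M U (ic.1, h ic.2) w) =
    row_mx (col' ord0 ((\matrix_(i, j) (B *m (X1 j w - mu1)) i 0) *m H1^T))
           (col' ord0 ((\matrix_(i, j) (B *m (X2 j w - mu2)) i 0) *m H2^T)).
  apply/matrixP => i c; rewrite mxE/= MUE big_sumType/= /h !mxE.
  case: (fintype.split c) => a /=; rewrite !mxE.
    rewrite [X in _ + X]big1 ?addr0; last by move=> e _; rewrite mul0r.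
    by apply: eq_bigr => e _; rewrite [X in _ = X * _]mxE [X in _ = _ * X]mxE mulrC.
  rewrite big1 ?add0r; last by move=> e _; rewrite mul0r.
  by apply: eq_bigr => e _; rewrite [X in _ = X * _]mxE [X in _ = _ * X]mxE mulrC.
by rewrite /gram tr_row_mx mul_row_col.
Qed.

(** With c = n - 2, s = |resid|^2 and f = |beta|^2, the quadratic form is c Delta^2 / s and the root
    is c Delta sqrt (1 + f) / s, so that c and s cancel in the quotient. *)
Lemma rate_argument : (n1 + n2 != 0)%N ->
  exists2 Z : 'I_p * 'I_(n1 + n2) -> T -> R, std_gauss P Z &
    0 < Delta /\ forall w, gram (mxfam (Z ^~ w)) \in unitmx ->
     let delta := mu1 - mu2 in
     let Sinv := invmx (pooled_cov (X1 ^~ w) (X2 ^~ w)) in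
     - bilin delta Sinv delta /
        (2 * Num.sqrt (bilin delta (Sinv *m Sigma *m Sinv) delta)) =
     - Delta / (2 * Num.sqrt (1 + sqnorm (regr (mxfam (fun i => Z (lows i) w))
                  (cvfam (fun j => Z (top k.+1 j) w))))).
Proof.
move=> n0; have [B BS [D0 BD]] := whitening.
have [Z gZ WE] := scatter_std_gauss BS.
exists Z => //; split => // w Wu; cbv zeta; set dl := mu1 - mu2 in BD *.
set sc := scatter (X1 ^~ w) + scatter (X2 ^~ w) in WE *.
have cE : (n1.+1 + n2.+1)%:R - 2 = (n1 + n2)%:R :> R.
  by rewrite addSn addnS -!natr1; ring.
rewrite /pooled_cov cE -/sc.
set c : R := (n1 + n2)%:R; have c0 : 0 < c by rewrite ltr0n lt0n.
have {}WE := WE w; rewrite -/sc in WE.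
set W := gram _ in Wu WE.
have Bu : B \in unitmx by move: Wu; rewrite -WE !unitmx_mul => /andP[/andP[]].
have scu : sc \in unitmx by move: Wu; rewrite -WE !unitmx_mul => /andP[/andP[]].
have scV : invmx sc = B^T *m invmx W *m B.
  rewrite -[RHS](mulKmx scu); suff -> : sc *m (B^T *m invmx W *m B) = 1%:M by rewrite mulmx1.
  rewrite -[LHS](mulKmx Bu) !mulmxA -(mulmxA (invmx B)) -(mulmxA (invmx B)).
  by rewrite WE -(mulmxA (invmx B) W) mulmxV// mulmx1 mulVmx.
have SV : invmx (c^-1 *: sc) = c *: invmx sc.
  by rewrite invmxZ ?invrK// unitmxZ// unitfE invr_eq0 gt_eqF.
have form1 : bilin dl (invmx (c^-1 *: sc)) dl = c * Delta ^+ 2 * invmx W 0 0.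
  rewrite SV /bilin scV -scalemxAr -scalemxAl mxE -mulrA; congr (_ * _).
  have -> : dl^T *m (B^T *m invmx W *m B) *m dl = (B *m dl)^T *m invmx W *m (B *m dl).
    by rewrite trmx_mul !mulmxA.
  rewrite BD trmxZ -!scalemxAl -scalemxAr scalerA -expr2 mxE; congr (_ * _).
  by rewrite trmx_delta -rowE -colE !mxE.
have form2 : bilin dl (invmx (c^-1 *: sc) *m Sigma *m invmx (c^-1 *: sc)) dl =
    (c * Delta) ^+ 2 * (invmx W *m invmx W) 0 0.
  rewrite SV /bilin scV.
  have -> : c *: (B^T *m invmx W *m B) *m Sigma *m (c *: (B^T *m invmx W *m B)) =
      c ^+ 2 *: (B^T *m (invmx W *m invmx W) *m B).
    rewrite -!scalemxAl -scalemxAr scalerA -expr2; congr (_ *: _).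
    rewrite !mulmxA -(mulmxA _ B) -(mulmxA _ (B *m Sigma)) BS mulmx1.
    by [].
  rewrite -scalemxAr -scalemxAl mxE exprMn -[RHS]mulrA; congr (_ * _).
  set WW := invmx W *m invmx W.
  have -> : dl^T *m (B^T *m WW *m B) *m dl = (B *m dl)^T *m WW *m (B *m dl).
    by rewrite trmx_mul !mulmxA.
  rewrite BD trmxZ -!scalemxAl -scalemxAr scalerA -expr2 mxE; congr (_ * _).
  by rewrite trmx_delta -rowE -colE !mxE.
rewrite form1 form2.
have WE' : W = gram (col_mx (cvfam (fun j => Z (top k.+1 j) w))^T
                            (mxfam (fun i => Z (lows i) w))).
  by rewrite /W mxfam_col_mx.
have Wu' := Wu; rewrite WE' in Wu'.
have [i1 i2] := invmx_gram_col_mx Wu'.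
have := Wu'; rewrite gram_col_mx_unit => /andP[_ s0].
rewrite WE' i1 i2; set s := sqnorm _ in s0 *; set f := sqnorm _.
have {s0} s0 : 0 < s by rewrite lt0r s0 sqnorm_ge0.
have f0 : 0 <= f := sqnorm_ge0 _.
rewrite sqrtrM ?sqr_ge0// sqrtr_sqr gtr0_norm ?mulr_gt0//.
rewrite sqrtrM ?addr_ge0// sqrtrV ?sqr_ge0// sqrtr_sqr gtr0_norm//.
have q0 : 0 < Num.sqrt (1 + f) by rewrite sqrtr_gt0 ltr_pwDl.
clearbody c; field.
by rewrite (gt_eqF s0) (gt_eqF c0) (gt_eqF D0) (gt_eqF q0).
Qed.

End one_sample_size.

(** * Concentration of the rate *)

Section normal_cdf.
Context {R : realType}.

(** The density never exceeds [normal_peak 1], which therefore is a Lipschitz constant of the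
    distribution function. *)
Lemma std_normal_cdf_increment (x z : R) : x <= z ->
  0 <= std_normal_cdf z - std_normal_cdf x <= normal_peak 1 * (z - x).
Proof.
move=> xz; rewrite /std_normal_cdf.
have mI (i : interval R) : measurable ([set` i] : set (measurableTypeR R)).
  exact: measurable_itv.
have E : normal_prob (0 : R) 1 `]-oo, z] =
    (normal_prob (0 : R) 1 `]-oo, x] + normal_prob (0 : R) 1 `]x, z])%E.
  rewrite -measureU//; last first.
    by apply/seteqP; split => // t; rewrite /= !in_itv/= => -[h1 /andP[h2 _]]; lra.
  congr (normal_prob _ _ _); apply/seteqP; split => t /=; rewrite !in_itv/=.
    by move=> tz; have [|] := leP t x; [left | right; apply/andP].
  by case => [tx|/andP[]//]; exact: le_trans xz.
have fin (i : interval R) : normal_prob (0 : R) 1 [set` i] \is a fin_num.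
  exact: (@fin_num_measure _ _ _ (normal_prob (0 : R) 1) _ (mI i)).
rewrite E fineD// addrAC subrr add0r fine_ge0 ?measure_ge0//=.
rewrite -lee_fin fineK//.
apply: (@le_trans _ _ (\int[lebesgue_measure]_(t in `]x, z]) cst (normal_peak 1)%:E t)%E).
  apply: ge0_le_integral => //.
  - by move=> t _; rewrite lee_fin normal_pdf_ge0.
  - apply/measurable_EFinP; apply: measurable_funTS; exact: measurable_normal_pdf.
  - by move=> t _; rewrite lee_fin normal_pdf_ub// oner_neq0.
rewrite integral_cst// EFinM; apply: lee_pmul => //.
  by rewrite lee_fin normal_peak_ge0.
rewrite [leLHS](lebesgue_measure_itv `]x, z])/= lte_fin; case: ifP => // _.
by rewrite lee_fin subr_ge0.
Qed.

Lemma continuous_std_normal_cdf : continuous (@std_normal_cdf R).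
Proof.
have lip (x z : R) : `|std_normal_cdf x - std_normal_cdf z| <= normal_peak 1 * `|x - z|.
  have [xz|/ltW zx] := leP x z.
    rewrite distrC (distrC x) (ger0_norm (_ : 0 <= z - x)) ?subr_ge0//.
    by have /andP[h ?] := std_normal_cdf_increment xz; rewrite ger0_norm.
  rewrite (ger0_norm (_ : 0 <= x - z)) ?subr_ge0//.
  by have /andP[h ?] := std_normal_cdf_increment zx; rewrite ger0_norm.
have pk : 0 < normal_peak (1 : R) by rewrite normal_peak_gt0// oner_neq0.
move=> x; apply/cvgrPdist_le => e e0.
have d0 : 0 < e / normal_peak 1 by rewrite divr_gt0.
exists (e / normal_peak 1) => //= z xz; apply: le_trans (lip _ _) _.
by rewrite mulrC -ler_pdivlMr// ltW.
Qed.

Lemma rate_limit_continuous (Delta c : R) : 0 <= c ->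
  {for c, continuous (fun f : R => std_normal_cdf (- Delta / (2 * Num.sqrt (1 + f))))}.
Proof.
move=> c0.
apply: (@continuous_comp R R R (fun f => - Delta / (2 * Num.sqrt (1 + f))) (@std_normal_cdf R));
  last exact: continuous_std_normal_cdf.
apply: cvgM; first exact: cvg_cst.
apply: (@cvgV _ _ _ _ (fun f : R => 2 * Num.sqrt (1 + f))).
  by rewrite mulf_neq0 ?pnatr_eq0// gt_eqF// sqrtr_gt0 ltr_pwDl.
apply: cvgM; first exact: cvg_cst.
apply: (@continuous_comp R R R (fun f => 1 + f) Num.sqrt).
  by apply: cvgD; [exact: cvg_cst | exact: cvg_id].
exact: sqrt_continuous.
Qed.

Lemma rate_limitE (Delta y : R) : 0 < y -> y < 1 ->
  - Delta / (2 * Num.sqrt (1 + y / (1 - y))) = - (Delta / 2) * Num.sqrt (1 - y).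
Proof.
move=> y0 y1; have y1' : 0 < 1 - y by rewrite subr_gt0.
have -> : 1 + y / (1 - y) = (1 - y)^-1 by field; rewrite gt_eqF.
rewrite sqrtrV ?ltW// invfM invrK.
by field.
Qed.

End normal_cdf.

Section sample_measurability.
Context {R : realType} d (T : measurableType d) (P : probability T R).

Lemma mvn_measurable p (mu : 'cV[R]_p) (Sigma : 'M[R]_p) (X : T -> 'cV[R]_p) :
  multivariate_normal P mu Sigma X -> mxmeas X.
Proof.
move=> [A [Z [_ _ _ XE]]]; rewrite (_ : X = fun w => mu + A *m \col_i Z i w); last first.
  by apply/funext => w; exact: XE.
apply: mxmeas_add; first exact: mxmeas_cst.
apply: mxmeas_mul; first exact: mxmeas_cst.
by move=> i j; under eq_fun do rewrite mxE; exact: measurable_funP.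
Qed.

Lemma sigma_vec_measurable p (X : T -> 'cV[R]_p) : mxmeas X ->
  sigma_vec X `<=` measurable.
Proof.
move=> mX; apply: smallest_sub; first exact: sigma_algebra_measurable.
by move=> _ [i _ [B mB <-]]; exact: mX.
Qed.

Lemma sigma_vecs_measurable (I : Type) p (X : I -> T -> 'cV[R]_p) :
  (forall i, mxmeas (X i)) -> sigma_vecs X `<=` measurable.
Proof.
move=> mX; apply: smallest_sub; first exact: sigma_algebra_measurable.
by move=> A [i _]; exact: sigma_vec_measurable.
Qed.

End sample_measurability.

Section rate_concentration.
Context {R : realType} d (T : measurableType d) (P : probability T R).

(** Outside two null sets, where the formula for [r] fails or the Gram matrix is singular, [r] is a
    fixed function of |beta|^2. By the last hypothesis a deviation of [r] then forces one of
    |beta|^2. *)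
Lemma rate_concentration (p n1 n2 : nat) (mu1 mu2 : 'cV[R]_p) (Sigma : 'M[R]_p)
    (X1 : 'I_n1 -> T -> 'cV[R]_p) (X2 : 'I_n2 -> T -> 'cV[R]_p) (r : T -> R)
    (Delta c L e eps eta : R) :
  mu1 <> mu2 -> Sigma \in unitmx ->
  Num.sqrt (bilin (mu1 - mu2) (invmx Sigma) (mu1 - mu2)) = Delta ->
  (forall j, multivariate_normal P mu1 Sigma (X1 j)) ->
  (forall j, multivariate_normal P mu2 Sigma (X2 j)) ->
  mutually_independent P (fun i => sigma_vec (pool X1 X2 i)) ->
  measurable_fun setT r ->
  {ae P, forall w,
     let delta := mu1 - mu2 in
     let Sinv := invmx (pooled_cov (X1 ^~ w) (X2 ^~ w)) in
     r w = std_normal_cdf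
       (- bilin delta Sinv delta /
        (2 * Num.sqrt (bilin delta (Sinv *m Sigma *m Sinv) delta)))} ->
  (0 < n1)%N -> (0 < n2)%N -> (1 < p)%N -> (p + 2 <= n1 + n2)%N ->
  0 < eta -> eta < 2^-1 -> 0 < eps ->
  `|p.-1%:R / (n1 + n2 - p)%:R - c| <= eps / 2 ->
  4 * eta * (c + eps / 2) <= eps / 2 ->
  (forall f, `|f - c| <= eps ->
    `|std_normal_cdf (- Delta / (2 * Num.sqrt (1 + f))) - L| <= e) ->
  (P [set w | (e < `|r w - L|)%R] <=
   (expR (- eta ^+ 2 / 12) ^+ p.-1 *+ 2 +
    expR (- eta ^+ 2 / 12) ^+ (n1 + n2 - p) *+ 2)%:E)%E.
Proof.
case: p mu1 mu2 Sigma X1 X2 => [//|[//|k]] mu1 mu2 Sigma X1 X2.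
case: n1 X1 => // n1 X1; case: n2 X2 => // n2 X2.
move=> hmu Su hD hX1 hX2 hX mr [A [mA A0 hA]] _ _ _ kn eta0 eta1 eps0 qc etac hL.
(* [n1] and [n2] are now the sample sizes minus one; the margin of 2 in [p + 2 <= n1 + n2] pays for
   this. *)
have kN : (k.+2 <= n1 + n2)%N by lia.
have N0 : (n1 + n2 != 0)%N by lia.
have [Z gZ [D0 fE]] := rate_argument hmu Su hD hX1 hX2 hX N0.
have NE : (n1.+1 + n2.+1 - k.+2 = n1 + n2 - k)%N by lia.
rewrite NE in qc *; rewrite -[k.+2.-1]/k.+1 in qc *.
have mG := mxmeas_mxfam (std_gauss_vec gZ).
have mG1 := mxmeas_mxfam (std_gauss_vec (std_gauss_inj (@lows_inj _ _) gZ)).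
have mg := mxmeas_cvfam (std_gauss_vec (std_gauss_inj (@top_inj _ _) gZ)).
pose f w := sqnorm (regr (mxfam (fun i => Z (lows i) w)) (cvfam (fun j => Z (top k.+1 j) w))).
pose B := [set w | gram (mxfam (Z ^~ w)) \notin unitmx].
pose C := [set w | gram (mxfam (fun i => Z (lows i) w)) \in unitmx /\ eps < `|f w - c|].
have mB : measurable B.
  by apply: measurable_bool_set; apply: measurable_neg; apply: measurable_unitmx; exact: mxmeas_gram.
have mf : measurable_fun setT f by apply: measurable_sqnorm; exact: mxmeas_regr.
have mC : measurable C.
  apply: measurableI.
    by apply: measurable_bool_set; apply: measurable_unitmx; exact: mxmeas_gram.
  apply: measurable_bool_set; apply: measurable_fun_ltr => //.
  by apply: measurableT_comp => //; exact: measurable_funB.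
have PC := regr_concentration (ltnW kN) eta0 eta1 eps0 qc etac gZ.
have PB := gram_unit_ae kN gZ.
apply: (@le_trans _ _ (P (A `|` (B `|` C)))).
  apply: le_measure; rewrite ?inE.
  - apply: measurable_bool_set; apply: measurable_fun_ltr => //.
    by apply: measurableT_comp => //; exact: measurable_funB.
  - by apply: measurableU => //; exact: measurableU.
  - move=> w /= far; have [Aw|nAw] := pselect (A w); first by left.
    right; have [Wu|] := boolP (gram (mxfam (Z ^~ w)) \in unitmx); last by left.
    right; split.
      by move: Wu; rewrite mxfam_col_mx gram_col_mx_unit => /andP[].
    rewrite ltNge; apply/negP => near; move: far; apply/negP; rewrite -leNgt.
    have rE : r w = std_normal_cdf (- Delta / (2 * Num.sqrt (1 + f w))).
      by rewrite -(fE _ Wu); apply: contrapT => h; apply: nAw; apply: hA.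
    by rewrite rE; exact: hL.
apply: le_trans (measureU2 _ _ _) _ => //; first exact: measurableU.
rewrite [X in (X + _)%E]A0 add0e.
apply: le_trans (measureU2 _ _ _) _ => //.
by rewrite [X in (X + _)%E]PB add0e.
Qed.

End rate_concentration.

(** * Limits of the degrees of freedom *)

Section limits.
Context {R : realType}.
Variables (p n : nat -> nat) (y : R).
Hypotheses (hn : n m @[m --> \oo] --> \oo) (hy1 : y < 1).
Hypothesis hratio : (p m)%:R / (n m)%:R @[m --> \oo] --> y.

Lemma ratio_lt : \forall m \near \oo, (p m)%:R < (y + 1) / 2 * (n m)%:R :> R.
Proof.
have h : y < (y + 1) / 2 by move: hy1; lra.
have hn0 : \forall m \near \oo, (0 < n m)%N by move/cvgnyPgt: hn; exact.
near=> m.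
have nm : 0 < (n m)%:R :> R by rewrite ltr0n; near: m.
rewrite -ltr_pdivrMr//; near: m.
exact: (cvgr_lt _ hratio).
Unshelve. all: by end_near. Qed.

(** Eventually p / n stays below the midpoint of y and 1, so n - p is at least n (1 - y) / 2. *)
Lemma codim_cvgy : (n m - p m)%N @[m --> \oo] --> \oo.
Proof.
apply/cvgnyPge => A.
have h : 0 < (1 - y) / 2 by move: hy1; lra.
pose M := Num.truncn (A%:R / ((1 - y) / 2)).
have hM : \forall m \near \oo, (M.+1 <= n m)%N by move/cvgnyPge: hn; exact.
near=> m.
have h1 : (p m)%:R < (y + 1) / 2 * (n m)%:R :> R by near: m; exact: ratio_lt.
have h2 : A%:R / ((1 - y) / 2) <= (n m)%:R :> R.
  apply: le_trans (_ : M.+1%:R <= _); first exact/ltW/truncnS_gt.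
  by rewrite ler_nat; near: m.
rewrite ler_pdivrMr// in h2.
rewrite leq_subRL; last first.
  rewrite -(ler_nat R); apply: ltW; apply: lt_le_trans h1 _.
  by rewrite ler_piMl//; move: hy1; lra.
rewrite -(ler_nat R) natrD; nra.
Unshelve. all: by end_near. Qed.

Lemma inv_size_cvg0 : ((n m)%:R^-1 : R) @[m --> \oo] --> 0.
Proof.
apply/gtr0_cvgV0; last exact/cvgrnyP.
by move/cvgnyPgt: hn => /(_ 0); apply: filterS => m; rewrite ltr0n.
Qed.

Lemma odds_cvg : (\forall m \near \oo, (0 < p m)%N) ->
  ((p m).-1%:R / (n m - p m)%:R : R) @[m --> \oo] --> y / (1 - y).
Proof.
move=> p0.
(* Numerator and denominator divided by n; the predecessor of p becomes the term 1 / n. *)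
have h1 : ((p m)%:R / (n m)%:R - (n m)%:R^-1) / (1 - (p m)%:R / (n m)%:R) @[m --> \oo]
    --> (y - 0) / (1 - y).
  apply: cvgM; first by apply: cvgB => //; exact: inv_size_cvg0.
  apply: cvgV; first by rewrite subr_eq0 gt_eqF.
  by apply: cvgB => //; exact: cvg_cst.
rewrite subr0 in h1; apply: cvg_trans h1; apply: near_eq_cvg.
near=> m.
have n0 : (0 < n m)%N by near: m; move/cvgnyPgt: hn; exact.
have np0 : (0 < n m - p m)%N by near: m; move/cvgnyPgt: codim_cvgy; exact.
have pm0 : (0 < p m)%N by near: m.
rewrite natrB; last by rewrite -subn_gt0 in np0; lia.
have -> : (p m).-1%:R = (p m)%:R - 1 :> R by rewrite -[in RHS](prednK pm0) -natr1 addrK.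
have n0' : 0 < (n m)%:R :> R by rewrite ltr0n.
have pn' : (p m)%:R < (n m)%:R :> R by rewrite ltr_nat; lia.
by field; rewrite !gt_eqF// ?subr_gt0// ?divr_gt0.
Unshelve. all: by end_near. Qed.

End limits.

Lemma exprn_cvg0 {R : realType} (x : R) (f : nat -> nat) : 0 <= x -> x < 1 ->
  f m @[m --> \oo] --> \oo -> x ^+ f m @[m --> \oo] --> 0.
Proof.
move=> x0 x1 hf; apply: (cvg_comp f (fun k => x ^+ k) hf).
by apply: cvg_expr; rewrite ger0_norm.
Qed.

(** * The conditional misclassification rate *)

Section conditional_probability.
Context {R : realType} d (T : measurableType d) (P : probability T R).

(** The comparison takes place on the space carrying only [<<s C>>], with the image of [P] under the
    identity: there [f] and [g] are measurable and have equal integrals over all measurable sets.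
    The exceptional set lies in [<<s C>>], hence is null for [P]. *)
Lemma cond_prob_unique (C : set (set T)) (E : set T) (f g : T -> R) :
    <<s C>> `<=` measurable ->
    cond_prob_version P <<s C>> E f ->
    measurable_fun setT (g : g_sigma_algebraType C -> R) -> (forall w, 0 <= g w) ->
    (forall A, <<s C>> A -> (\int[P]_(w in A) (g w)%:E)%E = P (A `&` E)) ->
  {ae P, forall w, f w = g w}.
Proof.
move=> hC [mf intf hf] mg g0 hg.
pose TC := g_sigma_algebraType C.
have mid : measurable_fun setT (fun w : T => w : TC).
  by move=> _ A mA; rewrite setTI; exact: hC.
pose X : {mfun T >-> TC} := HB.pack (fun w : T => w : TC) (isMeasurableFun.Build _ _ _ _ _ mid).
have mf' : measurable_fun setT (f : TC -> R).
  by move=> _ B mB; rewrite setTI; exact: mf.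
have := @integral_ae_eq _ TC R (distribution P X) setT measurableT
  (fun w => (g w)%:E) (fun w => (f w)%:E).
have ifX : (distribution P X).-integrable setT (fun w : TC => (f w)%:E).
  apply: (@integrable_pushforward _ _ _ _ _ X) => //.
  exact/measurable_EFinP.
move=> /(_ ifX); case.
- exact/measurable_EFinP.
- move=> A _ mA.
  rewrite [LHS](@integral_pushforward _ _ _ _ _ X)//; last 2 first.
  + exact/measurable_EFinP.
  + exact: (integrableS measurableT (hC _ mA) (@subsetT _ _) intf).
  rewrite [RHS](@ge0_integral_pushforward _ _ _ _ _ X)//; last 2 first.
  + by apply/measurable_EFinP; exact: measurable_funTS.
  + by move=> w _; rewrite lee_fin.
  by rewrite [LHS](hf _ mA) [RHS](hg _ mA).
- move=> A [mA A0 hA]; exists A; split => //; first exact: hC.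
  by move=> w /= fg; apply: hA => /= /(_ I) -[].
Qed.

(** The freezing lemma. Two sigma-algebras on the same space are seen as two coordinates, and the
    event lives on the diagonal of their product. *)
Lemma cond_prob_indep (C D : set (set T)) (f : T -> R)
    (K : set (g_sigma_algebraType C * g_sigma_algebraType D)) :
    <<s C>> `<=` measurable -> <<s D>> `<=` measurable ->
    independent2 P <<s D>> <<s C>> -> measurable K ->
    cond_prob_version P <<s C>> [set w | K (w, w)] f ->
  {ae P, forall w, f w = fine (P [set w' | K (w, w')])}.
Proof.
move=> hC hD CD mK cf.
pose TC := g_sigma_algebraType C; pose TD := g_sigma_algebraType D.
have mC : measurable_fun setT (fun w : T => w : TC).
  by move=> _ A mA; rewrite setTI; exact: hC.
have mD : measurable_fun setT (fun w : T => w : TD).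
  by move=> _ A mA; rewrite setTI; exact: hD.
have mself d' (U : measurableType d') : @measurable _ U = <<s @measurable _ U >>.
  by rewrite sigma_algebra_id//; exact: sigma_algebra_measurable.
have ind A B : @measurable _ TC A -> @measurable _ TD B ->
    P [set w | A w /\ B w] = (P A * P B)%E.
  by move=> mA mB; rewrite muleC -(CD _ _ mB mA); congr (P _); rewrite setIC.
have fub := @indep_fubini _ _ _ P _ TC _ TD _ _ mC mD _ _ (mself _ TC) (mself _ TD)
  measurableT measurableT (@measurableI _ TC) (@measurableI _ TD) ind.
have msec (w : TC) : measurable [set w' : T | K (w, w')].
  apply: hD; have := measurable_xsection w mK.
  by congr measurable; apply/seteqP; split => w'; rewrite /xsection/= inE.
have fin (w : TC) : P [set w' | K (w, w')] \is a fin_num by exact: fin_num_measure.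
pose Y : {mfun T >-> TD} := HB.pack (fun w : T => w : TD) (isMeasurableFun.Build _ _ _ _ _ mD).
apply: (cond_prob_unique hC cf).
- apply: (measurableT_comp (fine_measurable measurableT)).
  apply: (eq_measurable_fun (fun w : TC => distribution P Y (xsection K w))).
    move=> w _ /=; congr (P _); apply/seteqP; split => w'; by rewrite /xsection/= inE.
  exact: measurable_fun_xsection.
- by move=> w; rewrite fine_ge0.
- move=> A mA.
  have mAT : measurable A by exact: hC.
  transitivity (\int[P]_(w in A) P [set w' | K (w, w')])%E.
    by apply: eq_integral => w _; rewrite fineK.
  rewrite integral_mkcond.
  have := fub [set z | A z.1 /\ K z].
  (* Restricting [K] to [A] in the first coordinate turns the defining identity of a conditional
     probability into Fubini for one set. *)
  have mAK : measurable [set z : TC * TD | A z.1 /\ K z].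
    apply: measurableI => //.
    rewrite -[X in measurable X]setTI.
    exact: (@measurable_fst _ _ TC TD measurableT A mA).
  move=> /(_ mAK) E; transitivity (P [set w | A w /\ K (w, w)]) => //.
  rewrite [RHS]E; apply: eq_integral => w _; rewrite patchE; case: ifPn.
    by rewrite inE => Aw; congr (P _); apply/seteqP; split => w' //= [].
  rewrite notin_setE => nAw; rewrite (_ : [set w' | _] = set0) ?measure0//.
  by apply/seteqP; split => w' //= [].
Qed.

End conditional_probability.

(** * Error probabilities of a fixed linear rule *)

Section class_probability.
Context {R : realType} d (T : measurableType d) (P : probability T R).

Lemma std_normal_cdf_open (x : R) : fine (normal_prob (0 : R) 1 `]-oo, x[) = std_normal_cdf x.
Proof.
rewrite /std_normal_cdf; congr fine.
have -> : `]-oo, x]%classic = `]-oo, x[ `|` [set x] :> set R by rewrite setUitv1.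
rewrite [RHS](measureU (normal_prob (0 : R) 1)).
- by rewrite [X in (_ + X)%E]normal_prob_point adde0.
- exact: (@measurable_itv R `]-oo, x[).
- exact: (@measurable_set1 R x).
by apply/seteqP; split => // t [] /=; rewrite in_itv/= => /[swap] ->; rewrite ltxx.
Qed.

(** By symmetry and the absence of atoms; this value is what the degenerate rules in [class_rate]
    need. *)
Lemma std_normal_cdf0 : std_normal_cdf (0 : R) = 2^-1.
Proof.
have mI (i : interval R) : measurable ([set` i] : set (measurableTypeR R)).
  exact: measurable_itv.
have fin (i : interval R) : normal_prob (0 : R) 1 [set` i] \is a fin_num.
  exact: (@fin_num_measure _ _ _ (normal_prob (0 : R) 1) _ (mI i)).
pose I1 : set R := `]-oo, 0]%classic; pose I2 : set R := `]0, +oo[%classic.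
pose I3 : set R := `]-oo, 0[%classic.
have E : (normal_prob (0 : R) 1 I1 + normal_prob (0 : R) 1 I2 = 1)%E.
  rewrite -(measureU (normal_prob (0 : R) 1)); last 3 first.
  - exact: mI.
  - exact: mI.
  - by apply/seteqP; split => // t; rewrite /I1 /I2/= !in_itv/= andbT => -[h1 h2]; lra.
  by rewrite /I1 /I2 itv_setU_setT [LHS]probability_setT.
have E2 : normal_prob (0 : R) 1 I2 = normal_prob (0 : R) 1 I3.
  rewrite -normal_probN; last exact: mI.
  congr (normal_prob 0 1 _); apply/seteqP; split => t; rewrite /I2 /I3/= !in_itv/= andbT.
    by rewrite oppr_gt0.
  by rewrite oppr_gt0.
have E3 : fine (normal_prob (0 : R) 1 I1) + fine (normal_prob (0 : R) 1 I3) = 1.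
  by rewrite -E2 -fineD; [rewrite E | exact: fin | exact: fin].
have := E3; rewrite [X in _ + X](std_normal_cdf_open 0) -/(std_normal_cdf 0).
move: (std_normal_cdf 0) => u; lra.
Qed.

(** Rotating [v] to c e_0 makes the linear form [c] times one standard normal coordinate. *)
Lemma std_gauss_linear k (Z : 'I_k.+1 -> T -> R) (v : 'cV[R]_k.+1) (c : R) (B : set R) :
    std_gauss P Z -> sqnorm v = c ^+ 2 -> measurable B ->
  P [set w | B ((v^T *m \col_i Z i w) 0 0)] = normal_prob 0 1 [set t | B (c * t)].
Proof.
move=> gZ cv mB.
have [H hH Hv] : exists2 H : 'M[R]_k.+1, orthomx H & H *m v = c *: delta_mx 0 0.
  exact: reflection_to_axis.
have gH := std_gauss_orthomx hH gZ.
have mB' : measurable [set t : R | B (c * t)].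
  by apply: measurable_preim mB; exact: measurable_funM.
rewrite -(std_gauss_mul_one 0 gH mB'); congr (P _).
suff vE w : (v^T *m \col_i Z i w) 0 0 = c * mulfam H Z 0 w.
  by apply/seteqP; split => w; rewrite /= vE.
have -> : v^T = c *: (delta_mx 0 0)^T *m H.
  by rewrite -[LHS]mulmx1 -(orthomx_tr hH) mulmxA -trmx_mul Hv trmxZ.
rewrite -!scalemxAl mxE trmx_delta -mulmxA -rowE !mxE; congr (_ * _).
by apply: eq_bigr => i _; rewrite !mxE.
Qed.

Lemma bilinDl p (u v : 'cV[R]_p) M w : bilin (u + v) M w = bilin u M w + bilin v M w.
Proof.
rewrite /bilin (_ : (u + v)^T = u^T + v^T) ?mulmxDl ?mxE//.
by apply/matrixP => i j; rewrite !mxE.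
Qed.

Lemma bilinZl p c (u : 'cV[R]_p) M w : bilin (c *: u) M w = c * bilin u M w.
Proof. by rewrite /bilin trmxZ -!scalemxAl mxE. Qed.

(** Centred at the midpoint, the score has mean a / 2 under class 1 and - a / 2 under class 2, with
    variance [b] in both cases, so the two errors coincide. Singular [M] is included. *)
Lemma class_rate p (mu1 mu2 : 'cV[R]_p) (Sigma M : 'M[R]_p) (Y1 Y2 : T -> 'cV[R]_p) :
    Sigma \in unitmx -> M^T = M ->
    multivariate_normal P mu1 Sigma Y1 -> multivariate_normal P mu2 Sigma Y2 ->
  let delta := mu1 - mu2 in let m := 2^-1 *: (mu1 + mu2) in
  (fine (P [set w | ~~ (0 < bilin (Y1 w - m) M delta)]) +
   fine (P [set w | 0 < bilin (Y2 w - m) M delta])) / 2 =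
  std_normal_cdf (- bilin delta M delta /
    (2 * Num.sqrt (bilin delta (M *m Sigma *m M) delta))).
Proof.
case: p mu1 mu2 Sigma M Y1 Y2 => [|k] mu1 mu2 Sigma M Y1 Y2 Su MT hY1 hY2 delta m.
  (* In dimension 0 every score is 0, class 2 is always chosen, and both sides equal 1/2. *)
  have b0 (u v : 'cV[R]_0) N : bilin u N v = 0.
    by rewrite /bilin [u](_ : _ = 0) ?trmx0 ?mul0mx ?mxE//; apply/colP => -[].
  have -> : [set w | ~~ (0 < bilin (Y1 w - m) M delta)] = setT.
    by apply/seteqP; split => // w _ /=; rewrite b0 ltxx.
  have -> : [set w | 0 < bilin (Y2 w - m) M delta] = set0.
    by apply/seteqP; split => // w /=; rewrite b0 ltxx.
  by rewrite probability_setT measure0 /= !b0 oppr0 mul0r std_normal_cdf0 addr0 mul1r.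
have [A1 [Z1 [AA1 dZ1 iZ1 Y1E]]] := hY1; have [A2 [Z2 [AA2 dZ2 iZ2 Y2E]]] := hY2.
have g1 := std_gauss_of_independent dZ1 iZ1; have g2 := std_gauss_of_independent dZ2 iZ2.
set a := bilin delta M delta; set b := bilin delta (M *m Sigma *m M) delta.
pose v A : 'cV[R]_k.+1 := A^T *m (M *m delta).
have v2 A : A *m A^T = Sigma -> sqnorm (v A) = b.
  move=> AA; rewrite sqnorm_dot /v /b /bilin -AA; congr (fun_of_matrix _ _ _).
  by rewrite !trmx_mul trmxK MT !mulmxA.
have b0 : 0 <= b by rewrite -(v2 _ AA1) sqnorm_ge0.
set s := Num.sqrt b; have s2 : s ^+ 2 = b by rewrite sqr_sqrtr.
have s0 : 0 <= s by rewrite sqrtr_ge0.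
have formE A mu (z : 'cV[R]_k.+1) : bilin (mu + A *m z - m) M delta =
    bilin (mu - m) M delta + ((v A)^T *m z) 0 0.
  rewrite addrAC bilinDl; congr (_ + _); rewrite /bilin.
  have -> : (v A)^T *m z = ((A *m z)^T *m M *m delta)^T.
    by rewrite /v !trmx_mul !trmxK MT !mulmxA.
  by rewrite [RHS]mxE.
have f1 : bilin (mu1 - m) M delta = a / 2.
  rewrite (_ : _ - _ = 2^-1 *: delta) ?bilinZl 1?mulrC//.
  by apply/colP => i; rewrite !mxE; field.
have f2 : bilin (mu2 - m) M delta = - (a / 2).
  rewrite (_ : _ - _ = - 2^-1 *: delta) ?bilinZl ?mulNr 1?mulrC//.
  by apply/colP => i; rewrite !mxE; field.
have mpos x : measurable_fun setT (fun t : R => 0 < x + t).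
  by apply: measurable_fun_ltr => //; exact: measurable_funD.
have P1 : P [set w | ~~ (0 < bilin (Y1 w - m) M delta)] =
    normal_prob 0 1 [set t | ~~ (0 < a / 2 + s * t)].
  have := @std_gauss_linear _ _ (v A1) s [set t | ~~ (0 < a / 2 + t)] g1.
  rewrite v2// => /(_ (esym s2)) <-; last first.
    by apply: measurable_bool_set; apply: measurable_neg; exact: mpos.
  by congr (P _); apply/seteqP; split => w /=; rewrite Y1E formE f1.
(* Writing the deviation with - s makes this error event a left half-line ending at the same point
   as for class 1, only open. *)
have P2 : P [set w | 0 < bilin (Y2 w - m) M delta] =
    normal_prob 0 1 [set t | 0 < - (a / 2) + - s * t].
  have := @std_gauss_linear _ _ (v A2) (- s) [set t | 0 < - (a / 2) + t] g2.
  rewrite v2// sqrrN => /(_ (esym s2)) <-; last first.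
    by apply: measurable_bool_set; exact: mpos.
  by congr (P _); apply/seteqP; split => w /=; rewrite Y2E formE f2.
rewrite P1 P2; have [s00|sn0] := eqVneq s 0.
  (* Zero variance means A^T M delta = 0 with [A] invertible. The score is then identically 0 and
     the rate is 1/2, in agreement with division by zero giving argument 0. *)
  have Md : M *m delta = 0.
    have /eqP := v2 _ AA1; rewrite -s2 s00 expr0n/= sqnorm_eq0 => /eqP v0.
    have A1u : A1 \in unitmx by move: Su; rewrite -AA1 unitmx_mul unitmx_tr andbb.
    have A1u' : A1^T \in unitmx by rewrite unitmx_tr.
    by rewrite -[LHS](mulKmx A1u') -/(v A1) v0 mulmx0.
  have a0 : a = 0 by rewrite /a /bilin -mulmxA Md mulmx0 mxE.
  rewrite a0 s00.
  have -> : [set t : R | ~~ (0 < 0 / 2 + 0 * t)] = setT.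
    by apply/seteqP; split => // t _ /=; rewrite !mul0r addr0 ltxx.
  have -> : [set t : R | 0 < - (0 / 2) + - 0 * t] = set0.
    by apply/seteqP; split => // t /=; rewrite !mul0r !oppr0 mul0r addr0 ltxx.
  rewrite [X in fine X]probability_setT measure0 /= addr0 mul1r.
  by rewrite oppr0 mul0r std_normal_cdf0.
have sp : 0 < s by rewrite lt0r sn0.
have -> : [set t : R | ~~ (0 < a / 2 + s * t)] = `]-oo, - a / (2 * s)]%classic.
  apply/seteqP; split => t; rewrite /= in_itv/= -leNgt ler_pdivlMr ?mulr_gt0//; lra.
have -> : [set t : R | 0 < - (a / 2) + - s * t] = `]-oo, - a / (2 * s)[%classic.
  apply/seteqP; split => t; rewrite /= in_itv/= ltr_pdivlMr ?mulr_gt0//; lra.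
rewrite [X in _ + X](std_normal_cdf_open (- a / (2 * s))).
have half (x : R) : (x + x) / 2 = x by lra.
exact: half.
Qed.

End class_probability.

Section rate_formula.
Context {R : realType} d (T : measurableType d) (P : probability T R).

Lemma pooled_cov_sym p n1 n2 (x1 : 'I_n1 -> 'cV[R]_p) (x2 : 'I_n2 -> 'cV[R]_p) :
  (pooled_cov x1 x2)^T = pooled_cov x1 x2.
Proof.
have ssym n (x : 'I_n -> 'cV[R]_p) : (scatter x)^T = scatter x.
  by rewrite /scatter raddf_sum; apply: eq_bigr => j _; rewrite /= trmx_mul trmxK.
rewrite /pooled_cov trmxZ -[in RHS](ssym n1) -[in RHS](ssym n2); congr (_ *: _).
by apply/matrixP => i j; rewrite !mxE.
Qed.

Lemma mxmeas_scatter d' (U : measurableType d') p n (X : 'I_n -> U -> 'cV[R]_p) :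
  (forall j, mxmeas (X j)) -> mxmeas (fun w => scatter (X ^~ w)).
Proof.
move=> mX; apply: mxmeas_sum => j.
have mc : mxmeas (fun w => X j w - sample_mean (X ^~ w)).
  apply: mxmeas_sub => //; apply: mxmeas_scale => //; exact: mxmeas_sum.
by apply: mxmeas_mul => //; exact: mxmeas_tr.
Qed.

Lemma mxmeas_pooled_cov d' (U : measurableType d') p n1 n2
    (X1 : 'I_n1 -> U -> 'cV[R]_p) (X2 : 'I_n2 -> U -> 'cV[R]_p) :
  (forall j, mxmeas (X1 j)) -> (forall j, mxmeas (X2 j)) ->
  mxmeas (fun w => pooled_cov (X1 ^~ w) (X2 ^~ w)).
Proof.
move=> m1 m2; apply: mxmeas_scale => //.
by apply: mxmeas_add; exact: mxmeas_scatter.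
Qed.

Lemma measurable_bilin d' (U : measurableType d') p (u : U -> 'cV[R]_p) (M : U -> 'M[R]_p)
    (v : 'cV[R]_p) :
  mxmeas u -> mxmeas M -> measurable_fun setT (fun w => bilin (u w) (M w) v).
Proof.
move=> mu mM; have := mxmeas_mul (mxmeas_mul (mxmeas_tr mu) mM) (mxmeas_cst v).
exact.
Qed.

Lemma mxmeas_comp d1 (U : measurableType d1) d2 (V : measurableType d2) m n
    (F : V -> 'M[R]_(m, n)) (h : U -> V) :
  mxmeas F -> measurable_fun setT h -> mxmeas (F \o h).
Proof. by move=> mF mh i j; exact: (measurableT_comp (mF i j) mh). Qed.

(** No invertibility of the pooled covariance is required: [invmx] of a symmetric matrix is
    symmetric even when it is a default value, and [class_rate] accepts it. *)
Lemma rate_formula (p n1 n2 : nat) (mu1 mu2 : 'cV[R]_p) (Sigma : 'M[R]_p)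
    (X1 : 'I_n1 -> T -> 'cV[R]_p) (X2 : 'I_n2 -> T -> 'cV[R]_p) (Y1 Y2 : T -> 'cV[R]_p)
    (r : T -> R) :
  Sigma \in unitmx ->
  (forall j, multivariate_normal P mu1 Sigma (X1 j)) ->
  (forall j, multivariate_normal P mu2 Sigma (X2 j)) ->
  multivariate_normal P mu1 Sigma Y1 -> multivariate_normal P mu2 Sigma Y2 ->
  independent2 P (sigma_vec Y1) (sigma_vecs (pool X1 X2)) ->
  independent2 P (sigma_vec Y2) (sigma_vecs (pool X1 X2)) ->
  lda2_rate P mu1 mu2 X1 X2 Y1 Y2 r ->
  measurable_fun setT r /\
  {ae P, forall w,
     let delta := mu1 - mu2 in
     let Sinv := invmx (pooled_cov (X1 ^~ w) (X2 ^~ w)) in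
     r w = std_normal_cdf
       (- bilin delta Sinv delta /
        (2 * Num.sqrt (bilin delta (Sinv *m Sigma *m Sinv) delta)))}.
Proof.
move=> Su hX1 hX2 hY1 hY2 i1 i2 [e1 [e2 [c1 c2 rE]]].
have mpool j : mxmeas (pool X1 X2 j).
  by case: j => j; apply: mvn_measurable; [exact: hX1 | exact: hX2].
have hG := sigma_vecs_measurable mpool.
split.
  have me (e : T -> R) E : cond_prob_version P (sigma_vecs (pool X1 X2)) E e ->
      measurable_fun setT e.
    by move=> [me _ _] _ B mB; rewrite setTI; apply: hG; exact: me.
  rewrite (_ : r = fun w => (e1 w + e2 w) / 2); last by apply/funext => w; exact: rE.
  by apply: measurable_funM => //; apply: measurable_funD; [exact: me c1 | exact: me c2].
pose C := \bigcup_(i in [set: 'I_n1 + 'I_n2]) sigma_vec (pool X1 X2 i).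
pose D (Y : T -> 'cV[R]_p) := \bigcup_(i in [set: 'I_p]) g_sigma_algebra_preimage (fun w => Y w i 0).
pose TC := g_sigma_algebraType C.
pose S (w : TC) := pooled_cov (X1 ^~ w) (X2 ^~ w).
have mX j : @mxmeas R _ TC _ _ (pool X1 X2 j).
  move=> i k mT B mB; rewrite ord1; apply: sub_sigma_algebra; exists j => //.
  exact: (@measurable_coord_sigma_vec _ _ T p (pool X1 X2 j) i measurableT _ mB).
have mS : mxmeas S.
  by apply: mxmeas_pooled_cov => j; [exact: (mX (inl j)) | exact: (mX (inr j))].
(* The score as a function of two points: the sample is read at the first, the new observation at
   the second; on the diagonal it is the actual score. *)
pose s (Y : T -> 'cV[R]_p) (z : TC * g_sigma_algebraType (D Y)) :=
  bilin (Y z.2 - 2^-1 *: (mu1 + mu2)) (invmx (S z.1)) (mu1 - mu2).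
have ms Y : measurable_fun setT (@s Y).
  have mY : @mxmeas R _ (g_sigma_algebraType (D Y)) _ _ Y.
    by move=> i j; rewrite ord1; exact: measurable_coord_sigma_vec.
  apply: measurable_bilin.
    apply: mxmeas_sub; last exact: mxmeas_cst.
    exact: (mxmeas_comp mY measurable_snd).
  apply: mxmeas_inv; exact: (mxmeas_comp mS measurable_fst).
have mpos Y : measurable [set z | 0 < @s Y z].
  by apply: measurable_bool_set; exact: measurable_fun_ltr.
have mneg Y : measurable [set z | ~~ (0 < @s Y z)].
  by apply: measurable_bool_set; apply: measurable_neg; exact: measurable_fun_ltr.
have hD (Y : T -> 'cV[R]_p) mu : multivariate_normal P mu Sigma Y -> <<s D Y >> `<=` measurable.
  by move=> /mvn_measurable; exact: sigma_vec_measurable.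
have u1 := cond_prob_indep hG (hD _ _ hY1) i1 (mneg Y1) c1.
have u2 := cond_prob_indep hG (hD _ _ hY2) i2 (mpos Y2) c2.
apply: filterS2 u1 u2 => w h1 h2; cbv zeta.
have MT : (invmx (S w))^T = invmx (S w) by rewrite trmx_inv pooled_cov_sym.
by rewrite -(class_rate Su MT hY1 hY2) rE h1 h2.
Qed.

End rate_formula.

Theorem theorem2p2 (R : realType)
    (p n1 n2 : nat -> nat)
    (mu1 mu2 : forall m, 'cV[R]_(p m)) (Sigma : forall m, 'M[R]_(p m))
    (d : nat -> measure_display) (T : forall m, measurableType (d m))
    (P : forall m, probability (T m) R)
    (X1 : forall m, 'I_(n1 m) -> T m -> 'cV[R]_(p m))
    (X2 : forall m, 'I_(n2 m) -> T m -> 'cV[R]_(p m))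
    (Y1 Y2 : forall m, T m -> 'cV[R]_(p m))
    (R_LDA2 : forall m, T m -> R) (y Delta : R)
    (hn1 : forall m, (0 < n1 m)%N) (hn2 : forall m, (0 < n2 m)%N)
    (hp : p m @[m --> \oo] --> \oo)
    (hn : (n1 m + n2 m)%N @[m --> \oo] --> \oo)
    (hy0 : 0 < y) (hy1 : y < 1)
    (hratio : (p m)%:R / (n1 m + n2 m)%:R @[m --> \oo] --> y)
    (hmu : forall m, mu1 m <> mu2 m)
    (hSigma : forall m, covariance_mx (Sigma m) /\ Sigma m \in unitmx)
    (hDelta : forall m,
      Num.sqrt (bilin (mu1 m - mu2 m) (invmx (Sigma m)) (mu1 m - mu2 m))
      = Delta)
    (hX1 : forall m j, multivariate_normal (P m) (mu1 m) (Sigma m) (X1 m j))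
    (hX2 : forall m j, multivariate_normal (P m) (mu2 m) (Sigma m) (X2 m j))
    (hX : forall m, mutually_independent (P m)
      (fun i => sigma_vec (pool (X1 m) (X2 m) i)))
    (hY1 : forall m, multivariate_normal (P m) (mu1 m) (Sigma m) (Y1 m))
    (hY2 : forall m, multivariate_normal (P m) (mu2 m) (Sigma m) (Y2 m))
    (hY1X : forall m, independent2 (P m)
      (sigma_vec (Y1 m)) (sigma_vecs (pool (X1 m) (X2 m))))
    (hY2X : forall m, independent2 (P m)
      (sigma_vec (Y2 m)) (sigma_vecs (pool (X1 m) (X2 m))))
    (hR : forall m, lda2_rate (P m) (mu1 m) (mu2 m) (X1 m) (X2 m)
      (Y1 m) (Y2 m) (R_LDA2 m)) :
  (forall m, {ae P m, forall w,
     let delta := mu1 m - mu2 m in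
     let Sinv := invmx (pooled_cov (X1 m ^~ w) (X2 m ^~ w)) in
     R_LDA2 m w = std_normal_cdf
       (- bilin delta Sinv delta /
        (2 * Num.sqrt (bilin delta (Sinv *m Sigma m *m Sinv) delta)))})
  /\ cvg_in_probability P R_LDA2
       (std_normal_cdf (- (Delta / 2) * Num.sqrt (1 - y))).

Proof.
have form m := rate_formula (hSigma m).2 (@hX1 m) (@hX2 m) (hY1 m) (hY2 m)
  (hY1X m) (hY2X m) (hR m).
split=> [m|]; first exact: (form m).2.
move=> e e0; rewrite -rate_limitE//.
set c := y / (1 - y).
have c0 : 0 <= c by rewrite divr_ge0 ?subr_ge0 ?ltW.
have := @rate_limit_continuous R Delta c c0 => /cvgrPdist_le/(_ _ e0)[/= eps0 eps00 near_c].
(* Half the continuity radius, so that the closed bound on |f - c| falls inside the open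
   neighbourhood. *)
pose eps := eps0 / 2.
have eps_gt0 : 0 < eps by rewrite divr_gt0.
(* The first bound keeps [eta] below 1/2; the second is the inequality 4 eta (c + eps / 2) <= eps /
   2 solved for [eta]. *)
pose eta := Num.min (4^-1) (eps / (8 * (c + eps / 2))).
have ce0 : 0 < c + eps / 2 by rewrite ltr_wpDl// divr_gt0.
have eta0 : 0 < eta.
  by rewrite lt_min invr_gt0 ltr0n/= divr_gt0// mulr_gt0.
have eta1 : eta < 2^-1 by rewrite gt_min; apply/orP; left; lra.
have etac : 4 * eta * (c + eps / 2) <= eps / 2.
  have : eta <= eps / (8 * (c + eps / 2)) by rewrite ge_min lexx orbT.
  rewrite ler_pdivlMr ?mulr_gt0//; lra.
pose q : R := expR (- eta ^+ 2 / 12).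
have q0 : 0 <= q by exact: expR_ge0.
have q1 : q < 1.
  by rewrite -expR0 ltr_expR mulNr oppr_lt0 divr_gt0// exprn_gt0.
have p2 : \forall m \near \oo, (1 < p m)%N by move/cvgnyPgt: hp; exact.
have p0 : \forall m \near \oo, (0 < p m)%N by move/cvgnyPgt: hp; exact.
have codim := codim_cvgy hn hy1 hratio.
have odds := odds_cvg hn hy1 hratio p0.
(* The exponents p - 1 and n - p both tend to infinity, while [q] < 1 depends on [e], [y] and
   [Delta] but not on [m]. *)
apply: (@squeeze_cvge _ _ _ _ (fun=> 0%E) _
  (fun m => (q ^+ (p m).-1 *+ 2 + q ^+ (n1 m + n2 m - p m) *+ 2)%:E)).
- have eps2 : 0 < eps / 2 by rewrite divr_gt0.
  have near_odds : \forall m \near \oo,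
      `|c - (p m).-1%:R / (n1 m + n2 m - p m)%:R| <= eps / 2.
    exact: (cvgrPdist_le _ _).1 odds _ eps2.
  have codim2 : \forall m \near \oo, (2 <= n1 m + n2 m - p m)%N.
    by move/cvgnyPge: codim; exact.
  near=> m.
  apply/andP; split; first exact: measure_ge0.
  have hc : (2 <= n1 m + n2 m - p m)%N by near: m.
  apply: (rate_concentration (hmu m) (hSigma m).2 (hDelta m) (@hX1 m) (@hX2 m) (hX m)
    (form m).1 (form m).2 (hn1 m) (hn2 m) _ _ eta0 eta1 eps_gt0 _ etac).
  + by near: m.
  + by move: hc; rewrite ltn_subRL addn1 addn2.
  + by rewrite distrC; near: m.
  + move=> f fc; rewrite distrC; apply: near_c.
    by rewrite /= distrC; apply: le_lt_trans fc _; rewrite /eps; lra.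
- exact: cvg_cst.
- apply: cvg_EFin; first exact: nearW.
  have pd : (p m).-1 @[m --> \oo] --> \oo.
    apply/cvgnyPge => A; move/cvgnyPgt: hp => /(_ A).
    by apply: filterS => m; case: (p m).
  have h1 := exprn_cvg0 q0 q1 pd; have h2 := exprn_cvg0 q0 q1 codim.
  have := cvgD (cvgD h1 h1) (cvgD h2 h2); rewrite !addr0.
  exact.
Unshelve. all: by end_near. Qed.
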